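(* Let $\beta>0$, $\lambda\in\mathbb R$, $h=0$, and let $A(\beta,\lambda)=\lim_{N\to\infty}A_N(\beta,\lambda)$. Then $$A(\beta,\lambda)=\inf_{x\in\mathcal X}\hat A(\beta,\lambda;x),$$ $$\hat A(\beta,\lambda;x)=\log\sigma(Q)+\frac12\beta^2\sigma^2(Q)\int_0^Q\frac{dq}{1-\beta^2\sigma^2(Q)\int_q^Qx(q')dq'}+\frac{\beta^2}{4}Q^2-\frac{\beta^2}{2}\int_0^Qq\,x(q)\,dq,$$ and the infimum is attained at the replica symmetric order parameter: $Q=q^{RS}$ and $x\equiv0$ on $[0,q^{RS})$ (i.e. $K=1$, $m_1=0$), where $q^{RS}=0$ if $\lambda<1$ and $\beta\le1-\lambda$, and $q^{RS}=\frac{\beta-(1-\lambda)}{\beta^2}$ if $\beta>1-\lambda$.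
   Context: For $N\ge1$, $J=(J_{ij})_{i,j=1}^N$ i.i.d. $\mathcal N(0,1)$ over all ordered pairs, $\mathbb E_z$ the standard Gaussian measure on $\mathbb R^N$, $Z_N(\beta,\lambda;J)=\mathbb E_z\exp\big(\frac{\beta}{\sqrt{2N}}\sum_{i,j}J_{ij}z_iz_j-\frac{\beta^2}{4N}(\sum_iz_i^2)^2+\frac\lambda2\sum_iz_i^2\big)$ and $A_N(\beta,\lambda)=\frac1N\mathbb E\log Z_N$. $\mathcal X$ is the set of pairs $(Q,x)$ with $Q\ge0$, $1-\lambda+\beta^2Q>0$, and $x:[0,Q]\to[0,1]$ a nondecreasing piecewise constant function (given by $0=q_0\le\dots\le q_K=Q$, $0\le m_1\le\dots\le m_K\le1$, $x=m_a$ on $[q_{a-1},q_a)$) such that $\beta^2\sigma^2(Q)\int_q^Qx(q')dq'<1$ for all $q\in[0,Q]$; here $\sigma(Q)=(1-\lambda+\beta^2Q)^{-1/2}$. *)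

(* Defs.v *)
From HB Require Import structures.
From mathcomp Require Import all_boot all_order all_algebra.
From mathcomp Require Import all_classical all_reals all_analysis.
Set Implicit Arguments. Unset Strict Implicit. Unset Printing Implicit Defensive.
Import Order.TTheory GRing.Theory Num.Theory.
Import numFieldNormedType.Exports.
Local Open Scope classical_set_scope.
Local Open Scope ring_scope.

Section Defs.
Variable R : realType.

Fixpoint gauss_exp (n : nat) (f : seq R -> \bar R) : \bar R :=
  match n with
  | 0 => f [::]
  | n'.+1 => (\int[normal_prob (0:R) 1]_x gauss_exp n' (fun s => f (x :: s)))%E
  end.

Definition hamil (beta lambda : R) (N : nat) (J z : seq R) : R :=
  let Jij i j := nth 0 J (i * N + j)%N in
  let zi i := nth 0 z i in
  let S := \sum_(i < N) zi i ^+ 2 in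
  beta / Num.sqrt (2 * N%:R) * (\sum_(i < N) \sum_(j < N) Jij i j * zi i * zi j)
  - beta ^+ 2 / (4 * N%:R) * S ^+ 2 + lambda / 2 * S.

Definition ZN (beta lambda : R) (N : nat) (J : seq R) : \bar R :=
  gauss_exp N (fun z => (expR (hamil beta lambda N J z))%:E).

Definition AN (beta lambda : R) (N : nat) : \bar R :=
  ((N%:R)^-1)%:E * gauss_exp (N * N) (fun J => (ln (fine (ZN beta lambda N J)))%:E).

(* Parameters (Q, x): x is given by K, 0 = q_0 <= ... <= q_K = Q and
   m_1 <= ... <= m_K, with x = m_a on [q_{a-1}, q_a). *)
Record xpar := XPar { xQ : R; xK : nat; xq : nat -> R; xm : nat -> R }.

Definition xfun (p : xpar) (t : R) : R :=
  \sum_(1 <= a < (xK p).+1)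
     (if (xq p a.-1 <= t) && (t < xq p a) then xm p a else 0).

Definition sigma (beta lambda Q : R) : R :=
  (Num.sqrt (1 - lambda + beta ^+ 2 * Q))^-1.

Definition int_ab (a b : R) (f : R -> R) : R :=
  Rintegral lebesgue_measure `[a, b] f.

Definition inX (beta lambda : R) (p : xpar) : Prop :=
  let Q := xQ p in let K := xK p in let q := xq p in let m := xm p in
  0 <= Q /\ 0 < 1 - lambda + beta ^+ 2 * Q /\
  (0 < K)%N /\ q 0%N = 0 /\ q K = Q /\
  (forall a, (a < K)%N -> q a <= q a.+1) /\
  (forall a, (1 <= a <= K)%N -> 0 <= m a <= 1) /\
  (forall a, (1 <= a < K)%N -> m a <= m a.+1) /\
  (forall t, 0 <= t <= Q ->
        beta ^+ 2 * sigma beta lambda Q ^+ 2 * int_ab t Q (xfun p) < 1).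

Definition Ahat (beta lambda : R) (p : xpar) : R :=
  let Q := xQ p in let s := sigma beta lambda Q in
  ln s
  + 1 / 2 * beta ^+ 2 * s ^+ 2 *
      int_ab 0 Q (fun t => (1 - beta ^+ 2 * s ^+ 2 * int_ab t Q (xfun p))^-1)
  + beta ^+ 2 / 4 * Q ^+ 2
  - beta ^+ 2 / 2 * int_ab 0 Q (fun t => t * xfun p t).

Definition qRS (beta lambda : R) : R :=
  if beta <= 1 - lambda then 0 else (beta - (1 - lambda)) / beta ^+ 2.

Definition xRS (beta lambda : R) : xpar :=
  XPar (qRS beta lambda) 1 (fun a => if a is 0%N then 0 else qRS beta lambda)
       (fun _ => 0).

End Defs.

(* Main.v *)
Require Import Defs.
From HB Require Import structures.
From mathcomp Require Import all_boot all_order all_algebra.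
From mathcomp Require Import all_classical all_reals all_analysis.
From mathcomp Require Import measurable_realfun ring lra.
Import Order.TTheory GRing.Theory Num.Theory.
Import numFieldNormedType.Exports.
Set Implicit Arguments. Unset Strict Implicit. Unset Printing Implicit Defensive.
Local Open Scope classical_set_scope.
Local Open Scope ring_scope.

(* Lower bound.  Let w be a near-maximizer of the quadratic form of J on a sphere, and shift
   z = sqrt(s) y + w.  Apply Jensen's inequality with respect to the Gibbs measure of y at
   the subcritical inverse temperature beta s < 1, restricted to the band |y|^2 ~ N; the
   terms odd in w disappear on averaging over w and -w.  What remains is that
   (i) this Gibbs measure has annealed free energy and small overlap, by the
   Guerra-Toninelli quadratic coupling of two replicas, whose annealed partition function
   is a one-dimensional gaussian integral; and (ii) the mean of the top eigenvalue is at
   least sqrt(2N)(1 - o(1)).  For (ii) the test vector has entries given by sums over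
   self-avoiding paths: distinct path monomials are orthogonal, fourth moments are
   controlled by hypercontractivity, and Efron-Stein bounds the variance of the top
   eigenvalue.

   Upper bound.  Guerra's interpolation between the couplings J and independent random
   fields of variance beta^2 Q, along a circle.  The inequality |m|^4 <= |<z z^T>|^2
   (Frobenius norm) for m = <z> turns the derivative into a constant minus a square, so
   only averages over one replica enter, and at the end of the path the partition function
   is a product of one-body gaussian integrals.

   Variational problem.  With v = sigma(Q)^-2 and u(t) = v - beta^2 int_t^Q x, integrating
   int q x(q) dq by parts turns the functional into
   -(ln v)/2 + (1/2) int_0^Q (beta^2/u + u) - v Q/2 + beta^2 Q^2/4.  The integrand is at
   least 2 beta and, where 1 - lambda + beta^2 t >= beta, at least its value at
   u = 1 - lambda + beta^2 t <= u(t); the replica symmetric point attains these bounds. *)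

(** * Gaussian integration *)

(** The free energy is never differentiated along an interpolation. Jensen's inequality between two
    nearby parameter values bounds its increment from both sides by a first-order term, up to an
    error quadratic in the step; for fixed N, m steps of size 1/m leave an error of order 1/m. This
    needs bounded observables only, and the cutoffs to a ball or to a band make the coupling
    coefficients bounded. The quartic term of the Hamiltonian is half the variance of the gaussian
    term, so the first-order contribution of squares in a single replica cancels and only overlaps
    remain. The lower bound needs beta s < 1, since the annealed two-replica bound blows up there; s
    is therefore taken just below 1 / max(beta, 1 - lambda), the maximizer of the bound, and the
    loss vanishes in the limit. The shift vector depends on the disorder, which is harmless: for
    each J it is eliminated in favour of the top eigenvalue before any average over J is taken. *)

Section normal_density_integral.
Variables (R : realType) (m s : R).
Local Notation mu := (@lebesgue_measure R).
Local Notation TR := (measurableTypeR R).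
Local Notation N := (@normal_prob R m s).

Let mpdf : measurable_fun [set: TR] (fun x : TR => (normal_pdf m s x)%:E).
Proof. by apply: measurableT_comp => //; exact: measurable_normal_pdf. Qed.

Let integral_normal_indic (E : set TR) : measurable E ->
  (\int[N]_x (\1_E x)%:E = \int[mu]_x ((\1_E x)%:E * (normal_pdf m s x)%:E))%E.
Proof.
move=> mE; rewrite integral_indic// setIT /= /normal_prob integral_mkcond.
apply: eq_integral => x _; rewrite patchE indicE; case: ifPn => _.
  by rewrite mul1e.
by rewrite mul0e.
Qed.

Import HBNNSimple.

Let integral_normal_nnsfun (f : {nnsfun TR >-> R}) :
  (\int[N]_x (f x)%:E = \int[mu]_x ((f x)%:E * (normal_pdf m s x)%:E))%E.
Proof.
have mf1 r : measurable (f @^-1` [set r]).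
  exact: measurable_funPTI.
under [LHS]eq_integral do rewrite fimfunE -fsumEFin//.
rewrite [LHS]ge0_integral_fsum//; last 2 first.
  - by move=> r; apply/measurable_EFinP/measurable_funM => //; apply: measurable_indic; exact: mf1.
  - by move=> n x _; rewrite EFinM nnfun_muleindic_ge0.
under [RHS]eq_integral.
  move=> x xD; rewrite fimfunE -fsumEFin// ge0_mule_fsuml; last first.
    by move=> r; rewrite EFinM nnfun_muleindic_ge0.
  over.
rewrite [RHS]ge0_integral_fsum//; last 2 first.
  - move=> r; apply: emeasurable_funM => //.
    by apply/measurable_EFinP/measurable_funM => //; apply: measurable_indic; exact: mf1.
  - by move=> r x _; rewrite mule_ge0 ?EFinM ?nnfun_muleindic_ge0// lee_fin normal_pdf_ge0.
apply: eq_fsbigr => r _.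
under [LHS]eq_integral do rewrite EFinM.
rewrite integralZl_indic_nnsfun//.
rewrite integral_normal_indic; last exact: mf1.
rewrite /=; have [r0|r0] := ltP r 0.
  rewrite preimage_nnfun0//; under [in RHS]eq_integral do rewrite indic0 mulr0 mul0e.
  by under [in LHS]eq_integral do rewrite indic0 mul0e; rewrite !integral0 mule0.
rewrite -ge0_integralZl//.
- by apply: eq_integral => x _; rewrite EFinM muleA.
- apply: emeasurable_funM => //; apply/measurable_EFinP/measurable_indic.
  exact: mf1.
- by move=> x _; rewrite mule_ge0// lee_fin ?normal_pdf_ge0// indicE.
Qed.

Lemma ge0_integral_normal_prob (f : TR -> \bar R) :
  measurable_fun setT f -> (forall x, 0 <= f x)%E ->
  (\int[N]_x f x = \int[mu]_x (f x * (normal_pdf m s x)%:E))%E.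
Proof.
move=> mf f0; pose f_ := nnsfun_approx measurableT mf.
transitivity (limn (fun n => \int[N]_x (f_ n x)%:E)%E).
  rewrite -monotone_convergence//=.
  - apply: eq_integral => x _; apply/esym/cvg_lim => //.
    exact: cvg_nnsfun_approx.
  - by move=> n; exact/measurable_EFinP/measurable_funTS.
  - by move=> *; rewrite lee_fin.
  - by move=> x _ a b ab; rewrite lee_fin; exact/lefP/nd_nnsfun_approx.
under eq_fun do rewrite integral_normal_nnsfun.
rewrite -monotone_convergence//=.
- apply: eq_integral => x _; apply/cvg_lim => //.
  by apply: cvgeZr => //; exact: cvg_nnsfun_approx.
- by move=> n; apply: emeasurable_funM => //; exact/measurable_EFinP/measurable_funTS.
- by move=> *; rewrite mule_ge0// lee_fin// normal_pdf_ge0.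
- move=> x _ a b ab; apply: lee_wpmul2r; first by rewrite lee_fin normal_pdf_ge0.
  by rewrite lee_fin; exact/lefP/nd_nnsfun_approx.
Qed.

End normal_density_integral.

Ltac meas := repeat first
  [ exact: measurable_cst | exact: measurable_id | assumption
  | exact: measurable_tnth | exact: measurable_fst | exact: measurable_snd
  | apply: measurable_funD | apply: measurable_funB | apply: measurable_funM
  | apply: measurable_funX | apply: measurable_funN
  | (apply: (measurableT_comp (@measurable_expR _)))
  | (apply: (measurableT_comp (@measurable_ln _)))
  | (apply: (measurableT_comp (@normr_measurable _ setT)))
  | (apply: measurable_sum => ?)
  | (apply: (measurableT_comp (@EFin_measurable _ setT))) ].

Section gaussian_tuple.
Variable R : realType.
Local Notation TR := (measurableTypeR R).

Definition idTR (x : TR) : R := x.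
Lemma measurable_idTR : measurable_fun setT idTR.
Proof. by move=> _ Y mY; rewrite setTI. Qed.
HB.instance Definition _ := isMeasurableFun.Build _ _ _ _ idTR measurable_idTR.

(* [normal_prob] transported to the canonical sigma-algebra of [R], whose display differs *)
Definition gauss1 : probability R R :=
  [the probability _ _ of distribution (normal_prob (0:R) 1) (idTR : {mfun _ >-> _})].

Lemma ge0_integral_gauss1 (f : R -> \bar R) : measurable_fun setT f ->
  (forall x, 0 <= f x)%E ->
  (\int[gauss1]_x f x = \int[normal_prob (0:R) 1]_x f x)%E.
Proof. by move=> mf f0; rewrite ge0_integral_distribution. Qed.

Lemma integral_gauss1 (f : R -> \bar R) : gauss1.-integrable setT f ->
  (\int[gauss1]_x f x = \int[normal_prob (0:R) 1]_x f x)%E.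
Proof.
move=> fi.
have mf : measurable_fun setT f by exact: measurable_int fi.
rewrite integral_pushforward//.
apply/integrableP; split => //.
move/integrableP : fi => [_].
rewrite ge0_integral_pushforward//.
exact: measurableT_comp.
Qed.

Lemma ge0_integral_gauss1_lebesgue (f : R -> \bar R) : measurable_fun setT f ->
  (forall x, 0 <= f x)%E ->
  (\int[gauss1]_x f x = \int[lebesgue_measure]_x (f x * (normal_pdf 0 1 x)%:E))%E.
Proof. by move=> mf f0; rewrite ge0_integral_gauss1// ge0_integral_normal_prob. Qed.

Definition consT n (p : R * n.-tuple R) : n.+1.-tuple R := [tuple of p.1 :: p.2].
Lemma measurable_consT n : measurable_fun setT (@consT n).
Proof. exact: (@measurable_cons _ _ _ _ fst n snd). Qed.
HB.instance Definition _ n :=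
  isMeasurableFun.Build _ _ _ _ (@consT n) (@measurable_consT n).

(** The product measure is built coordinate by coordinate, in the same recursion as [gauss_exp], so
    that the iterated integrals of the statement become integrals against a single measure. *)
Fixpoint gaussT n : probability (n.-tuple R) R :=
  match n with
  | 0 => [the probability _ R of dirac [tuple]]
  | n'.+1 => [the probability _ R of
      distribution (gauss1 \x gaussT n')%E (@consT n' : {mfun _ >-> _})]
  end.

Lemma ge0_integral_gaussTS n (f : n.+1.-tuple R -> \bar R) :
  measurable_fun setT f -> (forall x, 0 <= f x)%E ->
  (\int[gaussT n.+1]_x f x =
   \int[gauss1]_x \int[gaussT n]_s f [tuple of x :: s])%E.
Proof.
move=> mf f0; rewrite [gaussT n.+1]/= ge0_integral_distribution//.
rewrite (fubini_tonelli1 (f \o @consT n))//.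
  by apply: measurableT_comp => //; exact: measurable_consT.
by move=> x; exact: f0.
Qed.

Lemma integral_gaussTS n (f : n.+1.-tuple R -> \bar R) :
  (gaussT n.+1).-integrable setT f ->
  (\int[gaussT n.+1]_x f x =
   \int[gauss1]_x \int[gaussT n]_s f [tuple of x :: s])%E.
Proof.
move=> fi; have mf : measurable_fun setT f by exact: measurable_int fi.
have fi2 : (gauss1 \x gaussT n)%E.-integrable setT (f \o @consT n).
  apply/integrableP; split; first exact: measurableT_comp.
  move/integrableP : fi => [_]; rewrite [gaussT n.+1]/=.
  by rewrite ge0_integral_pushforward//; exact: measurableT_comp.
rewrite [gaussT n.+1]/= integral_pushforward//.
by rewrite -integral12_prod_meas1.
Qed.

Lemma integral_gaussT0 (f : 0.-tuple R -> \bar R) : measurable_fun setT f ->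
  (\int[gaussT 0]_x f x = f [tuple])%E.
Proof. by move=> mf; rewrite /= integral_dirac// diracT mul1e. Qed.

Lemma measurable_section n (f : n.+1.-tuple R -> \bar R) x :
  measurable_fun setT f -> measurable_fun setT (fun s : n.-tuple R => f [tuple of x :: s]).
Proof.
move=> mf; apply: measurableT_comp => //.
by apply: measurable_cons => //; exact: measurable_cst.
Qed.

Lemma measurable_ge0_inner n (f : n.+1.-tuple R -> \bar R) :
  measurable_fun setT f -> (forall x, 0 <= f x)%E ->
  measurable_fun setT (fun x : R => (\int[gaussT n]_s f [tuple of x :: s])%E).
Proof.
move=> mf f0; apply: (measurable_fun_fubini_tonelli_F (f \o @consT n)) => //.
  by apply: measurableT_comp => //; exact: measurable_consT.
by move=> x; exact: f0.
Qed.

Lemma gauss_exp_ge0 n (f : seq R -> \bar R) :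
  measurable_fun setT (fun x : n.-tuple R => f x) ->
  (forall x, 0 <= f x)%E ->
  gauss_exp n f = (\int[gaussT n]_x f x)%E.
Proof.
elim: n f => [|n IH] f mf f0; first by rewrite integral_gaussT0.
rewrite ge0_integral_gaussTS//= -ge0_integral_gauss1; last 2 first.
- rewrite (_ : (fun x => _) = (fun x : R => (\int[gaussT n]_s f (x :: s))%E)).
    exact: measurable_ge0_inner mf _.
  apply/funext => x; apply: IH => //; exact: (measurable_section x mf).
- move=> x; rewrite IH//; first exact: integral_ge0.
  exact: (measurable_section x mf).
apply: eq_integral => x _; rewrite IH//; exact: (measurable_section x mf).
Qed.

End gaussian_tuple.

Section one_dimensional_gaussian.
Variable R : realType.
Local Notation TR := (measurableTypeR R).
Local Notation mu := (@lebesgue_measure R).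
Local Notation phi := (@normal_pdf R 0 1).

Lemma phiE (x : R) : phi x = (Num.sqrt (pi *+ 2))^-1 * expR (- (x ^+ 2) / 2).
Proof.
by rewrite normal_pdfE ?oner_eq0// /normal_peak /normal_fun subr0 expr1n mul1r -[1 *+ 2]/2%:R.
Qed.

(** Completing the square: an exponential of a quadratic times the standard density is a multiple of
    the normal density of mean b / v and variance 1 / v. All gaussian integrals computed explicitly
    below reduce to this one. *)
Lemma normal_pdf_shift (b v x : R) : 0 < v ->
  expR (b * x - (v - 1) * x ^+ 2 / 2) * phi x =
  (Num.sqrt v)^-1 * expR (b ^+ 2 / (2 * v)) * normal_pdf (b / v) (Num.sqrt v)^-1 x.
Proof.
move=> v0.
have s0 : Num.sqrt v != 0 by rewrite gt_eqF// sqrtr_gt0.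
rewrite phiE normal_pdfE ?invr_eq0// /normal_peak /normal_fun.
rewrite exprVn sqr_sqrtr ?ltW//.
have -> : (Num.sqrt (v^-1 * pi *+ 2))^-1 = Num.sqrt v * (Num.sqrt (pi *+ 2))^-1.
  rewrite -mulrnAr sqrtrM ?invr_ge0 ?ltW// invfM; congr (_ * _).
  by rewrite sqrtrV ?invrK// ltW.
rewrite mulrCA -expRD.
rewrite [RHS](_ : _ = (Num.sqrt (pi *+ 2))^-1 *
   (expR (b ^+ 2 / (2 * v)) * expR (- (x - b / v) ^+ 2 / (v^-1 *+ 2)))); last first.
  move: (Num.sqrt v) s0 (Num.sqrt (pi *+ 2))^-1 (expR _) (expR _) => a a0 c e1 e2.
  by field.
rewrite -expRD; congr (_ * expR _).
by rewrite -[v^-1 *+ 2]mulr_natr; field; rewrite gt_eqF.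
Qed.

Lemma gauss1_quadratic (b v : R) : 0 < v ->
  (\int[@gauss1 R]_x (expR (b * x - (v - 1) * x ^+ 2 / 2))%:E =
   ((Num.sqrt v)^-1 * expR (b ^+ 2 / (2 * v)))%:E)%E.
Proof.
move=> v0.
have mf : measurable_fun [set: R] (fun x : R => expR (b * x - (v - 1) * x ^+ 2 / 2)).
  by meas.
rewrite ge0_integral_gauss1_lebesgue//=; last by meas.
under eq_integral do rewrite -EFinM normal_pdf_shift// EFinM.
rewrite ge0_integralZl//=; last 2 first.
- by apply/measurable_EFinP; exact: measurable_normal_pdf.
- by move=> x _; rewrite lee_fin normal_pdf_ge0.
by rewrite integral_normal_pdf mule1.
Qed.

Lemma gauss1_mgf (b : R) :
  (\int[@gauss1 R]_x (expR (b * x))%:E = (expR (b ^+ 2 / 2))%:E)%E.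
Proof.
have := gauss1_quadratic b (@ltr01 R).
under eq_integral do rewrite subrr !mul0r subr0.
by rewrite sqrtr1 invr1 mul1r mulr1.
Qed.

Definition affR (s w : R) (x : TR) : TR := s * x + w.

Lemma measurable_affR s w : measurable_fun setT (affR s w).
Proof. by apply: measurable_funD => //; apply: measurable_funM. Qed.

Definition lebesgue_aff (s w : R) : {measure set TR -> \bar R} :=
  measure_function_pushforward__canonical__measure_function_Measure mu
    (measurable_affR s w).

Lemma lebesgue_measure_aff (s : {nonneg R}) (w : R) (A : set TR) : 0 < s%:num ->
  measurable A -> mscale s (lebesgue_aff s%:num w) A = mu A.
Proof.
move=> s0 mA; apply/esym; apply: (@lebesgue_measure_unique _ (mscale s (lebesgue_aff s%:num w))) => //= _ [[a b]] _ <-.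
rewrite /mscale/= /pushforward.
rewrite (_ : _ @^-1` _ = `](a - w) / s%:num, (b - w) / s%:num]%classic); last first.
  apply/seteqP; split => x /=; rewrite !in_itv/= /affR ltr_pdivrMr// ler_pdivlMr//.
    by rewrite ltrBlDr lerBrDr mulrC.
  by rewrite ltrBlDr lerBrDr mulrC.
rewrite !lebesgue_measure_itv/= !lte_fin ltr_pM2r ?invr_gt0// ltrD2r.
case: ifPn => // ab; rewrite ?mule0// -!EFinB -EFinM; congr (_%:E).
by field; rewrite gt_eqF.
Qed.

Lemma ge0_integral_lebesgue_aff (s w : R) (f : TR -> \bar R) : 0 < s ->
  measurable_fun setT f -> (forall x, 0 <= f x)%E ->
  (\int[mu]_x f x = \int[mu]_x (s%:E * f (s * x + w)%R))%E.
Proof.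
move=> s0 mf f0; pose s' := NngNum (ltW s0).
rewrite (@eq_measure_integral _ _ _ _ (mscale s' (lebesgue_aff s w))); last first.
  by move=> A mA _; exact/esym/(@lebesgue_measure_aff s').
rewrite ge0_integral_mscale//= ge0_integral_pushforward//=; last exact: measurable_affR.
rewrite ge0_integralZl//.
- by apply: (@measurableT_comp _ _ _ _ _ _ f _ (affR s w)) => //; exact: measurable_affR.
- by rewrite lee_fin ltW.
Qed.

(** The weight is the Jacobian s times the ratio of the standard densities at s x + w and at x. *)
Lemma gauss1_aff (s w : R) (f : R -> \bar R) : 0 < s ->
  measurable_fun setT f -> (forall x, 0 <= f x)%E ->
  (\int[@gauss1 R]_x f x = \int[@gauss1 R]_x
     (f (s * x + w)%R * (s * expR ((x ^+ 2 - (s * x + w) ^+ 2) / 2))%:E))%E.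
Proof.
move=> s0 mf f0.
have mphi : measurable_fun [set: R] (fun x : R => (phi x)%:E).
  by apply: measurableT_comp => //; exact: measurable_normal_pdf.
have maff : measurable_fun [set: R] (fun x : R => s * x + w).
  by apply: measurable_funD => //; exact: measurable_funM.
rewrite !ge0_integral_gauss1_lebesgue//; last 2 first.
- apply: emeasurable_funM => //; first exact: measurableT_comp.
  apply: measurableT_comp => //; apply: measurable_funM => //.
  apply: measurableT_comp => //; apply: measurable_funM => //.
  by apply: measurable_funB; exact: measurable_funX.
- by move=> x; rewrite mule_ge0// lee_fin mulr_ge0 ?expR_ge0// ltW.
rewrite (ge0_integral_lebesgue_aff w s0); last 2 first.
- exact: emeasurable_funM.
- by move=> x; rewrite mule_ge0// lee_fin normal_pdf_ge0.
apply: eq_integral => x _; rewrite muleCA -!muleA; congr (_ * _)%E.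
rewrite -!EFinM; congr EFin; rewrite !phiE -mulrA; congr (_ * _).
rewrite [RHS]mulrCA; congr (_ * _); rewrite -expRD; congr expR.
by field.
Qed.

End one_dimensional_gaussian.

Section gaussian_integration_by_parts.
Variable R : realType.
Local Notation TR := (measurableTypeR R).
Local Notation mu := (@lebesgue_measure R).
Local Notation phi := (@normal_pdf R 0 1).
Local Notation g1 := (@gauss1 R).

Lemma measurable_phi : measurable_fun [set: R] phi.
Proof. exact: measurable_normal_pdf. Qed.

Lemma integral_gauss1_lebesgue (f : R -> \bar R) : measurable_fun setT f ->
  (\int[g1]_x f x = \int[mu]_x (f x * (phi x)%:E))%E.
Proof.
move=> mf; rewrite integralE [RHS]integralE.
have mp : measurable_fun setT (f^\+)%E by exact: measurable_funepos.
have mn : measurable_fun setT (f^\-)%E by exact: measurable_funeneg.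
rewrite !ge0_integral_gauss1_lebesgue//.
congr (_ - _)%E; apply: eq_integral => x _.
- by rewrite !funeposE maxe_pMl ?lee_fin ?normal_pdf_ge0// mul0e.
- by rewrite !funenegE -mulNe maxe_pMl ?lee_fin ?normal_pdf_ge0// mul0e.
Qed.

Lemma expR_norm_le (x K : R) : 0 <= K -> expR (K * `|x|) <= expR (K * x) + expR (- K * x).
Proof.
move=> K0; have [x0|x0] := ger0P x; rewrite ?lerDl ?expR_ge0//.
by rewrite mulrN -mulNr lerDr expR_ge0.
Qed.

Lemma integrable_expR_norm (K : R) : 0 <= K ->
  g1.-integrable setT (fun x : R => (expR (K * `|x|))%:E).
Proof.
move=> K0; apply/integrableP; split.
  by meas.
have H b : g1.-integrable setT (fun x : R => (expR (b * x))%:E).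
  apply/integrableP; split.
    by apply/measurable_EFinP; meas.
  under eq_integral do rewrite gee0_abs ?lee_fin ?expR_ge0//.
  by rewrite gauss1_mgf ltry.
have /integrableP[_] := integrableD measurableT (H K) (H (- K)).
apply: le_lt_trans; apply: ge0_le_integral => //=.
- by meas.
- by meas.
- move=> x _; rewrite lee_fin (ger0_norm (expR_ge0 _)) (ger0_norm (addr_ge0 (expR_ge0 _) (expR_ge0 _))).
  exact: expR_norm_le.
Qed.

(** Exponential growth is preserved by sums and products and is integrable against the gaussian. One
    constant serves as prefactor and as rate; [tame1_bnd] accepts two different ones. *)
Definition tame1 (f : R -> R) := measurable_fun setT f /\
  exists2 C : R, 0 <= C & forall x, `|f x| <= C * expR (C * `|x|).

Lemma tame1_integrable (f : R -> R) : tame1 f -> g1.-integrable setT (EFin \o f).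
Proof.
move=> [mf [C C0 fC]].
apply: (@le_integrable _ _ _ _ _ _ _ (fun x : R => (C%:E * (expR (C * `|x|))%:E)%E)) => //.
- exact/measurable_EFinP.
- by move=> x _ /=; rewrite lee_fin (le_trans (fC x))// ler_norm.
- exact: integrableZl (integrable_expR_norm C0).
Qed.

Lemma cvg_gauss_tail (C : R) : 0 <= C ->
  (fun n : nat => C * expR (C * n%:R) * phi n%:R) @ \oo --> (0 : R).
Proof.
move=> C0.
have p0 : 0 <= (Num.sqrt (pi *+ 2) : R)^-1 by rewrite invr_ge0 sqrtr_ge0.
apply: (@squeeze_cvgr _ _ _ _ (fun=> 0) (fun n : nat => (C * (Num.sqrt (pi *+ 2))^-1) * n.+1%:R^-1)).
- near=> n.
  have n0 : 0 <= n%:R :> R by rewrite ler0n.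
  rewrite mulr_ge0 ?mulr_ge0 ?expR_ge0 ?normal_pdf_ge0//=.
  rewrite phiE -!mulrA ler_wpM2l// mulrCA ler_wpM2l//.
  rewrite -expRD.
  have -> : (n.+1%:R : R)^-1 = (1 + n%:R)^-1 by rewrite -natr1 addrC.
  apply: (@le_trans _ _ (expR (- n%:R))).
    rewrite ler_expR.
    (* Beyond this point n^2 / 2 - C n is at least n, so the gaussian factor leaves at most exp(-
       n), which is below 1 / (1 + n). *)
    have nC : 2 * (C + 1) <= n%:R by near: n; exact: nbhs_infty_ger.
    rewrite -subr_ge0 [leRHS](_ : _ = n%:R * (n%:R - 2 * (C + 1)) / 2); last by field.
    by rewrite mulr_ge0// mulr_ge0// subr_ge0.
  rewrite expRN lef_pV2 ?posrE ?expR_gt0 ?ltr_pwDl//.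
  exact: expR_ge1Dx.
- exact: cvg_cst.
- rewrite -[X in _ --> X](mulr0 (C * (Num.sqrt (pi *+ 2))^-1)).
  by apply: cvgMr; exact: cvg_harmonic.
Unshelve. all: end_near. Qed.

Lemma phi_even (x : R) : phi (- x) = phi x.
Proof. by rewrite !phiE sqrrN. Qed.

Lemma is_derive_phi (x : R) : is_derive x 1 phi (- x * phi x).
Proof.
have -> : (phi : R -> R) = (fun x : R => (Num.sqrt (pi *+ 2))^-1 * expR (- (x ^+ 2) / 2)).
  by apply/funext => y; rewrite phiE.
apply: is_derive_eq.
rewrite !scaler0 add0r /GRing.scale/= mulr1.
by move: (Num.sqrt (pi *+ 2))^-1 (expR _) => a e; field.
Qed.

Lemma tame1_bnd (f : R -> R) (C D : R) : measurable_fun setT f -> 0 <= C -> 0 <= D ->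
  (forall x, `|f x| <= C * expR (D * `|x|)) -> tame1 f.
Proof.
move=> mf C0 D0 fCD; split=> //; exists (C + D); first exact: addr_ge0.
move=> x; apply: (le_trans (fCD x)); apply: ler_pM => //; rewrite ?expR_ge0 ?lerDl//.
by rewrite ler_expR ler_wpM2r// lerDr.
Qed.

Lemma tame1_cst (c : R) : tame1 (fun=> c).
Proof.
by apply: (@tame1_bnd _ `|c| 0) => // x; rewrite mul0r expR0 mulr1.
Qed.

Lemma tame1_id : tame1 id.
Proof.
apply: (@tame1_bnd _ 1 1) => // x; rewrite !mul1r.
by rewrite (le_trans _ (expR_ge1Dx _))// lerDr.
Qed.

Lemma tame1D (f g : R -> R) : tame1 f -> tame1 g -> tame1 (fun x => f x + g x).
Proof.
move=> [mf [C C0 fC]] [mg [D D0 gD]].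
apply: (@tame1_bnd _ (C + D) (C + D)); rewrite ?addr_ge0//; first exact: measurable_funD.
move=> x; rewrite (le_trans (ler_normD _ _))// mulrDl lerD//.
  rewrite (le_trans (fC x))// ler_wpM2l// ler_expR ler_wpM2r// lerDl//.
by rewrite (le_trans (gD x))// ler_wpM2l// ler_expR ler_wpM2r// lerDr.
Qed.

Lemma tame1M (f g : R -> R) : tame1 f -> tame1 g -> tame1 (fun x => f x * g x).
Proof.
move=> [mf [C C0 fC]] [mg [D D0 gD]].
apply: (@tame1_bnd _ (C * D) (C + D)); rewrite ?addr_ge0 ?mulr_ge0//; first exact: measurable_funM.
move=> x; rewrite normrM mulrDl expRD mulrACA.
by apply: ler_pM.
Qed.

Lemma tame1X (f : R -> R) n : tame1 f -> tame1 (fun x => f x ^+ n).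
Proof.
move=> tf; elim: n => [|n IH]; first exact: (tame1_cst 1).
by under eq_fun do rewrite exprS; exact: tame1M.
Qed.

(** The function f phi has derivative (f' - x f) phi. Integrate it over [-n, n] and let n grow: the
    boundary terms vanish because the density beats exponential growth, and the integrals converge
    by domination. *)
Lemma gauss1_ibp (f f' : R -> R) : (forall x : R, is_derive x (1 : R) f (f' x)) ->
  continuous f' -> tame1 f -> tame1 f' ->
  \int[g1]_x (x * f x) = \int[g1]_x f' x.
Proof.
move=> df cf' tf tf'.
have cf : continuous f.
  by move=> x; apply/differentiable_continuous/derivable1_diffP; have [] := df x.
have txf : tame1 (fun x => x * f x) by apply: tame1M tame1_id tf.
pose g x := f' x + (-1) * (x * f x).
have tg : tame1 g by apply: tame1D => //; apply: tame1M => //; exact: tame1_cst.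
have ig := tame1_integrable tg.
suff : \int[g1]_x g x = 0.
  rewrite /g RintegralD//; last 2 first.
  - exact: tame1_integrable.
  - by apply: tame1_integrable; apply: tame1M => //; exact: tame1_cst.
  rewrite RintegralZl//; last exact: tame1_integrable.
  by move=> h0; apply/eqP; rewrite eq_sym -subr_eq0 -mulN1r h0.
have mg : measurable_fun [set: R] g by case: tg.
pose h x := g x * phi x.
pose F x := f x * phi x.
have dF (x : R) : is_derive x (1 : R) F (h x).
  have dfx := df x; have dphi := is_derive_phi x.
  apply: is_derive_eq.
  by rewrite /h /g /GRing.scale/=; ring.
have mh : measurable_fun [set: R] h by apply: measurable_funM => //; exact: measurable_phi.
have ihm : mu.-integrable setT (EFin \o h).
  apply/integrableP; split; first exact/measurable_EFinP.
  move/integrableP : ig => [_].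
  rewrite ge0_integral_gauss1_lebesgue//; last first.
    by apply: measurableT_comp => //; exact/measurable_EFinP.
  congr (_ < _)%E; apply: eq_integral => x _.
  by rewrite /h /= normrM (ger0_norm (normal_pdf_ge0 _ _ _)) EFinM.
rewrite /Rintegral integral_gauss1_lebesgue//; last exact/measurable_EFinP.
under eq_integral do rewrite -EFinM -/(h _).
pose hn (n : nat) (x : R) := ((EFin \o h) \_ `[- n%:R, n%:R]) x.
have h1 n : measurable_fun [set: TR] (hn n).
  apply/(measurable_restrictT _ _).1 => //.
  by apply/measurable_EFinP; exact: measurable_funTS.
have h2 : measurable_fun [set: TR] (EFin \o h) by exact/measurable_EFinP.
have h3 : {ae mu, forall x, [set: TR] x -> hn n x @[n --> \oo] --> (EFin \o h) x}.
  apply/aeW => x _; rewrite /hn.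
  apply: cvg_near_cst; near=> n.
  rewrite patchE ifT// inE/= in_itv/= -ler_norml.
  by near: n; exact: nbhs_infty_ger.
have h4 : mu.-integrable setT (fun x => `|h x|%:E) by exact: integrable_norm.
have h5 : {ae mu, forall x n, [set: TR] x -> (`|hn n x| <= (fun x => `|h x|%:E) x)%E}.
  apply/aeW => x n _; rewrite /hn patchE; case: ifPn => _ //=.
  by rewrite normr0 lee_fin.
have [_ _ cvgh] := dominated_convergence measurableT h1 h2 h3 h4 h5.
have hnE n : (0 < n)%N -> (\int[mu]_x hn n x)%E = (F n%:R - F (- n%:R))%:E.
  move=> n0; rewrite /hn -integral_mkcond.
  have nn : - n%:R < n%:R :> R by rewrite gtrN// ltr0n.
  have ch : continuous h.
    move=> x; apply: cvgM; last exact: continuous_normal_pdf.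
    apply: cvgD; first exact: cf'.
    by apply: cvgM; [exact: cvg_cst|apply: cvgM; [exact: cvg_id|exact: cf]].
  rewrite (@continuous_FTC2 _ h F)//.
  - exact: continuous_subspaceT.
  - have cF : continuous F.
      by move=> x; apply/differentiable_continuous/derivable1_diffP; have [] := dF x.
    split.
    + by move=> x _; have [] := dF x.
    + by apply: cvg_at_right_filter; exact: cF.
    + by apply: cvg_at_left_filter; exact: cF.
  - by move=> x _; rewrite derive1E; apply: derive_val.
have : (\int[mu]_x hn n x)%E @[n --> \oo] --> (0 : R)%:E.
  have [C C0 fC] := tf.2.
  have FC (x : R) : 0 <= x -> `|F x| <= C * expR (C * x) * phi x /\ `|F (- x)| <= C * expR (C * x) * phi x.
    move=> x0; rewrite /F !normrM phi_even (ger0_norm (normal_pdf_ge0 _ _ _)).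
    split; rewrite ler_wpM2r ?normal_pdf_ge0// (le_trans (fC _))// ?normrN.
      by rewrite (ger0_norm x0).
    by rewrite (ger0_norm x0).
  apply/fine_cvgP; split.
    by near=> n; rewrite hnE//; near: n; exact: nbhs_infty_gt.
  apply/norm_cvg0P.
  apply: (@squeeze_cvgr _ _ _ _ (fun=> 0) (fun n : nat => 2 * (C * expR (C * n%:R) * phi n%:R))).
  - near=> n; rewrite normr_ge0/= hnE/=; last by near: n; exact: nbhs_infty_gt.
    rewrite (le_trans (ler_normB _ _))// mulr_natl mulr2n.
    by apply: lerD; have [] := FC n%:R (ler0n _ _).
  - exact: cvg_cst.
  - rewrite -[X in _ --> X](mulr0 2); apply: cvgMr; exact: cvg_gauss_tail.
by move=> h0; rewrite (cvg_unique _ cvgh h0).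
Unshelve. all: end_near. Qed.

End gaussian_integration_by_parts.

Section real_fubini.
Context d1 d2 (T : measurableType d1) (U : measurableType d2) (R : realType).
Variables (P : probability T R) (Q : probability U R) (f : T * U -> R).
Hypothesis mf : measurable_fun setT f.

Lemma measurable_Rint_param : measurable_fun setT (fun x => \int[Q]_u f (x, u)).
Proof.
have mEf : measurable_fun setT (EFin \o f) by exact/measurable_EFinP.
rewrite /Rintegral.
apply: measurableT_comp => //.
under eq_fun do rewrite integralE.
apply: emeasurable_funB.
- rewrite (_ : (fun _ => _) = fubini_F Q ((EFin \o f)^\+)%E); last first.
    by apply/funext => x; apply: eq_integral => u _; rewrite !funeposE.
  apply: measurable_fun_fubini_tonelli_F => //; exact: measurable_funepos.
- rewrite (_ : (fun _ => _) = fubini_F Q ((EFin \o f)^\-)%E); last first.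
    by apply/funext => x; apply: eq_integral => u _; rewrite !funenegE.
  apply: measurable_fun_fubini_tonelli_F => //; exact: measurable_funeneg.
Qed.

Hypothesis intQ : forall x, Q.-integrable setT (fun u => (f (x, u))%:E).
Hypothesis intP : forall u, P.-integrable setT (fun x => (f (x, u))%:E).
Hypothesis intPQ : P.-integrable setT (fun x => (\int[Q]_u `|f (x, u)|)%:E).

Lemma RFubini : \int[P]_x \int[Q]_u f (x, u) = \int[Q]_u \int[P]_x f (x, u).
Proof.
have mEf : measurable_fun setT (EFin \o f) by exact/measurable_EFinP.
have fi : (P \x Q)%E.-integrable setT (EFin \o f).
  apply/(integrable12ltyP _ _ mEf).
  have /integrableP[_] := intPQ.
  congr (_ < _)%E; apply: eq_integral => x _.
  have iQ : Q.-integrable setT (fun u => (`|f (x, u)|)%:E) by exact: integrable_norm (intQ x).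
  rewrite gee0_abs; last by rewrite lee_fin; apply: Rintegral_ge0.
  by rewrite /Rintegral fineK//; exact: integrable_fin_num iQ.
have := Fubini fi => /= H.
rewrite /Rintegral; congr fine.
transitivity (\int[P]_x \int[Q]_y (f (x, y))%:E)%E.
  by apply: eq_integral => x _; rewrite fineK//; exact: integrable_fin_num (intQ x).
rewrite H.
by apply: eq_integral => x _; rewrite fineK//; exact: integrable_fin_num (intP x).
Qed.

End real_fubini.

(** * Functions of several gaussian variables and resampling of one coordinate *)

Section tuple_update.
Variable R : realType.

Definition upd n (x : n.-tuple R) (k : 'I_n) (t : R) : n.-tuple R :=
  [tuple if i == k then t else tnth x i | i < n].

Lemma tnth_upd n (x : n.-tuple R) k t i :
  tnth (upd x k t) i = if i == k then t else tnth x i.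
Proof. by rewrite tnth_mktuple. Qed.

Lemma upd_cons0 n x (s : n.-tuple R) t :
  upd [tuple of x :: s] ord0 t = [tuple of t :: s].
Proof.
apply: eq_from_tnth => i; rewrite tnth_upd.
case: (unliftP ord0 i) => [j ->|->]; last by rewrite eqxx !tnth0.
by rewrite eq_sym (negbTE (neq_lift _ _)) !tnthS.
Qed.

Lemma upd_consS n x (s : n.-tuple R) k t :
  upd [tuple of x :: s] (lift ord0 k) t = [tuple of x :: upd s k t].
Proof.
apply: eq_from_tnth => i; rewrite tnth_upd.
case: (unliftP ord0 i) => [j ->|->].
  by rewrite (inj_eq lift_inj) !tnthS tnth_upd.
by rewrite (negbTE (neq_lift _ _)) !tnth0.
Qed.

Lemma measurable_upd2 n (k : 'I_n) :
  measurable_fun setT (fun p : n.-tuple R * R => upd p.1 k p.2).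
Proof.
apply/measurable_fun_tnthP => i.
rewrite (_ : _ \o _ = fun p : n.-tuple R * R => if i == k then p.2 else tnth p.1 i); last first.
  by apply/funext => p /=; rewrite tnth_upd.
case: (i == k); first exact: measurable_snd.
by apply: (measurableT_comp (@measurable_tnth _ _ _ i)); exact: measurable_fst.
Qed.

End tuple_update.

Section tame.
Variable R : realType.
Local Notation g1 := (@gauss1 R).
Local Notation gT := (@gaussT R).

Definition nrm1 n (x : n.-tuple R) : R := \sum_(i < n) `|tnth x i|.

Lemma nrm1_ge0 n (x : n.-tuple R) : 0 <= nrm1 x.
Proof. exact: sumr_ge0. Qed.

Lemma nrm1_cons n x (s : n.-tuple R) : nrm1 [tuple of x :: s] = `|x| + nrm1 s.
Proof.
by rewrite /nrm1 big_ord_recl tnth0; congr (_ + _); apply: eq_bigr => i _; rewrite tnthS.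
Qed.

Lemma measurable_nrm1 n : measurable_fun setT (@nrm1 n).
Proof. by rewrite /nrm1; meas. Qed.

Lemma nrm1_upd n (x : n.-tuple R) k t : nrm1 (upd x k t) <= nrm1 x + `|t|.
Proof.
rewrite /nrm1 (bigD1 k)//= [in leRHS](bigD1 k)//= tnth_upd eqxx.
rewrite addrC lerD2r -[leLHS]add0r lerD//.
by apply: ler_sum => i /negbTE ik; rewrite tnth_upd ik.
Qed.

(** With the l1 norm in the exponent the bounding function is a product over coordinates, hence
    integrable by induction on the dimension. *)
Definition tame n (f : n.-tuple R -> R) := measurable_fun setT f /\
  exists2 C : R, 0 <= C & forall x, `|f x| <= C * expR (C * nrm1 x).

Lemma integrable_expR_nrm1 n (C : R) : 0 <= C ->
  (gT n).-integrable setT (fun x : n.-tuple R => (expR (C * nrm1 x))%:E).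
Proof.
move=> C0; apply/integrableP; split.
  by apply/measurable_EFinP; apply: (measurableT_comp (@measurable_expR _)); apply: measurable_funM => //; exact: measurable_nrm1.
under eq_integral do rewrite gee0_abs ?lee_fin ?expR_ge0//.
set I := (\int[g1]_x (expR (C * `|x|))%:E)%E.
have Ioo : (I < +oo)%E.
  have /integrableP[_] := integrable_expR_norm C0.
  by under eq_integral do rewrite gee0_abs ?lee_fin ?expR_ge0//.
have I0 : (0 <= I)%E by apply: integral_ge0 => x _; rewrite lee_fin expR_ge0.
have mm m : measurable_fun setT (fun x : m.-tuple R => (expR (C * nrm1 x))%:E).
  by apply/measurable_EFinP; apply: (measurableT_comp (@measurable_expR _)); apply: measurable_funM => //; exact: measurable_nrm1.
elim: n => [|n IH].
  by rewrite integral_gaussT0// ltry.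
rewrite ge0_integral_gaussTS//.
rewrite (eq_integral (fun x : R => (expR (C * `|x|))%:E * \int[gT n]_x (expR (C * nrm1 x))%:E)%E); last first.
  move=> x _; rewrite -ge0_integralZl//.
    by apply: eq_integral => s _; rewrite nrm1_cons mulrDr expRD EFinM.
  exact: mm.
have J0 : (0 <= \int[gT n]_x (expR (C * nrm1 x))%:E)%E.
  by apply: integral_ge0 => x _; rewrite lee_fin expR_ge0.
rewrite ge0_integralZr//=; last by meas.
by apply: lte_mul_pinfty => //; rewrite ge0_fin_numE.
Qed.

End tame.

Section tame_theory.
Variable R : realType.
Local Notation g1 := (@gauss1 R).
Local Notation gT := (@gaussT R).

Lemma tame_bnd n (f : n.-tuple R -> R) (C D : R) : measurable_fun setT f ->
  0 <= C -> 0 <= D -> (forall x, `|f x| <= C * expR (D * nrm1 x)) -> tame f.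
Proof.
move=> mf C0 D0 fCD; split=> //; exists (C + D); first exact: addr_ge0.
move=> x; apply: (le_trans (fCD x)); apply: ler_pM => //; rewrite ?expR_ge0 ?lerDl//.
by rewrite ler_expR ler_wpM2r ?nrm1_ge0// lerDr.
Qed.

Lemma tame_integrable n (f : n.-tuple R -> R) : tame f ->
  (gT n).-integrable setT (EFin \o f).
Proof.
move=> [mf [C C0 fC]].
apply: (@le_integrable _ _ _ _ _ _ _ (fun x : n.-tuple R => (C%:E * (expR (C * nrm1 x))%:E)%E)) => //.
- exact/measurable_EFinP.
- by move=> x _ /=; rewrite lee_fin (le_trans (fC x))// ler_norm.
- exact: integrableZl (integrable_expR_nrm1 n C0).
Qed.

Lemma tame_le n (f g : n.-tuple R -> R) : measurable_fun setT f -> tame g ->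
  (forall x, `|f x| <= `|g x|) -> tame f.
Proof.
move=> mf [mg [C C0 gC]] fg; split=> //; exists C => // x.
exact: le_trans (fg x) (gC x).
Qed.

Lemma tame_cst n (c : R) : tame (fun _ : n.-tuple R => c).
Proof. by apply: (@tame_bnd _ _ `|c| 0) => // x; rewrite mul0r expR0 mulr1. Qed.

Lemma tnth_le_nrm1 n (x : n.-tuple R) k : `|tnth x k| <= nrm1 x.
Proof. by rewrite /nrm1 (bigD1 k)//= lerDl sumr_ge0. Qed.

Lemma tame_tnth n k : tame (fun x : n.-tuple R => tnth x k).
Proof.
apply: (@tame_bnd _ _ 1 1) => //; first exact: measurable_tnth.
move=> x; rewrite !mul1r (le_trans _ (expR_ge1Dx _))//.
by rewrite (le_trans (tnth_le_nrm1 x k))// lerDr.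
Qed.

Lemma tame_nrm1 n : tame (@nrm1 R n).
Proof.
apply: (@tame_bnd _ _ 1 1) => //; first exact: measurable_nrm1.
move=> x; rewrite !mul1r (le_trans _ (expR_ge1Dx _))//.
by rewrite ger0_norm ?nrm1_ge0// lerDr.
Qed.

Lemma tameD n (f g : n.-tuple R -> R) : tame f -> tame g -> tame (fun x => f x + g x).
Proof.
move=> [mf [C C0 fC]] [mg [D D0 gD]].
apply: (@tame_bnd _ _ (C + D) (C + D)); rewrite ?addr_ge0//; first exact: measurable_funD.
move=> x; rewrite (le_trans (ler_normD _ _))// mulrDl lerD//.
  by rewrite (le_trans (fC x))// ler_wpM2l// ler_expR ler_wpM2r ?nrm1_ge0// lerDl.
by rewrite (le_trans (gD x))// ler_wpM2l// ler_expR ler_wpM2r ?nrm1_ge0// lerDr.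
Qed.

Lemma tameM n (f g : n.-tuple R -> R) : tame f -> tame g -> tame (fun x => f x * g x).
Proof.
move=> [mf [C C0 fC]] [mg [D D0 gD]].
apply: (@tame_bnd _ _ (C * D) (C + D)); rewrite ?addr_ge0 ?mulr_ge0//; first exact: measurable_funM.
by move=> x; rewrite normrM mulrDl expRD mulrACA ler_pM.
Qed.

Lemma tameZ n (c : R) (f : n.-tuple R -> R) : tame f -> tame (fun x => c * f x).
Proof. by move=> tf; apply: tameM => //; exact: tame_cst. Qed.

Lemma tameN n (f : n.-tuple R -> R) : tame f -> tame (fun x => - f x).
Proof. by move=> tf; under eq_fun do rewrite -mulN1r; exact: tameZ. Qed.

Lemma tameB n (f g : n.-tuple R -> R) : tame f -> tame g -> tame (fun x => f x - g x).
Proof. by move=> tf tg; apply: tameD => //; exact: tameN. Qed.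

Lemma tameX n (f : n.-tuple R -> R) m : tame f -> tame (fun x => f x ^+ m).
Proof.
move=> tf; elim: m => [|m IH]; first exact: (tame_cst _ 1).
by under eq_fun do rewrite exprS; exact: tameM.
Qed.

Lemma tame_sum n (I : Type) (r : seq I) (P : pred I) (f : I -> n.-tuple R -> R) :
  (forall i, tame (f i)) -> tame (fun x => \sum_(i <- r | P i) f i x).
Proof.
move=> tf; elim: r => [|i r IH].
  by under eq_fun do rewrite big_nil; exact: tame_cst.
under eq_fun do rewrite big_cons.
by case: (P i) => //; exact: tameD.
Qed.

Lemma tame_norm n (f : n.-tuple R -> R) : tame f -> tame (fun x => `|f x|).
Proof.
move=> tf; apply: (tame_le _ tf) => [|x]; last by rewrite normr_id.
by case: tf => mf _; meas.
Qed.

Lemma EC n (c : R) : \int[gT n]_x c = c.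
Proof.
rewrite Rintegral_cst// -[RHS]mulr1; congr (_ * _).
by rewrite -[RHS]/(fine 1%E); congr fine; exact: probability_setT.
Qed.

Lemma E1C (c : R) : \int[g1]_x c = c.
Proof.
rewrite Rintegral_cst// -[RHS]mulr1; congr (_ * _).
by rewrite -[RHS]/(fine 1%E); congr fine; exact: probability_setT.
Qed.

Lemma ED n (f g : n.-tuple R -> R) : tame f -> tame g ->
  \int[gT n]_x (f x + g x) = \int[gT n]_x f x + \int[gT n]_x g x.
Proof. by move=> tf tg; rewrite RintegralD//; exact: tame_integrable. Qed.

Lemma EZ n (c : R) (f : n.-tuple R -> R) : tame f ->
  \int[gT n]_x (c * f x) = c * \int[gT n]_x f x.
Proof. by move=> tf; rewrite RintegralZl//; exact: tame_integrable. Qed.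

Lemma EB n (f g : n.-tuple R -> R) : tame f -> tame g ->
  \int[gT n]_x (f x - g x) = \int[gT n]_x f x - \int[gT n]_x g x.
Proof. by move=> tf tg; rewrite RintegralB//; exact: tame_integrable. Qed.

Lemma E_le n (f g : n.-tuple R -> R) : tame f -> tame g ->
  (forall x, f x <= g x) -> \int[gT n]_x f x <= \int[gT n]_x g x.
Proof. by move=> tf tg fg; apply: le_Rintegral => //; exact: tame_integrable. Qed.

Lemma E_ge0 n (f : n.-tuple R -> R) : (forall x, 0 <= f x) -> 0 <= \int[gT n]_x f x.
Proof. by move=> f0; apply: Rintegral_ge0. Qed.

Lemma E_sum n (I : Type) (r : seq I) (P : pred I) (f : I -> n.-tuple R -> R) :
  (forall i, tame (f i)) ->
  \int[gT n]_x (\sum_(i <- r | P i) f i x) = \sum_(i <- r | P i) \int[gT n]_x f i x.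
Proof.
move=> tf; elim: r => [|i r IH].
  by under eq_Rintegral do rewrite big_nil; rewrite EC big_nil.
under eq_Rintegral do rewrite big_cons.
rewrite big_cons; case: (P i) => //; rewrite ED ?IH//; exact: tame_sum.
Qed.

Definition gauss_mom (C : R) n : R := \int[gT n]_x expR (C * nrm1 x).
Definition gauss1_mom (C : R) : R := \int[g1]_x expR (C * `|x|).

Lemma gauss1_mom_ge0 C : 0 <= gauss1_mom C.
Proof. by apply: Rintegral_ge0 => x _; exact: expR_ge0. Qed.
Lemma gauss_mom_ge0 C n : 0 <= gauss_mom C n.
Proof. by apply: Rintegral_ge0 => x _; exact: expR_ge0. Qed.

(** The extra real variable is either a new first coordinate or the resampled value of an existing
    one. *)
Definition tame2 n (f : n.-tuple R * R -> R) := measurable_fun setT f /\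
  exists2 C : R, 0 <= C & forall x t, `|f (x, t)| <= C * expR (C * (nrm1 x + `|t|)).

Lemma tame2_l n (f : n.-tuple R * R -> R) t : tame2 f -> tame (fun x => f (x, t)).
Proof.
move=> [mf [C C0 fC]]; apply: (@tame_bnd _ _ (C * expR (C * `|t|)) C) => //.
- by apply: measurableT_comp => //; exact: measurable_pair2.
- by rewrite mulr_ge0 ?expR_ge0.
- by move=> x; rewrite (le_trans (fC x t))// mulrDr addrC expRD mulrA.
Qed.

Lemma tame2_r n (f : n.-tuple R * R -> R) x : tame2 f -> tame1 (fun t => f (x, t)).
Proof.
move=> [mf [C C0 fC]]; apply: (@tame1_bnd _ _ (C * expR (C * nrm1 x)) C) => //.
- by apply: measurableT_comp => //; exact: measurable_pair1.
- by rewrite mulr_ge0 ?expR_ge0.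
- by move=> t; rewrite (le_trans (fC x t))// mulrDr expRD mulrA.
Qed.

Lemma tame2_norm n (f : n.-tuple R * R -> R) : tame2 f -> tame2 (fun p => `|f p|).
Proof.
move=> [mf [C C0 fC]]; split; first by meas.
by exists C => // x t; rewrite normr_id.
Qed.

Lemma tame2_int_r n (f : n.-tuple R * R -> R) : tame2 f ->
  tame (fun x => \int[g1]_t f (x, t)).
Proof.
move=> tf; have [mf [C C0 fC]] := tf.
apply: (@tame_bnd _ _ (C * gauss1_mom C) C) => //.
- exact: measurable_Rint_param.
- by rewrite mulr_ge0// gauss1_mom_ge0.
move=> x; apply: (le_trans (le_normr_Rintegral _ _)) => //.
  exact: tame1_integrable (tame2_r x tf).
rewrite mulrAC /gauss1_mom -RintegralZl//; last exact: integrable_expR_norm.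
apply: le_Rintegral => //.
- exact: integrable_norm (tame1_integrable (tame2_r x tf)).
- have := integrableZl (R:=R) measurableT (C * expR (C * nrm1 x)) (integrable_expR_norm C0).
  by [].
- by move=> t _; rewrite (le_trans (fC x t))// mulrDr expRD mulrA.
Qed.

Lemma tame2_int_l n (f : n.-tuple R * R -> R) : tame2 f ->
  tame1 (fun t => \int[gT n]_x f (x, t)).
Proof.
move=> tf; have [mf [C C0 fC]] := tf.
apply: (@tame1_bnd _ _ (C * gauss_mom C n) C) => //.
- apply: (@measurable_Rint_param _ _ _ _ _ (gT n) (fun p : R * n.-tuple R => f (p.2, p.1))).
  apply: measurableT_comp => //.
  by apply/measurable_fun_pairP; split; [exact: measurable_snd|exact: measurable_fst].
- by rewrite mulr_ge0// gauss_mom_ge0.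
move=> t; apply: (le_trans (le_normr_Rintegral _ _)) => //.
  exact: tame_integrable (tame2_l t tf).
rewrite mulrAC /gauss_mom -RintegralZl//; last exact: integrable_expR_nrm1.
apply: le_Rintegral => //.
- exact: integrable_norm (tame_integrable (tame2_l t tf)).
- have := integrableZl (R:=R) measurableT (C * expR (C * `|t|)) (integrable_expR_nrm1 n C0).
  by [].
- by move=> x _; rewrite (le_trans (fC x t))// mulrDr addrC expRD mulrA.
Qed.

Lemma tame2_swap n (f : n.-tuple R * R -> R) : tame2 f ->
  \int[gT n]_x \int[g1]_t f (x, t) = \int[g1]_t \int[gT n]_x f (x, t).
Proof.
move=> tf; apply: RFubini.
- by case: tf.
- move=> x; exact: tame1_integrable (tame2_r x tf).
- move=> t; exact: tame_integrable (tame2_l t tf).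
- exact: tame_integrable (tame2_int_r (tame2_norm tf)).
Qed.

Lemma tame_cons n (f : n.+1.-tuple R -> R) : tame f ->
  tame2 (fun p : n.-tuple R * R => f [tuple of p.2 :: p.1]).
Proof.
move=> [mf [C C0 fC]]; split.
  by apply: measurableT_comp => //; apply: measurable_cons; [exact: measurable_snd|exact: measurable_fst].
by exists C => // x t; rewrite (le_trans (fC _))// nrm1_cons addrC.
Qed.

Lemma ES n (f : n.+1.-tuple R -> R) : tame f ->
  \int[gT n.+1]_x f x = \int[g1]_t \int[gT n]_s f [tuple of t :: s].
Proof.
move=> tf; rewrite /Rintegral integral_gaussTS; last exact: tame_integrable.
congr fine; apply: eq_integral => t _; rewrite fineK//.
exact: integrable_fin_num (tame_integrable (tame2_l t (tame_cons tf))).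
Qed.

Lemma tame_upd n (f : n.-tuple R -> R) k : tame f ->
  tame2 (fun p : n.-tuple R * R => f (upd p.1 k p.2)).
Proof.
move=> [mf [C C0 fC]]; split.
  by apply: measurableT_comp => //; exact: measurable_upd2.
exists C => // x t; rewrite (le_trans (fC _))// ler_wpM2l// ler_expR ler_wpM2l//.
exact: nrm1_upd.
Qed.

(** Replacing one coordinate by an independent copy does not change the law of the tuple. This
    reduces statements about coordinate k to one-dimensional integrals. *)
Lemma E_resample n (f : n.-tuple R -> R) k : tame f ->
  \int[gT n]_x f x = \int[gT n]_x \int[g1]_t f (upd x k t).
Proof.
elim: n f k => [f []//|n IH] f k tf.
rewrite (ES tf) (ES (tame2_int_r (tame_upd k tf))).
case: (unliftP ord0 k) => [j ->|->].
  apply: eq_Rintegral => t _.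
  rewrite (IH _ j); last exact: tame2_l (tame_cons tf).
  by apply: eq_Rintegral => s _; apply: eq_Rintegral => u _ /=; rewrite upd_consS.
rewrite [RHS](_ : _ = \int[g1]_t \int[gT n]_s \int[g1]_u f [tuple of u :: s]).
  rewrite E1C.
  by rewrite (tame2_swap (tame_cons tf)).
apply: eq_Rintegral => t _; apply: eq_Rintegral => s _; apply: eq_Rintegral => u _.
by rewrite /= upd_cons0.
Qed.

Lemma E_ibp n (f f' : n.-tuple R -> R) k : tame f -> tame f' ->
  (forall x t, is_derive (t : R) (1 : R) (fun t => f (upd x k t)) (f' (upd x k t))) ->
  (forall x, continuous (fun t : R => f' (upd x k t))) ->
  \int[gT n]_x (tnth x k * f x) = \int[gT n]_x f' x.
Proof.
move=> tf tf' df cf'.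
rewrite (E_resample k (tameM (tame_tnth k) tf)) (E_resample k tf').
apply: eq_Rintegral => x _.
under eq_Rintegral do rewrite tnth_upd eqxx.
apply: gauss1_ibp => //.
- exact: tame2_r x (tame_upd k tf).
- exact: tame2_r x (tame_upd k tf').
Qed.

(** The signed counterpart of [gauss_exp_ge0]: the logarithm of the partition function changes sign,
    so the iterated integral of the statement is identified through integrability. *)
Lemma gauss_exp_tame n (f : seq R -> R) : tame (fun x : n.-tuple R => f x) ->
  gauss_exp n (fun s => (f s)%:E) = (\int[gT n]_x f x)%:E.
Proof.
elim: n f => [|n IH] f tf.
  rewrite /= /Rintegral integral_gaussT0//.
  by apply/measurable_EFinP; case: tf.
rewrite (ES tf)/=.
transitivity (\int[normal_prob (0:R) 1]_x (\int[gT n]_s f (x :: s))%:E)%E.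
  apply: eq_integral => x _; apply: (IH (fun s => f (x :: s))).
  exact: tame2_l x (tame_cons tf).
have t1 := tame1_integrable (tame2_int_l (tame_cons tf)).
rewrite -(integral_gauss1 t1) /Rintegral fineK//.
exact: integrable_fin_num t1.
Qed.

End tame_theory.

Ltac tm := repeat first
  [ exact: tame_cst | assumption | exact: tame_tnth | apply: tameD | apply: tameZ
  | apply: tameX | apply: tameM | apply: tameN | (apply: tame_sum => ?) ].

Lemma eq_lerR (R : realType) (x y : R) : x = y -> x <= y. Proof. by move=> ->. Qed.

(** * Gibbs measures with gaussian couplings *)

Section bounded_measurable.
Context d (Z : measurableType d) (R : realType).

Definition bm (g : Z -> R) := measurable_fun setT g /\
  exists2 B : R, 0 <= B & forall z, `|g z| <= B.

Lemma bm_cst c : bm (fun=> c). Proof. by split => //; exists `|c|. Qed.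

Lemma bmD f g : bm f -> bm g -> bm (fun z => f z + g z).
Proof.
move=> [mf [B B0 fB]] [mg [C C0 gC]]; split; first by meas.
by exists (B + C) => [|z]; rewrite ?addr_ge0// (le_trans (ler_normD _ _))// lerD.
Qed.

Lemma bmM f g : bm f -> bm g -> bm (fun z => f z * g z).
Proof.
move=> [mf [B B0 fB]] [mg [C C0 gC]]; split; first by meas.
by exists (B * C) => [|z]; rewrite ?mulr_ge0// normrM ler_pM.
Qed.

Lemma bmZ c f : bm f -> bm (fun z => c * f z).
Proof. by move=> bf; apply: bmM => //; exact: bm_cst. Qed.

Lemma bmB f g : bm f -> bm g -> bm (fun z => f z - g z).
Proof.
by move=> bf bg; apply: bmD => //; under eq_fun do rewrite -mulN1r; exact: bmZ.
Qed.

Lemma bmX f n : bm f -> bm (fun z => f z ^+ n).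
Proof.
move=> bf; elim: n => [|n IH]; first exact: (bm_cst 1).
by under eq_fun do rewrite exprS; exact: bmM.
Qed.

Lemma bm_sum (I : Type) (r : seq I) (P : pred I) (f : I -> Z -> R) :
  (forall i, bm (f i)) -> bm (fun z => \sum_(i <- r | P i) f i z).
Proof.
move=> bf; elim: r => [|i r IH].
  by under eq_fun do rewrite big_nil; exact: bm_cst.
under eq_fun do rewrite big_cons.
by case: (P i) => //; exact: bmD.
Qed.

Lemma bm_exp f : bm f -> bm (fun z => expR (f z)).
Proof.
move=> [mf [B B0 fB]]; split; first by meas.
exists (expR B) => [|z]; first exact: expR_ge0.
by rewrite ger0_norm ?expR_ge0// ler_expR (le_trans (ler_norm _)).
Qed.

Variable mu : probability Z R.

Lemma bm_integrable f : bm f -> mu.-integrable setT (EFin \o f).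
Proof.
move=> [mf [B B0 fB]].
apply: measurable_bounded_integrable => //; first exact: fin_num_fun_lty.
exists B; split; first exact: num_real.
move=> x Bx z _; exact: le_trans (fB z) (ltW Bx).
Qed.

Lemma bIC c : \int[mu]_z c = c.
Proof.
rewrite Rintegral_cst// -[RHS]mulr1; congr (_ * _).
by rewrite -[RHS]/(fine 1%E); congr fine; exact: probability_setT.
Qed.

Lemma bID f g : bm f -> bm g -> \int[mu]_z (f z + g z) = \int[mu]_z f z + \int[mu]_z g z.
Proof. by move=> bf bg; rewrite RintegralD//; exact: bm_integrable. Qed.

Lemma bIZ c f : bm f -> \int[mu]_z (c * f z) = c * \int[mu]_z f z.
Proof. by move=> bf; rewrite RintegralZl//; exact: bm_integrable. Qed.

Lemma bI_le f g : bm f -> bm g -> (forall z, f z <= g z) -> \int[mu]_z f z <= \int[mu]_z g z.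
Proof. by move=> bf bg fg; apply: le_Rintegral => //; exact: bm_integrable. Qed.

(** Differentiation under the integral sign: as G and b are bounded, the derivative is dominated by
    one constant on the interval of radius 1 around t. *)
Lemma is_derive_exp_integral (G b : Z -> R) (t : R) : bm G -> bm b ->
  is_derive t (1 : R) (fun t : R => \int[mu]_z (G z * expR (t * b z)))
    (\int[mu]_z (G z * b z * expR (t * b z))).
Proof.
move=> bG bb; have [mb [B B0 bB]] := bb; have [mG [C C0 GC]] := bG.
pose f (x : R) (z : Z) := G z * expR (x * b z).
have dfx (x : R) z : is_derive x (1 : R) (fun x => f x z) (G z * b z * expR (x * b z)).
  rewrite /f; apply: is_derive_eq.
  by rewrite !scaler0 ?add0r ?addr0 /GRing.scale/= ?mulr1; ring.
have intf (x : R) : `]t - 1, t + 1[%classic x -> mu.-integrable setT (EFin \o f x).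
  by move=> _; apply: bm_integrable; apply: bmM => //; apply: bm_exp; exact: bmZ.
have derf (x : R) z : `]t - 1, t + 1[%classic x -> setT z -> derivable (f ^~ z) x 1.
  by move=> _ _; have [] := dfx x z.
have It : `]t - 1, t + 1[%classic t by rewrite /= in_itv/= ltrBlDr ltrDl ltr01.
pose M := C * B * expR ((`|t| + 1) * B).
have intM : mu.-integrable setT (EFin \o (fun _ : Z => M)).
  by apply: bm_integrable; exact: bm_cst.
have M0 (z : Z) : 0 <= M by rewrite /M !mulr_ge0 ?expR_ge0.
have fM (x : R) z : `]t - 1, t + 1[%classic x -> setT z -> `|partial1of2 f x z| <= M.
  move=> /=; rewrite in_itv/= => /andP[x1 x2] _.
  rewrite partial1of2E (@derive_val _ _ _ _ _ _ _ (dfx x z)) !normrM.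
  apply: ler_pM => //; first by apply: ler_pM.
  rewrite ger0_norm ?expR_ge0// ler_expR (le_trans (ler_norm _))// normrM.
  apply: ler_pM => //.
  have := ler_norm t; have := ler_norm (- t); rewrite normrN ler_norml => h1 h2.
  by clear - x1 x2 h1 h2; apply/andP; split; lra.
have D := @derivable_under_integral _ _ _ mu f setT measurableT t _ _ It intf derf _ M0 intM fM.
apply: DeriveDef => //.
rewrite -derive1E (@differentiation_under_integral _ _ _ mu f setT measurableT t _ _ It intf derf _ M0 intM fM).
apply: eq_Rintegral => z _.
by rewrite partial1of2E (@derive_val _ _ _ _ _ _ _ (dfx t z)).
Qed.

End bounded_measurable.

Section gibbs.
Context d (Z : measurableType d) (R : realType).
Variables (mu : probability Z R) (rho : Z -> R) (n : nat) (c : 'I_n -> Z -> R).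
Variable D : R.
Hypothesis D0 : 0 <= D.
Hypothesis brho : bm rho.
Hypothesis rho0 : forall z, 0 <= rho z.
Hypothesis rho_gt0 : 0 < \int[mu]_z rho z.
Hypothesis mc : forall k, measurable_fun setT (c k).
Hypothesis cD : forall k z, `|c k z| <= D.
Local Notation gT := (@gaussT R).
Implicit Types (a : 'I_n -> R) (J : n.-tuple R) (g : Z -> R).

(** The subtracted squares normalize each factor: for every z the mean of exp(ham) over J is 1,
    whatever the strengths [a]. The couplings of the model and the external fields are both
    instances. *)
Definition ham a J z : R :=
  \sum_(k < n) (a k * tnth J k * c k z - (a k ^+ 2 / 2) * c k z ^+ 2).
Definition wgt a J z : R := rho z * expR (ham a J z).
Definition Zf a J : R := \int[mu]_z wgt a J z.
Definition num a J g : R := \int[mu]_z (g z * wgt a J z).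
Definition av a J g : R := num a J g / Zf a J.

Lemma bmc k : bm (c k). Proof. by split => //; exists D. Qed.

Lemma bm_ham a J : bm (ham a J).
Proof.
apply: bm_sum => k; apply: bmB; apply: bmZ; first exact: bmc.
by apply: bmX; exact: bmc.
Qed.

Lemma bm_wgt a J : bm (wgt a J).
Proof. by apply: bmM => //; apply: bm_exp; exact: bm_ham. Qed.

Lemma wgt_ge0 a J z : 0 <= wgt a J z.
Proof. by rewrite mulr_ge0 ?expR_ge0. Qed.

Definition hamA a : R := \sum_(k < n) `|a k| * D.
Definition hamB a : R := \sum_(k < n) a k ^+ 2 / 2 * D ^+ 2.

Lemma ham_le a J z : `|ham a J z| <= hamA a * nrm1 J + hamB a.
Proof.
rewrite (le_trans (ler_norm_sum _ _ _))// /hamA /hamB mulr_suml -big_split/=.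
apply: ler_sum => k _; rewrite (le_trans (ler_normB _ _))// lerD//.
  rewrite !normrM -mulrA -[leRHS]mulrA ler_wpM2l// mulrC ler_pM//.
  exact: tnth_le_nrm1.
rewrite normrM ger0_norm ?divr_ge0 ?sqr_ge0// ler_wpM2l ?divr_ge0 ?sqr_ge0//.
by rewrite ger0_norm ?sqr_ge0// -real_normK ?num_real// lerXn2r ?nnegrE.
Qed.

Lemma measurable_wgt2 a :
  measurable_fun setT (fun p : n.-tuple R * Z => wgt a p.1 p.2).
Proof.
rewrite /wgt /ham; apply: measurable_funM.
  by apply: measurableT_comp; [exact: brho.1|exact: measurable_snd].
apply: (measurableT_comp (@measurable_expR _)); apply: measurable_sum => k.
have m1 : measurable_fun setT (fun p : n.-tuple R * Z => c k p.2).
  by apply: (measurableT_comp (mc k)); exact: measurable_snd.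
have m2 : measurable_fun setT (fun p : n.-tuple R * Z => tnth p.1 k).
  by apply: (measurableT_comp (@measurable_tnth _ _ _ k)); exact: measurable_fst.
by meas.
Qed.

Lemma Zf_le a J : Zf a J <= expR (hamA a * nrm1 J + hamB a) * \int[mu]_z rho z.
Proof.
rewrite -bIZ//; apply: bI_le; first exact: bm_wgt.
  exact: bmZ.
move=> z; rewrite /wgt mulrC ler_wpM2r// ler_expR.
by rewrite (le_trans (ler_norm _))// ham_le.
Qed.

Lemma Zf_ge a J : expR (- (hamA a * nrm1 J + hamB a)) * \int[mu]_z rho z <= Zf a J.
Proof.
rewrite -bIZ//; apply: bI_le; [exact: bmZ|exact: bm_wgt|].
move=> z; rewrite /wgt [leRHS]mulrC ler_wpM2r// ler_expR.
by have := ham_le a J z; rewrite ler_norml => /andP[].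
Qed.

Lemma Zf_gt0 a J : 0 < Zf a J.
Proof. by rewrite (lt_le_trans _ (Zf_ge a J))// mulr_gt0 ?expR_gt0. Qed.

Lemma measurable_num a g : measurable_fun setT g -> measurable_fun setT (num a ^~ g).
Proof.
move=> mg; apply: (@measurable_Rint_param _ _ _ _ _ mu (fun p : n.-tuple R * Z => g p.2 * wgt a p.1 p.2)).
apply: measurable_funM; last exact: measurable_wgt2.
by apply: (measurableT_comp mg); exact: measurable_snd.
Qed.

Lemma measurable_Zf a : measurable_fun setT (Zf a).
Proof. exact: measurable_Rint_param (measurable_wgt2 a). Qed.

Lemma tame_lnZf a : tame (fun J => ln (Zf a J)).
Proof.
have tg : tame (fun J : n.-tuple R => `|ln (\int[mu]_z rho z)| + (hamA a * nrm1 J + hamB a)).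
  apply: tameD; first exact: tame_cst.
  by apply: tameD; [apply: tameZ; exact: tame_nrm1|exact: tame_cst].
apply: (tame_le _ tg).
  by apply: (measurableT_comp (@measurable_ln _)); exact: measurable_Zf.
move=> J; rewrite [leRHS]ger0_norm; last first.
  rewrite !addr_ge0 ?mulr_ge0 ?nrm1_ge0 ?sumr_ge0// => k _; rewrite mulr_ge0 ?sqr_ge0//.
  by rewrite divr_ge0 ?sqr_ge0.
have h1 : ln (Zf a J) <= (hamA a * nrm1 J + hamB a) + ln (\int[mu]_z rho z).
  rewrite -[X in X + _]expRK -lnM ?posrE ?expR_gt0//.
  rewrite ler_ln ?posrE ?Zf_gt0 ?mulr_gt0 ?expR_gt0//; exact: Zf_le.
have h2 : - (hamA a * nrm1 J + hamB a) + ln (\int[mu]_z rho z) <= ln (Zf a J).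
  rewrite -[X in X + _]expRK -lnM ?posrE ?expR_gt0//.
  rewrite ler_ln ?posrE ?Zf_gt0 ?mulr_gt0 ?expR_gt0//; exact: Zf_ge.
have := ler_norm (ln (\int[mu]_z rho z)); have := ler_norm (- ln (\int[mu]_z rho z)).
rewrite normrN ler_norml; move: h1 h2; clear; move=> *; apply/andP; split; lra.
Qed.

Lemma avE a J g : av a J g = num a J g * expR (- ln (Zf a J)).
Proof. by rewrite /av expRN lnK ?posrE ?Zf_gt0. Qed.

Lemma bm_numi a J g : bm g -> bm (fun z => g z * wgt a J z).
Proof. by move=> bg; apply: bmM => //; exact: bm_wgt. Qed.

Lemma av1 a J r : av a J (fun=> r) = r.
Proof.
rewrite /av /num bIZ; last exact: bm_wgt.
by rewrite -/(Zf a J) mulfK// gt_eqF// Zf_gt0.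
Qed.

Lemma avD a J g h : bm g -> bm h -> av a J (fun z => g z + h z) = av a J g + av a J h.
Proof.
move=> bg bh; rewrite /av -mulrDl; congr (_ / _); rewrite /num -bID; try exact: bm_numi.
by apply: eq_Rintegral => z _; rewrite mulrDl.
Qed.

Lemma avZ a J r g : bm g -> av a J (fun z => r * g z) = r * av a J g.
Proof.
move=> bg; rewrite /av mulrA; congr (_ / _); rewrite /num -bIZ; last exact: bm_numi.
by apply: eq_Rintegral => z _; rewrite mulrA.
Qed.

Lemma avB a J g h : bm g -> bm h -> av a J (fun z => g z - h z) = av a J g - av a J h.
Proof.
move=> bg bh; rewrite avD//; last by under eq_fun do rewrite -mulN1r; exact: bmZ.
congr (_ + _); rewrite -mulN1r -avZ//; congr (av a J _).
by apply/funext => z; rewrite mulN1r.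
Qed.

Lemma av_sum a J (I : Type) (r : seq I) (P : pred I) (f : I -> Z -> R) :
  (forall i, bm (f i)) ->
  av a J (fun z => \sum_(i <- r | P i) f i z) = \sum_(i <- r | P i) av a J (f i).
Proof.
move=> bf; elim: r => [|i r IH].
  by under eq_fun do rewrite big_nil; rewrite av1 big_nil.
under eq_fun do rewrite big_cons.
rewrite big_cons; case: (P i) => //; rewrite avD ?IH//; exact: bm_sum.
Qed.

Lemma av_le a J g h : bm g -> bm h -> (forall z, rho z != 0 -> g z <= h z) ->
  av a J g <= av a J h.
Proof.
move=> bg bh gh; rewrite /av ler_pM2r ?invr_gt0 ?Zf_gt0//.
apply: bI_le; try exact: bm_numi.
move=> z; rewrite /wgt; have [->|r0] := eqVneq (rho z) 0; first by rewrite !mul0r !mulr0.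
by rewrite ler_wpM2r ?wgt_ge0 ?gh// mulr_ge0 ?expR_ge0.
Qed.

Lemma av_ge0 a J g : bm g -> (forall z, 0 <= g z) -> 0 <= av a J g.
Proof.
move=> bg g0; rewrite -[leLHS](av1 a J 0); apply: av_le => //; exact: bm_cst.
Qed.

Lemma av_sqr a J g : bm g -> av a J g ^+ 2 <= av a J (fun z => g z ^+ 2).
Proof.
move=> bg; rewrite -subr_ge0.
have -> : av a J (fun z => g z ^+ 2) - av a J g ^+ 2 =
    av a J (fun z => (g z - av a J g) ^+ 2).
  set m := av a J g.
  have -> : (fun z => (g z - m) ^+ 2) = (fun z => (g z ^+ 2 + (- 2 * m) * g z) + m ^+ 2).
    by apply/funext => z; ring.
  rewrite avD ?av1 ?avD ?avZ//; try exact: bm_cst; try exact: bmX; try exact: bmZ.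
    by rewrite -/m; ring.
  by apply: bmD; [exact: bmX|exact: bmZ].
apply: av_ge0; last by move=> z; exact: sqr_ge0.
by apply: bmX; apply: bmB => //; exact: bm_cst.
Qed.

Lemma av_bound a J g B : bm g -> (forall z, `|g z| <= B) -> `|av a J g| <= B.
Proof.
move=> bg gB; rewrite ler_norml; apply/andP; split.
  rewrite -[leLHS](av1 a J); apply: av_le => //; first exact: bm_cst.
  by move=> z _; have := gB z; rewrite ler_norml => /andP[].
rewrite -[leRHS](av1 a J); apply: av_le => //; first exact: bm_cst.
by move=> z _; have := gB z; rewrite ler_norml => /andP[].
Qed.

Lemma tame_av a g : bm g -> tame (fun J => av a J g).
Proof.
move=> bg; have [mg [B B0 gB]] := bg.
apply: (tame_le _ (tame_cst _ B)).
  under eq_fun do rewrite avE.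
  apply: measurable_funM; first exact: measurable_num.
  apply: (measurableT_comp (@measurable_expR _)); apply: measurable_funN.
  by case: (tame_lnZf a).
by move=> J; rewrite [leRHS]ger0_norm// av_bound.
Qed.

Lemma av_jensen a J g : bm g -> expR (av a J g) <= av a J (fun z => expR (g z)).
Proof.
move=> bg; set m := av a J g.
have : av a J (fun z => expR m * (1 - m) + expR m * g z) <= av a J (fun z => expR (g z)).
  apply: av_le; first by apply: bmD; [exact: bm_cst|exact: bmZ].
    exact: bm_exp.
  move=> z _; rewrite -mulrDr -[leRHS](_ : expR m * expR (g z - m) = _); last first.
    by rewrite -expRD; congr expR; ring.
  by rewrite ler_wpM2l ?expR_ge0// (le_trans _ (expR_ge1Dx _))//; apply: eq_lerR; ring.
apply: le_trans; rewrite avD; try exact: bm_cst; try exact: bmZ.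
by rewrite av1 avZ// -/m -mulrDr subrK mulr1.
Qed.

(** The ratio of the two partition functions is the Gibbs average, at the parameters [a], of the
    exponential of the difference of the exponents. *)
Lemma lnZf_jensen a a' J :
  av a J (fun z => ham a' J z - ham a J z) <= ln (Zf a' J) - ln (Zf a J).
Proof.
have bg : bm (fun z => ham a' J z - ham a J z) by apply: bmB; exact: bm_ham.
rewrite -ler_expR (le_trans (av_jensen a J bg))//.
have Z1 := Zf_gt0 a J; have Z2 := Zf_gt0 a' J; have Zi : 0 < (Zf a J)^-1 by rewrite invr_gt0.
rewrite expRD expRN (lnK Z1) (lnK Z2) /av (ler_pM2r Zi).
apply: eq_lerR; apply: eq_Rintegral => z _.
by rewrite /wgt mulrCA -expRD subrK.
Qed.

Lemma ham_diff a a' J z : ham a' J z - ham a J z =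
  \sum_(k < n) ((a' k - a k) * tnth J k * c k z - ((a' k ^+ 2 - a k ^+ 2) / 2) * c k z ^+ 2).
Proof. by rewrite -sumrB; apply: eq_bigr => k _; ring. Qed.

Lemma ham_upd a J k t z :
  ham a (upd J k t) z = ham a (upd J k 0) z + t * (a k * c k z).
Proof.
rewrite /ham (bigD1 k)//= [X in X + _ = _](_ : _ =
   (a k * 0 * c k z - a k ^+ 2 / 2 * c k z ^+ 2) + t * (a k * c k z)); last first.
  by rewrite tnth_upd eqxx; ring.
rewrite [in RHS](bigD1 k)//= tnth_upd eqxx -!addrA; congr (_ + (_ + _)).
rewrite addrC; congr (_ + _); apply: eq_bigr => i /negbTE ik.
by rewrite !tnth_upd ik.
Qed.

(** The derivative in J_k of the Gibbs average of g. *)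
Definition cov a J k g : R := a k * (av a J (fun z => g z * c k z) - av a J g * av a J (c k)).

Lemma num_upd a J k g t : num a (upd J k t) g =
  \int[mu]_z (g z * wgt a (upd J k 0) z * expR (t * (a k * c k z))).
Proof. by apply: eq_Rintegral => z _; rewrite /wgt ham_upd expRD !mulrA. Qed.

Lemma Zf_num a J : Zf a J = num a J (fun=> 1).
Proof. by apply: eq_Rintegral => z _; rewrite mul1r. Qed.

Lemma is_derive_num a J k g t : bm g ->
  is_derive (t : R) (1 : R) (fun t => num a (upd J k t) g)
    (a k * num a (upd J k t) (fun z => g z * c k z)).
Proof.
move=> bg; under eq_fun do rewrite num_upd.
rewrite num_upd.
have := is_derive_exp_integral mu t (bm_numi a (upd J k 0) bg) (bmZ (a k) (bmc k)).
congr (is_derive _ _ _ _).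
rewrite -bIZ; last first.
  apply: bmM; last by apply: bm_exp; do 2 apply: bmZ; exact: bmc.
  by apply: bm_numi; apply: bmM => //; exact: bmc.
by apply: eq_Rintegral => z _; ring.
Qed.

Lemma is_derive_av a J k g t : bm g ->
  is_derive (t : R) (1 : R) (fun t => av a (upd J k t) g) (cov a (upd J k t) k g).
Proof.
move=> bg; rewrite /av /cov.
have d1 := is_derive_num a J k t bg.
have d2 := is_derive_num a J k t (bm_cst Z (1 : R)).
have ZN t' : Zf a (upd J k t') != 0 by rewrite gt_eqF// Zf_gt0.
under eq_fun do rewrite Zf_num.
have N0 : num a (upd J k t) (fun=> 1) != 0 by rewrite -Zf_num.
pose F (t : R) := num a (upd J k t) (fun=> 1).
have d3 := @is_deriveV R F t _ 1 N0 d2.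
apply: (@is_derive_eq _ _ _ _ _ _ _ _ (is_deriveM d1 d3)).
rewrite /F.
rewrite /GRing.scale/=.
have -> : num a (upd J k t) (fun z : Z => 1 * c k z) = num a (upd J k t) (c k).
  by apply: eq_Rintegral => z _; rewrite mul1r.
rewrite /av !Zf_num; move: (ZN t); rewrite Zf_num.
move: (num _ _ _) (num _ _ _) (num _ _ _) (num _ _ _) => x y u v u0.
by rewrite -!exprVn; field.
Qed.

Lemma continuous_av a J k g : bm g -> continuous (fun t : R => av a (upd J k t) g).
Proof.
move=> bg t; apply/differentiable_continuous/derivable1_diffP.
by have [] := is_derive_av a J k t bg.
Qed.

Lemma tame_cov a k g : bm g -> tame (fun J => cov a J k g).
Proof.
move=> bg; apply: tameZ; apply: tameB.
  by apply: tame_av; apply: bmM => //; exact: bmc.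
by apply: tameM; apply: tame_av => //; exact: bmc.
Qed.

(** Gaussian integration by parts in J_k: the derivative of the average of c_k is a_k times its
    Gibbs variance. *)
Lemma E_tnth_av a k :
  \int[gT n]_J (tnth J k * av a J (c k)) =
  a k * (\int[gT n]_J av a J (fun z => c k z ^+ 2) - \int[gT n]_J (av a J (c k) ^+ 2)).
Proof.
have tc := tame_av a (bmc k).
have tc2 := tame_av a (bmX 2 (bmc k)).
rewrite -EB//; last exact: tameX.
rewrite -EZ; last by apply: tameB => //; exact: tameX.
transitivity (\int[gT n]_J cov a J k (c k)); last by [].
apply: E_ibp => //.
- exact: tame_cov (bmc k).
- by move=> J t; exact: is_derive_av (bmc k).
- move=> J t; rewrite /cov; apply: cvgM; first exact: cvg_cst.
  apply: cvgB.
    by apply: continuous_av; apply: bmM; exact: bmc.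
  by apply: cvgM; apply: continuous_av; exact: bmc.
Qed.

Definition free a : R := \int[gT n]_J ln (Zf a J).

Lemma tame_av_diff a a' : tame (fun J => av a J (fun z => ham a' J z - ham a J z)).
Proof.
have -> : (fun J => av a J (fun z => ham a' J z - ham a J z)) =
   (fun J => \sum_(k < n) ((a' k - a k) * (tnth J k * av a J (c k)) -
        ((a' k ^+ 2 - a k ^+ 2) / 2) * av a J (fun z => c k z ^+ 2))).
  apply/funext => J; under eq_fun do rewrite ham_diff.
  rewrite av_sum; last first.
    move=> k; apply: bmB; apply: bmZ; first exact: bmc.
    by apply: bmX; exact: bmc.
  apply: eq_bigr => k _; rewrite avB; try (by apply: bmZ; try apply: bmX; exact: bmc).
  by rewrite !avZ; [rewrite mulrA|apply: bmX; exact: bmc|exact: bmc].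
apply: tame_sum => k; apply: tameB; apply: tameZ.
  by apply: tameM; [exact: tame_tnth|apply: tame_av; exact: bmc].
by apply: tame_av; apply: bmX; exact: bmc.
Qed.

(** The averages of c_k^2 enter with coefficient (a' - a) a - (a'^2 - a^2) / 2, which equals - (a' -
    a)^2 / 2. They are thus of second order in the step, and the squared averages of c_k carry the
    whole first-order term. *)
Lemma E_av_diff a a' :
  \int[gT n]_J av a J (fun z => ham a' J z - ham a J z) =
  \sum_(k < n) (- ((a' k - a k) ^+ 2 / 2) * \int[gT n]_J av a J (fun z => c k z ^+ 2)
     - (a' k - a k) * a k * \int[gT n]_J (av a J (c k) ^+ 2)).
Proof.
transitivity (\int[gT n]_J (\sum_(k < n) ((a' k - a k) * (tnth J k * av a J (c k)) -
        ((a' k ^+ 2 - a k ^+ 2) / 2) * av a J (fun z => c k z ^+ 2)))).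
  apply: eq_Rintegral => J _; under eq_fun do rewrite ham_diff.
  rewrite av_sum; last first.
    move=> k; apply: bmB; apply: bmZ; first exact: bmc.
    by apply: bmX; exact: bmc.
  apply: eq_bigr => k _; rewrite avB; try (by apply: bmZ; try apply: bmX; exact: bmc).
  by rewrite !avZ; [rewrite mulrA|apply: bmX; exact: bmc|exact: bmc].
have t1 k : tame (fun J => tnth J k * av a J (c k)).
  by apply: tameM; [exact: tame_tnth|apply: tame_av; exact: bmc].
have t2 k : tame (fun J => av a J (fun z => c k z ^+ 2)).
  by apply: tame_av; apply: bmX; exact: bmc.
rewrite E_sum; last by move=> k; apply: tameB; exact: tameZ.
apply: eq_bigr => k _; rewrite EB; try exact: tameZ.
by rewrite EZ// EZ// E_tnth_av; field.
Qed.

Lemma E_av_c2_le a k : 0 <= \int[gT n]_J av a J (fun z => c k z ^+ 2) <= D ^+ 2.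
Proof.
have b2 : bm (fun z => c k z ^+ 2) by apply: bmX; exact: bmc.
apply/andP; split.
  by apply: E_ge0 => J; apply: av_ge0 => // z; exact: sqr_ge0.
rewrite -[leRHS](EC n); apply: E_le; [exact: tame_av|exact: tame_cst|].
move=> J; rewrite -[leRHS](av1 a J); apply: av_le => //; first exact: bm_cst.
by move=> z _; rewrite -real_normK ?num_real// lerXn2r ?nnegrE.
Qed.

(** Jensen's inequality replaces a derivative of the free energy: the increment is at least its
    first-order term at the starting point, with an error quadratic in the step. *)
Lemma free_step_lower a a' :
  \sum_(k < n) (- ((a' k - a k) ^+ 2 / 2) * D ^+ 2
     - (a' k - a k) * a k * \int[gT n]_J (av a J (c k) ^+ 2)) <= free a' - free a.
Proof.
rewrite /free -EB; try exact: tame_lnZf.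
apply: (@le_trans _ _ (\int[gT n]_J av a J (fun z => ham a' J z - ham a J z))).
  rewrite E_av_diff; apply: ler_sum => k _; rewrite lerD2r ler_wnM2l//.
    by rewrite oppr_le0 divr_ge0 ?sqr_ge0.
  by have /andP[] := E_av_c2_le a k.
apply: E_le; [exact: tame_av_diff|by apply: tameB; exact: tame_lnZf|].
by move=> J; exact: lnZf_jensen.
Qed.

(** The lower bound with the two parameters exchanged; the first-order term is now taken at the end
    point. *)
Lemma free_step_upper a a' :
  free a' - free a <=
  \sum_(k < n) ((a' k - a k) ^+ 2 / 2 * D ^+ 2
     - (a' k - a k) * a' k * \int[gT n]_J (av a' J (c k) ^+ 2)).
Proof.
have := free_step_lower a' a.
rewrite -[in X in X -> _]lerN2 opprB => /le_trans; apply.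
rewrite -sumrN; apply: ler_sum => k _; apply: eq_lerR; ring.
Qed.

End gibbs.

Section interpolation.
Context d (Z : measurableType d) (R : realType).
Variables (mu : probability Z R) (rho : Z -> R) (n : nat) (c : 'I_n -> Z -> R).
Variable D : R.
Hypothesis D0 : 0 <= D.
Hypothesis brho : bm rho.
Hypothesis rho0 : forall z, 0 <= rho z.
Hypothesis rho_gt0 : 0 < \int[mu]_z rho z.
Hypothesis mc : forall k, measurable_fun setT (c k).
Hypothesis cD : forall k z, `|c k z| <= D.
Local Notation gT := (@gaussT R).
Local Notation av := (av mu rho c).
Local Notation free := (free mu rho c).
Local Notation Zf := (Zf mu rho c).

Lemma add_steps (x y z p q M' i r : R) :
  y - z <= p ^+ 2 / 2 * M' + i * r -> x - y <= (q ^+ 2 - p ^+ 2) / 2 * M' + r ->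
  x - z <= q ^+ 2 / 2 * M' + (i + 1) * r.
Proof.
move=> h1 h2; have := lerD h1 h2.
rewrite [leLHS](_ : _ = x - z); last by ring.
by rewrite [leRHS](_ : _ = q ^+ 2 / 2 * M' + (i + 1) * r)//; ring.
Qed.

(** The form in which every limit of vanishing error is taken below: discretization, truncation
    level, radius, rounding. *)
Lemma le_addM_invn (x y C : R) : (forall m : nat, x <= y + C * m.+1%:R^-1) -> x <= y.
Proof.
move=> H; apply/ler_addgt0Pr => e e0.
pose m := Num.truncn (`|C| / e).
apply: (le_trans (H m)); rewrite lerD2l ler_pdivrMr ?ltr0n//.
rewrite (le_trans (ler_norm _))// mulrC -ler_pdivrMr//.
exact/ltW/truncnS_gt.
Qed.

Section rs_path.
Variables (P : pred 'I_n) (M : R).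
Hypothesis overlap : forall a J,
  \sum_(k < n | ~~ P k) av a J (c k) ^+ 2 <= \sum_(k < n | P k) av a J (c k) ^+ 2 + M.

Let two (s t : R) (k : 'I_n) : R := if P k then s else t.

(** The rational parametrization of a quarter of the unit circle, from (0, 1) at t = 0 to (1, 0) at
    t = 1. The squared strengths, which are the variances, add up to 1, and both strengths are
    Lipschitz in t, so the squared increments are of second order up to the end points. *)
Let path_s (t : R) : R := 2 * t / (1 + t ^+ 2).
Let path_k (t : R) : R := (1 - t ^+ 2) / (1 + t ^+ 2).
Let path (t : R) := two (path_s t) (path_k t).

(** On the circle one variance gains what the other loses, so the first-order terms combine into
    half the gained variance times the difference of the two overlap sums, which [overlap] bounds by
    M. *)
Let rs_step (t u : R) : 0 <= t -> t <= u -> u <= 1 ->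
  free (path u) - free (path t) <=
  (path_s u ^+ 2 - path_s t ^+ 2) / 2 * M + n%:R * D ^+ 2 * (2 * (u - t)) ^+ 2.
Proof.
move=> t0 tu u1.
have tp : 0 < 1 + t ^+ 2 by rewrite ltr_pwDl// sqr_ge0.
have up : 0 < 1 + u ^+ 2 by rewrite ltr_pwDl// sqr_ge0.
have u0 : 0 <= u by exact: le_trans tu.
have circ v : 0 < 1 + v ^+ 2 -> path_k v ^+ 2 = 1 - path_s v ^+ 2.
  by move=> vp; rewrite /path_k /path_s; field; rewrite gt_eqF.
set ds := path_s u - path_s t; set dk := path_k u - path_k t.
have ds1 : ds = 2 * (u - t) * (1 - t * u) / ((1 + t ^+ 2) * (1 + u ^+ 2)).
  by rewrite /ds /path_s; field; rewrite !gt_eqF.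
have dk1 : dk = - (2 * (u - t) * (t + u) / ((1 + t ^+ 2) * (1 + u ^+ 2))).
  by rewrite /dk /path_k; field; rewrite !gt_eqF.
have pp : 0 < (1 + t ^+ 2) * (1 + u ^+ 2) by exact: mulr_gt0.
have tu1 : t * u <= 1 by rewrite mulr_ile1// (le_trans tu).
have dsle : 0 <= ds <= 2 * (u - t).
  rewrite ds1; apply/andP; split.
    by rewrite divr_ge0 ?(ltW pp)// !mulr_ge0 ?subr_ge0.
  rewrite ler_pdivrMr// ler_wpM2l ?mulr_ge0 ?subr_ge0//; nra.
have dkle : 0 <= - dk <= 2 * (u - t).
  rewrite dk1 opprK; apply/andP; split.
    by rewrite divr_ge0 ?(ltW pp)// !mulr_ge0 ?subr_ge0// addr_ge0.
  by rewrite ler_pdivrMr// ler_wpM2l ?mulr_ge0 ?subr_ge0//; nra.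
have ds2 : ds ^+ 2 <= (2 * (u - t)) ^+ 2.
  by case/andP: dsle => h1 h2; rewrite lerXn2r// nnegrE (le_trans h1).
have dk2 : dk ^+ 2 <= (2 * (u - t)) ^+ 2.
  by case/andP: dkle => h1 h2; rewrite -sqrrN lerXn2r// nnegrE (le_trans h1).
have mono : 0 <= path_s u ^+ 2 - path_s t ^+ 2.
  rewrite subr_sqr mulr_ge0//; first by case/andP: dsle.
  by rewrite /path_s addr_ge0// divr_ge0 ?(ltW tp) ?(ltW up)// mulr_ge0.
have := free_step_upper D0 brho rho0 rho_gt0 mc cD (path t) (path u).
move/le_trans; apply.
set O := fun k => \int[gT n]_J (av (path u) J (c k) ^+ 2).
have O0 k : 0 <= O k by apply: E_ge0 => J; exact: sqr_ge0.
have tO k : tame (fun J => av (path u) J (c k) ^+ 2).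
  by apply: tameX; exact: (tame_av D0 brho rho0 rho_gt0 mc cD (path u) (bmc D0 mc cD k)).
have OO : \sum_(k < n | ~~ P k) O k <= \sum_(k < n | P k) O k + M.
  rewrite /O -!E_sum// -[X in _ <= _ + X](EC n) -ED//; [|exact: tame_sum|exact: tame_cst].
  apply: E_le; [exact: tame_sum| apply: tameD;[exact: tame_sum|exact: tame_cst]|].
  by move=> J; exact: overlap.
rewrite (bigID P)/=.
(* With both strengths at the end point, increment times strength is half the increment of the
   square plus half the square of the increment; the latter enters with a favourable sign. *)
rewrite (eq_bigr (fun k => ds ^+ 2 / 2 * D ^+ 2 - (path_s u ^+ 2 - path_s t ^+ 2) / 2 * O k - ds ^+ 2 / 2 * O k)); last first.
  by move=> k Pk; rewrite /path /two Pk -/(O k) /ds; field.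
rewrite [X in _ + X](eq_bigr (fun k => dk ^+ 2 / 2 * D ^+ 2 + (path_s u ^+ 2 - path_s t ^+ 2) / 2 * O k - dk ^+ 2 / 2 * O k)); last first.
  move=> k /negbTE Pk; rewrite /path /two Pk -/(O k) /dk.
  have := circ _ tp; have := circ _ up => h1 h2.
  have -> : path_s u ^+ 2 - path_s t ^+ 2 = path_k t ^+ 2 - path_k u ^+ 2 by rewrite h1 h2; ring.
  by field.
apply: (@le_trans _ _ (\sum_(k < n | P k) ((2 * (u - t)) ^+ 2 * D ^+ 2 - (path_s u ^+ 2 - path_s t ^+ 2) / 2 * O k) +
   \sum_(k < n | ~~ P k) ((2 * (u - t)) ^+ 2 * D ^+ 2 + (path_s u ^+ 2 - path_s t ^+ 2) / 2 * O k))).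
  apply: lerD; apply: ler_sum => k _.
    have h : 0 <= ds ^+ 2 / 2 * O k by rewrite mulr_ge0 ?divr_ge0 ?sqr_ge0.
    have h2 : ds ^+ 2 / 2 * D ^+ 2 <= (2 * (u - t)) ^+ 2 * D ^+ 2.
      by rewrite ler_wpM2r ?sqr_ge0//; have := sqr_ge0 ds; lra.
    lra.
  have h : 0 <= dk ^+ 2 / 2 * O k by rewrite mulr_ge0 ?divr_ge0 ?sqr_ge0.
  have h2 : dk ^+ 2 / 2 * D ^+ 2 <= (2 * (u - t)) ^+ 2 * D ^+ 2.
    by rewrite ler_wpM2r ?sqr_ge0//; have := sqr_ge0 dk; lra.
  lra.
have [K KE] : exists K, K = (2 * (u - t)) ^+ 2 * D ^+ 2 by eexists.
rewrite -!KE.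
rewrite sumrB big_split/= -!mulr_sumr.
have -> : n%:R * D ^+ 2 * (2 * (u - t)) ^+ 2 =
   \sum_(i < n | P i) K + \sum_(i < n | ~~ P i) K.
  by rewrite -(bigID P (fun=> true) (fun=> K))/= sumr_const card_ord -mulr_natl KE; ring.
have : 0 <= (path_s u ^+ 2 - path_s t ^+ 2) / 2 * (\sum_(k < n | P k) O k + M - \sum_(k < n | ~~ P k) O k).
  by rewrite mulr_ge0 ?divr_ge0 ?subr_ge0//; move: mono; rewrite ?subr_ge0.
move=> h; rewrite -subr_ge0; apply: (le_trans h); apply: eq_lerR; ring.
Qed.

(** [P] will mark the couplings and its complement the random fields. Summing the steps of length
    1/m telescopes the squared strength from 0 to 1, which gives M / 2, and leaves an error of order
    1/m. *)
Lemma rs_interpolation :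
  free (fun k => if P k then 1 else 0) <= free (fun k => if P k then 0 else 1) + M / 2.
Proof.
have H m : (m > 0)%N -> free (path 1) - free (path 0) <= M / 2 + 4 * n%:R * D ^+ 2 * m%:R^-1.
  move=> m0; have mp : 0 < m%:R :> R by rewrite ltr0n.
  have Hi i : (i <= m)%N -> free (path (i%:R / m%:R)) - free (path 0) <=
      path_s (i%:R / m%:R) ^+ 2 / 2 * M + i%:R * (n%:R * D ^+ 2 * (2 * m%:R^-1) ^+ 2).
    elim: i => [|i IH] im.
      by rewrite !mul0r /path_s !mulr0 !mul0r expr0n/= !mul0r subrr addr0.
    have t0 : 0 <= i%:R / m%:R :> R by rewrite divr_ge0.
    have tu : i%:R / m%:R <= i.+1%:R / m%:R :> R by rewrite ler_pM2r ?invr_gt0// ler_nat.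
    have u1 : i.+1%:R / m%:R <= 1 :> R by rewrite ler_pdivrMr// mul1r ler_nat.
    have := rs_step t0 tu u1; have := IH (ltnW im).
    have -> : i.+1%:R / m%:R - i%:R / m%:R = m%:R^-1 :> R.
      by rewrite -mulrBl -natr1 addrC addKr mul1r.
    have -> : i.+1%:R = i%:R + 1 :> R by rewrite natr1.
    exact: add_steps.
  have := Hi m (leqnn m); rewrite divff ?gt_eqF//.
  have -> : path_s 1 = 1 by rewrite /path_s expr1n mulr1 divff.
  rewrite expr1n; move/le_trans; apply.
  apply: eq_lerR; field; by rewrite gt_eqF.
have <- : path 0 = (fun k => if P k then 0 else 1).
  apply/funext => k; rewrite /path /two /path_s /path_k.
  by rewrite expr0n/= addr0 subr0 !divr1 mulr0.
have <- : path 1 = (fun k => if P k then 1 else 0).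
  apply/funext => k; rewrite /path /two /path_s /path_k.
  by rewrite expr1n subrr mul0r mulr1 divff.
rewrite -lerBlDl; apply: (@le_addM_invn _ _ (4 * n%:R * D ^+ 2)) => m; exact: H.
Qed.

End rs_path.
End interpolation.

Section gaussian_mgf.
Variable R : realType.
Local Notation gT := (@gaussT R).

Lemma tame_exp_lin n (b : 'I_n -> R) (x : R) :
  tame (fun J : n.-tuple R => expR (\sum_(k < n) b k * tnth J k + x)).
Proof.
apply: (@tame_bnd _ _ _ (expR x) (\sum_(k < n) `|b k|)); rewrite ?expR_ge0 ?sumr_ge0//.
  apply: (measurableT_comp (@measurable_expR _)); apply: measurable_funD => //.
  by apply: measurable_sum => k; meas.
move=> J; rewrite ger0_norm ?expR_ge0// expRD mulrC ler_wpM2l ?expR_ge0// ler_expR.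
rewrite mulr_suml; apply: ler_sum => k _.
by rewrite (le_trans (ler_norm _))// normrM ler_wpM2l// tnth_le_nrm1.
Qed.

Lemma gauss1_mgfR (b : R) : \int[@gauss1 R]_x expR (b * x) = expR (b ^+ 2 / 2).
Proof. by rewrite /Rintegral gauss1_mgf. Qed.

Lemma E_mgf n (b : 'I_n -> R) :
  \int[gT n]_J expR (\sum_(k < n) b k * tnth J k) = expR (\sum_(k < n) b k ^+ 2 / 2).
Proof.
elim: n b => [|n IH] b.
  by rewrite big_ord0; under eq_Rintegral do rewrite big_ord0; rewrite EC.
have t m (b' : 'I_m -> R) : tame (fun J : m.-tuple R => expR (\sum_(k < m) b' k * tnth J k)).
  by have := tame_exp_lin b' 0; under eq_fun do rewrite addr0.
rewrite (ES (t _ b)) big_ord_recl.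
under eq_Rintegral.
  move=> x _.
  under eq_Rintegral.
    move=> s _; rewrite big_ord_recl tnth0 expRD.
    under eq_bigr do rewrite tnthS.
    over.
  rewrite EZ//.
  rewrite IH.
  over.
rewrite RintegralZr//; last first.
  apply: tame1_integrable; apply: (@tame1_bnd _ _ 1 `|b ord0|) => //; first by meas.
  by move=> x; rewrite mul1r ger0_norm ?expR_ge0// ler_expR (le_trans (ler_norm _))// normrM.
by rewrite gauss1_mgfR -expRD.
Qed.

End gaussian_mgf.

(** * Quadratic replica coupling *)

Section replica_coupling.
Context d (Z : measurableType d) (R : realType).
Variables (mu : probability Z R) (rho : Z -> R) (n : nat) (c : 'I_n -> Z -> R).
Variable D : R.
Hypothesis D0 : 0 <= D.
Hypothesis brho : bm rho.
Hypothesis rho0 : forall z, 0 <= rho z.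
Hypothesis rho_gt0 : 0 < \int[mu]_z rho z.
Hypothesis mc : forall k, measurable_fun setT (c k).
Hypothesis cD : forall k z, `|c k z| <= D.
Local Notation gT := (@gaussT R).
Local Notation av := (av mu rho c).
Local Notation free := (free mu rho c).
Local Notation Zf := (Zf mu rho c).
Local Notation wg := (wgt rho c).
Local Notation bmc := (bmc D0 mc cD).

Lemma tameZ_swap d' (T : measurableType d') (Q : probability T R) (f : n.-tuple R * T -> R) (C : R) :
  measurable_fun setT f -> 0 <= C ->
  (forall J z, `|f (J, z)| <= C * expR (C * nrm1 J)) ->
  tame (fun J => \int[Q]_z f (J, z)) /\
  \int[gT n]_J \int[Q]_z f (J, z) = \int[Q]_z \int[gT n]_J f (J, z).
Proof.
move=> mf C0 fC.
have bz J : bm (fun z => f (J, z)).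
  split; first by apply: measurableT_comp => //; exact: measurable_pair1.
  by exists (C * expR (C * nrm1 J)); rewrite ?mulr_ge0 ?expR_ge0.
have tz z : tame (fun J => f (J, z)).
  apply: (@tame_bnd _ _ _ C C) => //.
  by apply: measurableT_comp => //; exact: measurable_pair2.
have tI (g : n.-tuple R * T -> R) : measurable_fun setT g -> (forall J z, `|g (J, z)| <= C * expR (C * nrm1 J)) ->
    tame (fun J => \int[Q]_z g (J, z)).
  move=> mg gC; apply: (@tame_bnd _ _ _ C C) => //; first exact: measurable_Rint_param.
  move=> J; have bg : bm (fun z => g (J, z)).
    split; first by apply: measurableT_comp => //; exact: measurable_pair1.
    by exists (C * expR (C * nrm1 J)); rewrite ?mulr_ge0 ?expR_ge0.
  rewrite (le_trans (le_normr_Rintegral _ _))//; first exact: (bm_integrable Q bg).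
  rewrite -[leRHS](bIC Q); apply: bI_le; [|exact: bm_cst|by []].
  by split; [case: bg => mg' _; meas|exists (C * expR (C * nrm1 J)); rewrite ?mulr_ge0 ?expR_ge0// => z; rewrite normr_id].
split; first exact: tI.
apply: RFubini => //.
- by move=> J; exact: bm_integrable.
- by move=> z; exact: tame_integrable.
- apply: (tame_integrable (f := fun x => \int[Q]_u `|f (x, u)|)).
  apply: (tI (fun p => `|f p|)); first by meas.
  by move=> J z; rewrite normr_id.
Qed.

Definition mu2 : probability (Z * Z)%type R := [the probability _ _ of (mu \x mu)%E].

Lemma mu2_iter (f : Z * Z -> R) : bm f ->
  \int[mu2]_p f p = \int[mu]_z \int[mu]_z' f (z, z').
Proof.
move=> bf.
have bz z : bm (fun z' => f (z, z')).
  have [mf [B B0 fB]] := bf; split; last by exists B.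
  by apply: measurableT_comp => //; exact: measurable_pair1.
rewrite /Rintegral -integral12_prod_meas1; last exact: (bm_integrable mu2 bf).
congr fine; apply: eq_integral => z _.
by rewrite /fubini_F fineK//; exact: integrable_fin_num (bm_integrable mu (bz z)).
Qed.

Lemma bm_param (f : Z * Z -> R) : bm f -> bm (fun z => \int[mu]_z' f (z, z')).
Proof.
move=> [mf [B B0 fB]]; split; first exact: measurable_Rint_param.
exists B => // z.
have bz : bm (fun z' => f (z, z')).
  by split; [apply: measurableT_comp => //; exact: measurable_pair1|exists B].
rewrite (le_trans (le_normr_Rintegral _ _))//; first exact: (bm_integrable mu bz).
rewrite -[leRHS](bIC mu); apply: bI_le => //; last exact: bm_cst.
by split; [case: bz => mg' _; meas|exists B => // z'; rewrite normr_id].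
Qed.

Definition cdot (z z' : Z) : R := \sum_(k < n) c k z * c k z'.

(** The annealed partition function of two replicas, with the average over J already carried out. *)
Definition coupled (K : R) : R :=
  \int[mu2]_p (rho p.1 * rho p.2 * expR (K * cdot p.1 p.2)).

Let bm_l (f : Z -> R) : bm f -> bm (fun p : Z * Z => f p.1).
Proof.
move=> [mf [B B0 fB]]; split; last by exists B.
by apply: (measurableT_comp mf); exact: measurable_fst.
Qed.

Let bm_r (f : Z -> R) : bm f -> bm (fun p : Z * Z => f p.2).
Proof.
move=> [mf [B B0 fB]]; split; last by exists B.
by apply: (measurableT_comp mf); exact: measurable_snd.
Qed.

Let bm_cdot : bm (fun p : Z * Z => cdot p.1 p.2).
Proof. by apply: bm_sum => k; apply: bmM; [apply: bm_l|apply: bm_r]; exact: bmc. Qed.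

Lemma coupled_gt0 K : 0 < coupled K.
Proof.
have [mc2 [B B0 cB]] := bm_cdot.
apply: (@lt_le_trans _ _ (expR (- (`|K| * B)) * (\int[mu]_z rho z) ^+ 2)).
  by rewrite mulr_gt0 ?expR_gt0// exprn_gt0.
have -> : (\int[mu]_z rho z) ^+ 2 = \int[mu2]_p (rho p.1 * rho p.2).
  rewrite mu2_iter; last by apply: bmM; [exact: bm_l|exact: bm_r].
  under [RHS]eq_Rintegral do rewrite /= bIZ//.
  by rewrite RintegralZr//; last exact: bm_integrable.
rewrite -bIZ; last by apply: bmM; [exact: bm_l|exact: bm_r].
apply: bI_le.
- by apply: bmZ; apply: bmM; [exact: bm_l|exact: bm_r].
- by apply: bmM; [apply: bmM; [exact: bm_l|exact: bm_r]|apply: bm_exp; exact: bmZ].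
move=> p; rewrite mulrC ler_wpM2l ?mulr_ge0// ler_expR.
rewrite -lerN2 opprK -mulNr (le_trans (ler_norm _))// normrM normrN ler_wpM2l//.
Qed.

Local Notation cst s := (fun _ : 'I_n => s).

(** Averaging two replicas of strength s over J produces the interaction s^2 [cdot], because the
    individual squares cancel against the normalization in [ham]. The explicit K - s^2 completes it
    to K, so the average does not depend on s. *)
Definition coupledJ (s K : R) (J : n.-tuple R) : R :=
  \int[mu2]_p (wg (cst s) J p.1 * wg (cst s) J p.2 * expR ((K - s ^+ 2) * cdot p.1 p.2)).

Lemma E_coupledJ s K :
  tame (coupledJ s K) /\ \int[gT n]_J coupledJ s K J = coupled K.
Proof.
have [mcd [B B0 cB]] := bm_cdot; have [mrho [Br Br0 rB]] := brho.
pose A := hamA D (cst s); pose B' := hamB D (cst s).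
have A0 : 0 <= A by apply: sumr_ge0 => k _; rewrite mulr_ge0.
have B'0 : 0 <= B' by apply: sumr_ge0 => k _; rewrite mulr_ge0 ?divr_ge0 ?sqr_ge0.
pose C := Br * Br * expR (2 * B') * expR (`|K - s ^+ 2| * B) + 2 * A.
have C0 : 0 <= C by rewrite addr_ge0 ?mulr_ge0 ?expR_ge0.
pose f (q : n.-tuple R * (Z * Z)) : R := wg (cst s) q.1 q.2.1 * wg (cst s) q.1 q.2.2 *
   expR ((K - s ^+ 2) * cdot q.2.1 q.2.2).
have mf : measurable_fun setT f.
  apply: measurable_funM.
    have mw := measurable_wgt2 brho mc (cst s).
    apply: measurable_funM.
      apply: (@measurableT_comp _ _ _ _ _ _ (fun p : n.-tuple R * Z => wg (cst s) p.1 p.2) _ (fun q : n.-tuple R * (Z * Z) => (q.1, q.2.1)) mw).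
      apply/measurable_fun_pairP; split; first exact: measurable_fst.
      exact: (measurableT_comp measurable_fst measurable_snd).
    apply: (@measurableT_comp _ _ _ _ _ _ (fun p : n.-tuple R * Z => wg (cst s) p.1 p.2) _ (fun q : n.-tuple R * (Z * Z) => (q.1, q.2.2)) mw).
    apply/measurable_fun_pairP; split; first exact: measurable_fst.
    exact: (measurableT_comp measurable_snd measurable_snd).
  apply: (measurableT_comp (@measurable_expR _)); apply: measurable_funM => //.
  by apply: (measurableT_comp mcd); exact: measurable_snd.
have fC J p : `|f (J, p)| <= C * expR (C * nrm1 J).
  rewrite /f /= ger0_norm; last by rewrite !mulr_ge0 ?wgt_ge0 ?expR_ge0.
  apply: (@le_trans _ _ ((Br * expR (A * nrm1 J + B')) * (Br * expR (A * nrm1 J + B')) * expR (`|K - s ^+ 2| * B))).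
    have w1 z : 0 <= wg (cst s) J z <= Br * expR (A * nrm1 J + B').
      rewrite wgt_ge0//= /wgt ler_pM ?expR_ge0//.
        by rewrite (le_trans (ler_norm _)).
      by rewrite ler_expR (le_trans (ler_norm _))//; exact: ham_le.
    have /andP[w10 w11] := w1 p.1; have /andP[w20 w21] := w1 p.2.
    apply: ler_pM; rewrite ?mulr_ge0 ?expR_ge0//; first exact: ler_pM.
    by rewrite ler_expR (le_trans (ler_norm _))// normrM ler_wpM2l//; exact: cB.
  rewrite [leLHS](_ : _ = (Br * Br * expR (2 * B') * expR (`|K - s ^+ 2| * B)) * expR ((2 * A) * nrm1 J)); last first.
    have -> : expR (2 * B') = expR B' * expR B' by rewrite -expRD; congr expR; ring.
    have -> : expR ((2 * A) * nrm1 J) = expR (A * nrm1 J) * expR (A * nrm1 J) by rewrite -expRD; congr expR; ring.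
    by rewrite expRD; ring.
  apply: ler_pM; rewrite ?mulr_ge0 ?expR_ge0//; first by rewrite lerDl mulr_ge0.
  by rewrite ler_expR ler_wpM2r ?nrm1_ge0// lerDr !mulr_ge0 ?expR_ge0.
have [tf ->] := tameZ_swap mu2 mf C0 fC.
split; first exact: tf.
apply: eq_Rintegral => p _; rewrite /f /=.
set e2 := - (s ^+ 2 / 2) * (\sum_(k < n) (c k p.1 ^+ 2 + c k p.2 ^+ 2)) + (K - s ^+ 2) * cdot p.1 p.2.
transitivity (\int[gT n]_J (rho p.1 * rho p.2 * expR e2 *
    expR (\sum_(k < n) (s * (c k p.1 + c k p.2)) * tnth J k))).
  apply: eq_Rintegral => J _.
  rewrite /wgt mulrACA -!mulrA -!expRD; congr (_ * (_ * expR _)).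
  rewrite /ham addrA [RHS]addrC [RHS]addrA; congr (_ + _).
  by rewrite mulr_sumr -!big_split/=; apply: eq_bigr => k _; field.
rewrite EZ; last first.
  have := tame_exp_lin (fun k => s * (c k p.1 + c k p.2)) 0.
  by under eq_fun do rewrite addr0.
rewrite E_mgf -mulrA -expRD; congr (_ * expR _).
rewrite /e2 addrAC [X in X + _ = _](_ : _ = s ^+ 2 * cdot p.1 p.2); last first.
  by rewrite /cdot !mulr_sumr -big_split/=; apply: eq_bigr => k _; field.
ring.
Qed.

(** Jensen's inequality in each replica in turn replaces the inner product of the two coefficient
    vectors by the squared norm of their Gibbs average. *)
Lemma coupledJ_ge s K J : s ^+ 2 <= K ->
  0 < coupledJ s K J /\
  2 * ln (Zf (cst s) J) + (K - s ^+ 2) * \sum_(k < n) av (cst s) J (c k) ^+ 2 <=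
  ln (coupledJ s K J).
Proof.
move=> sK.
have Zp : 0 < Zf (cst s) J by apply: (Zf_gt0 D0).
have bw := bm_wgt D0 brho mc cD (cst s) J.
set m := fun k => av (cst s) J (c k).
have bcz z : bm (fun z' => (K - s ^+ 2) * cdot z z').
  by apply: bmZ; apply: bm_sum => k; apply: bmZ; exact: bmc.
have bcm : bm (fun z => (K - s ^+ 2) * \sum_(k < n) m k * c k z).
  by apply: bmZ; apply: bm_sum => k; apply: bmZ; exact: bmc.
have b2 : bm (fun p : Z * Z => wg (cst s) J p.1 * wg (cst s) J p.2 * expR ((K - s ^+ 2) * cdot p.1 p.2)).
  by apply: bmM; [apply: bmM; [exact: bm_l|exact: bm_r]|apply: bm_exp; exact: bmZ].
have bI : bm (fun z => \int[mu]_z' (wg (cst s) J z * wg (cst s) J z' * expR ((K - s ^+ 2) * cdot z z'))).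
  by have := bm_param b2.
have avg z : av (cst s) J (fun z' => (K - s ^+ 2) * cdot z z') =
    (K - s ^+ 2) * \sum_(k < n) m k * c k z.
  rewrite (avZ mu D0)//; last by apply: bm_sum => k; apply: bmZ; exact: bmc.
  congr (_ * _); rewrite (av_sum D0)//; last by move=> k; apply: bmZ; exact: bmc.
  by apply: eq_bigr => k _; rewrite (avZ mu D0)// 1?mulrC//; exact: bmc.
(* Jensen in the second replica with the first one frozen; [X2] then treats the first replica. *)
have X1 : Zf (cst s) J * \int[mu]_z (expR ((K - s ^+ 2) * \sum_(k < n) m k * c k z) * wg (cst s) J z) <= coupledJ s K J.
  have be : bm (fun z => expR ((K - s ^+ 2) * \sum_(k < n) m k * c k z) * wg (cst s) J z).
    by apply: bmM => //; exact: bm_exp.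
  rewrite /coupledJ mu2_iter// -bIZ//.
  apply: bI_le => //; first exact: bmZ.
  move=> z /=.
  have jen := @av_jensen _ _ _ mu rho n c D D0 brho rho0 rho_gt0 mc cD (cst s) J _ (bcz z).
  rewrite avg in jen.
  have -> : \int[mu]_z' (wg (cst s) J z * wg (cst s) J z' * expR ((K - s ^+ 2) * cdot z z')) =
      wg (cst s) J z * (Zf (cst s) J * av (cst s) J (fun z' => expR ((K - s ^+ 2) * cdot z z'))).
    rewrite /av [X in _ = _ * X]mulrCA divff ?mulr1 ?gt_eqF// /num -bIZ; last first.
      by apply: bmM => //; exact: bm_exp.
    by apply: eq_Rintegral => z' _; ring.
  rewrite mulrCA mulrC [leLHS]mulrAC -mulrA mulrC.
  rewrite [leRHS](_ : _ = wg (cst s) J z * Zf (cst s) J * av (cst s) J (fun z' => expR ((K - s ^+ 2) * cdot z z'))); last by ring.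
  rewrite [leLHS](_ : _ = wg (cst s) J z * Zf (cst s) J * expR ((K - s ^+ 2) * \sum_(k < n) m k * c k z)); last by ring.
  by rewrite ler_wpM2l// mulr_ge0 ?(ltW Zp)// wgt_ge0.
have X2 : expR ((K - s ^+ 2) * \sum_(k < n) m k ^+ 2) * Zf (cst s) J <=
    \int[mu]_z (expR ((K - s ^+ 2) * \sum_(k < n) m k * c k z) * wg (cst s) J z).
  have := @av_jensen _ _ _ mu rho n c D D0 brho rho0 rho_gt0 mc cD (cst s) J _ bcm.
  rewrite {2}/av /num ler_pdivlMr//; apply: le_trans.
  rewrite ler_wpM2r ?(ltW Zp)// ler_expR (avZ mu D0)//; last by apply: bm_sum => k; apply: bmZ; exact: bmc.
  apply: eq_lerR; congr (_ * _); rewrite (av_sum D0)//; last by move=> k; apply: bmZ; exact: bmc.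
  by apply: eq_bigr => k _; rewrite (avZ mu D0)//; exact: bmc.
have Xp : 0 < coupledJ s K J.
  apply: lt_le_trans X1; rewrite mulr_gt0//; apply: lt_le_trans X2.
  by rewrite mulr_gt0 ?expR_gt0.
split=> //; rewrite -ler_expR lnK ?posrE//; apply: le_trans X1.
rewrite expRD mulr_natl mulr2n expRD lnK ?posrE// -mulrA ler_wpM2l ?(ltW Zp)//.
by rewrite mulrC.
Qed.

Definition overlap2 (s : R) : R :=
  \sum_(k < n) \int[gT n]_J (av (cst s) J (c k) ^+ 2).

(* Guerra--Toninelli: quadratic coupling of two replicas, bounded by the annealed
   average of the coupled partition function. *)
Lemma free_overlap_le s K : s ^+ 2 <= K ->
  2 * free (cst s) + (K - s ^+ 2) * overlap2 s <= ln (coupled K).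
Proof.
move=> sK; have [tX EX] := E_coupledJ s K; have Cp := coupled_gt0 K.
have tO k : tame (fun J => av (cst s) J (c k) ^+ 2).
  by apply: tameX; apply: (tame_av D0 brho rho0 rho_gt0 mc cD); exact: bmc.
have tl : tame (fun J => ln (Zf (cst s) J)) by exact: (tame_lnZf D0).
have tS : tame (fun J => \sum_(k < n) av (cst s) J (c k) ^+ 2) by exact: tame_sum.
have -> : 2 * free (cst s) = \int[gT n]_J (2 * ln (Zf (cst s) J)) by rewrite EZ.
have -> : (K - s ^+ 2) * overlap2 s =
    \int[gT n]_J ((K - s ^+ 2) * \sum_(k < n) av (cst s) J (c k) ^+ 2).
  by rewrite EZ// E_sum.
rewrite -ED; [|exact: tameZ|exact: tameZ].
(* The logarithm lies below its tangent at the mean value [coupled K]; integrating the tangent gives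
   the annealed bound. *)
apply: (@le_trans _ _ (\int[gT n]_J ((ln (coupled K) - 1) + (coupled K)^-1 * coupledJ s K J))).
  apply: E_le.
  - by apply: tameD; exact: tameZ.
  - by apply: tameD; [exact: tame_cst|exact: tameZ].
  move=> J; have [Xp XJ] := coupledJ_ge J sK; apply: (le_trans XJ).
  have h : -1 < (coupled K)^-1 * coupledJ s K J - 1.
    by rewrite ltrBrDl subrr mulr_gt0 ?invr_gt0.
  have := le_ln1Dx h.
  have Ci : 0 < (coupled K)^-1 by rewrite invr_gt0.
  rewrite addrC subrK (lnM Ci Xp) (lnV Cp).
  by move: (ln _) (ln _) (_^-1 * _) => l k e; lra.
rewrite ED; [|exact: tame_cst|exact: tameZ].
by rewrite EC EZ// EX mulVf ?gt_eqF// subrK.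
Qed.

End replica_coupling.

Section gronwall.
Context d (Z : measurableType d) (R : realType).
Variables (mu : probability Z R) (rho : Z -> R) (n : nat) (c : 'I_n -> Z -> R).
Variable D : R.
Hypothesis D0 : 0 <= D.
Hypothesis brho : bm rho.
Hypothesis rho0 : forall z, 0 <= rho z.
Hypothesis rho_gt0 : 0 < \int[mu]_z rho z.
Hypothesis mc : forall k, measurable_fun setT (c k).
Hypothesis cD : forall k z, `|c k z| <= D.
Local Notation gT := (@gaussT R).
Local Notation fr s := (free mu rho c (fun=> s)).
Local Notation O2 s := (overlap2 mu rho c s).
Local Notation B K := (ln (coupled mu rho c K)).

Lemma free0 : fr 0 = ln (\int[mu]_z rho z).
Proof.
rewrite /free -[RHS](EC n); apply: eq_Rintegral => J _; congr (ln _).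
apply: eq_Rintegral => z _; rewrite /wgt /ham big1 ?expR0 ?mulr1// => k _.
by rewrite expr0n/= !mul0r subrr.
Qed.

Lemma overlap2_ge0 s : 0 <= O2 s.
Proof. by apply: sumr_ge0 => k _; apply: E_ge0 => J; exact: sqr_ge0. Qed.

Lemma gronwall_arith (u x e : R) : 0 < u -> 0 <= x -> 0 <= e -> x <= u ->
  (1 + x / u) * (u - x - e) <= u.
Proof.
move=> u0 x0 e0 xu.
have -> : (1 + x / u) * (u - x - e) = ((u + x) * (u - x - e)) / u.
  by field; rewrite gt_eqF.
rewrite ler_pdivrMr//.
have -> : (u + x) * (u - x - e) = u * u - (x * x + e * (u + x)) by ring.
by rewrite gerBl addr_ge0 ?mulr_ge0 ?addr_ge0// ltW.
Qed.

Lemma gronwall_arith2 (b ft fs e v w : R) : - e - v <= ft - fs -> v <= (b - fs) * w ->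
  b - ft <= (b - fs) * (1 + w) + e.
Proof.
move=> h1 h2; rewrite mulrDr mulr1; move: h1 h2; move: ((b - fs) * w) => W; lra.
Qed.

(** A discrete Gronwall step. Let g(s) be half of ln [coupled] K minus the free energy at strength
    s. Its derivative is s times the overlap, and the quadratic coupling bounds the overlap by 2 g /
    (K - s^2); hence g (K - s^2) does not increase, up to the quadratic error of the step. *)
Let gr_step K s t : 1 < K -> 0 <= s -> s <= t -> t <= 1 ->
  (B K / 2 - fr t) * (K - t ^+ 2) <=
  (B K / 2 - fr s) * (K - s ^+ 2) + K * (n%:R * D ^+ 2 * (t - s) ^+ 2).
Proof.
move=> K1 s0 st t1.
have t0 : 0 <= t by exact: le_trans st.
have s1 : s ^+ 2 <= 1 by rewrite expr_le1// (le_trans st).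
have t21 : t ^+ 2 <= 1 by rewrite expr_le1.
have Ks : 0 < K - s ^+ 2 by rewrite subr_gt0 (le_lt_trans s1).
have Kt : 0 < K - t ^+ 2 by rewrite subr_gt0 (le_lt_trans t21).
have sK : s ^+ 2 <= K by rewrite (le_trans s1)// ltW.
have h1 := free_overlap_le D0 brho rho0 rho_gt0 mc cD sK.
have h2 := free_step_lower D0 brho rho0 rho_gt0 mc cD (fun=> s) (fun=> t).
have O0 := overlap2_ge0 s.
have e0 : 0 <= n%:R * D ^+ 2 * (t - s) ^+ 2 by rewrite mulr_ge0 ?sqr_ge0// mulr_ge0 ?sqr_ge0.
have h3 : - (n%:R * D ^+ 2 * (t - s) ^+ 2) - (t - s) * s * O2 s <= fr t - fr s.
  apply: le_trans h2; rewrite sumrB.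
  have -> : \sum_(i < n) - ((t - s) ^+ 2 / 2) * D ^+ 2 = - (n%:R * D ^+ 2 * (t - s) ^+ 2) / 2.
    by rewrite sumr_const card_ord -mulr_natl; field.
  rewrite -mulr_sumr -/(O2 s); lra.
move: h1 h3 e0 O0; move: (fr t) (fr s) (O2 s) (B K) (n%:R * D ^+ 2 * (t - s) ^+ 2) => ft fs O b e h1 h3 e0 O0.
have D0' : 0 <= b / 2 - fs.
  have P0 : 0 <= (K - s ^+ 2) * O by rewrite mulr_ge0// ltW.
  by rewrite subr_ge0 ler_pdivlMr// mulrC (le_trans _ h1)// lerDl.
have OD : O <= 2 * (b / 2 - fs) / (K - s ^+ 2).
  by rewrite ler_pdivlMr// mulrC mulrBr mulrCA divff// mulr1 lerBrDl.
have h4 : b / 2 - ft <= (b / 2 - fs) * (1 + (2 * (t - s) * s) / (K - s ^+ 2)) + e.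
  have : (t - s) * s * O <= (t - s) * s * (2 * (b / 2 - fs) / (K - s ^+ 2)).
    by rewrite ler_wpM2l// mulr_ge0// subr_ge0.
  rewrite [X in _ <= X -> _](_ : _ = (b / 2 - fs) * (2 * (t - s) * s / (K - s ^+ 2))); last by ring.
  exact: gronwall_arith2 h3.
apply: (@le_trans _ _ (((b / 2 - fs) * (1 + (2 * (t - s) * s) / (K - s ^+ 2)) + e) * (K - t ^+ 2))).
  by rewrite ler_wpM2r// ltW.
rewrite mulrDl lerD//; last first.
  by rewrite mulrC ler_wpM2r// gerBl sqr_ge0.
rewrite -mulrA ler_wpM2l//.
have -> : K - t ^+ 2 = (K - s ^+ 2) - 2 * (t - s) * s - (t - s) ^+ 2 by ring.
apply: gronwall_arith => //; rewrite ?sqr_ge0 ?mulr_ge0 ?subr_ge0//.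
have : 0 <= (t - s) ^+ 2 by exact: sqr_ge0.
move: Kt; have -> : K - t ^+ 2 = (K - s ^+ 2) - 2 * (t - s) * s - (t - s) ^+ 2 by ring.
rewrite -addrA -opprD subr_gt0 => h7 h8; rewrite ltW// (le_lt_trans _ h7)// lerDl.
exact: sqr_ge0.
Qed.

(** At s = 0 the free energy is the logarithm of the total weight. Transporting g (K - s^2) from 0
    to 1 bounds the gap between free and annealed energy by quantities that contain no factor n,
    once the annealed integral is bounded. *)
Lemma free_lower K : 1 < K ->
  (B K / 2 - fr 1) * (K - 1) <= (B K / 2 - ln (\int[mu]_z rho z)) * K.
Proof.
move=> K1.
apply: (@le_addM_invn _ _ _ (K * (n%:R * D ^+ 2))) => m0.
set m := m0.+1; have mp : 0 < m%:R :> R by rewrite ltr0n.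
have Hi i : (i <= m)%N -> (B K / 2 - fr (i%:R / m%:R)) * (K - (i%:R / m%:R) ^+ 2) <=
    (B K / 2 - fr 0) * K + i%:R * (K * (n%:R * D ^+ 2 * m%:R^-1 ^+ 2)).
  elim: i => [|i IH] im.
    by rewrite !mul0r expr0n/= subr0 addr0.
  have t0 : 0 <= i%:R / m%:R :> R by rewrite divr_ge0.
  have tu : i%:R / m%:R <= i.+1%:R / m%:R :> R by rewrite ler_pM2r ?invr_gt0// ler_nat.
  have u1 : i.+1%:R / m%:R <= 1 :> R by rewrite ler_pdivrMr// mul1r ler_nat.
  have := gr_step K1 t0 tu u1; have := IH (ltnW im).
  have -> : i.+1%:R / m%:R - i%:R / m%:R = m%:R^-1 :> R.
    by rewrite -mulrBl -natr1 addrC addKr mul1r.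
  have -> : i.+1%:R * (K * (n%:R * D ^+ 2 * m%:R^-1 ^+ 2)) = i%:R * (K * (n%:R * D ^+ 2 * m%:R^-1 ^+ 2)) + K * (n%:R * D ^+ 2 * m%:R^-1 ^+ 2).
    by rewrite -natr1 mulrDl mul1r.
  move=> h1 h2; apply: (le_trans h2); rewrite addrA lerD2r; exact: h1.
have := Hi m (leqnn m); rewrite divff ?gt_eqF// expr1n free0.
move/le_trans; apply; rewrite lerD2l; apply: eq_lerR; field.
by rewrite gt_eqF.
Qed.

(** The bound on the free energy at s = 1, fed back into the quadratic coupling inequality, controls
    the overlap itself. *)
Lemma overlap2_le K : 1 < K ->
  O2 1 <= 2 * ((B K / 2 - ln (\int[mu]_z rho z)) * K) / (K - 1) / (K - 1).
Proof.
move=> K1; have K0 : 0 < K - 1 by rewrite subr_gt0.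
have s1 : (1 : R) ^+ 2 <= K by rewrite expr1n ltW.
have := free_overlap_le D0 brho rho0 rho_gt0 mc cD s1; rewrite expr1n.
have := free_lower K1.
rewrite -ler_pdivlMr// => h1 h2.
rewrite ler_pdivlMr// mulrC.
move: h1 h2; move: (fr 1) (O2 1) ((B K / 2 - _) * K) => f O e h1 h2.
have : (K - 1) * O <= 2 * (B K / 2 - f) by lra.
move/le_trans; apply; rewrite -mulrA; rewrite ler_wpM2l//.
Qed.

End gronwall.

(** * Moments of multilinear gaussian polynomials *)

Section gaussian_moments.
Variable R : realType.
Local Notation g1 := (@gauss1 R).
Local Notation gT := (@gaussT R).

Definition mom (e : nat) : R := \int[g1]_x x ^+ e.

Lemma tame1_exp e : tame1 (fun x : R => x ^+ e).
Proof. exact: (tame1X e (tame1_id R)). Qed.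

Lemma mom0 : mom 0 = 1.
Proof. by rewrite /mom; under eq_Rintegral do rewrite expr0; exact: E1C. Qed.

Lemma momS e : mom e.+2 = e.+1%:R * mom e.
Proof.
rewrite /mom -RintegralZl//; last exact: (tame1_integrable (tame1_exp e)).
under eq_Rintegral do rewrite exprS.
apply: gauss1_ibp.
- move=> x; have h := @is_deriveX R _ id e.+1 x (1 : R) _ (is_derive_id x (1 : R)).
  rewrite (_ : (fun x0 : R => x0 ^+ e.+1) = (id : R -> R) ^+ e.+1); last by rewrite exprfctE.
  by apply: (@is_derive_eq _ _ _ _ _ _ _ _ h); rewrite /GRing.scale/= mulr1.
- by move=> x; apply: cvgM; [exact: cvg_cst|exact: exprn_continuous].
- exact: tame1_exp.
- by apply: tame1M; [exact: tame1_cst|exact: tame1_exp].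
Qed.

Lemma mom1 : mom 1 = 0.
Proof.
transitivity (\int[g1]_x (x * (fun=> 1 : R) x)).
  by apply: eq_Rintegral => x _; rewrite expr1 mulr1.
rewrite (_ : 0 = \int[g1]_x (fun=> 0 : R) x); last by rewrite E1C.
apply: gauss1_ibp.
- by move=> x; exact: cvg_cst.
- exact: tame1_cst.
- exact: tame1_cst.
Qed.

Lemma mom2 : mom 2 = 1. Proof. by rewrite momS mom0 mulr1. Qed.
Lemma mom3 : mom 3 = 0. Proof. by rewrite momS mom1 mulr0. Qed.
Lemma mom4 : mom 4 = 3. Proof. by rewrite momS mom2 mulr1. Qed.

Lemma mom_ge0 e : 0 <= mom e.
Proof.
elim/ltn_ind: e => -[_|[_|e IH]]; first by rewrite mom0.
  by rewrite mom1.
by rewrite momS mulr_ge0// IH.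
Qed.

Lemma tame_coord n (f : R -> R) (k : 'I_n) : tame1 f -> tame (fun J : n.-tuple R => f (tnth J k)).
Proof.
move=> [mf [C C0 fC]]; apply: (@tame_bnd _ _ _ C C) => //.
  by apply: (measurableT_comp mf); exact: measurable_tnth.
move=> J; rewrite (le_trans (fC _))// ler_wpM2l// ler_expR ler_wpM2l//.
exact: tnth_le_nrm1.
Qed.

Lemma tame_prod n (I : Type) (r : seq I) (P : pred I) (f : I -> n.-tuple R -> R) :
  (forall i, tame (f i)) -> tame (fun x => \prod_(i <- r | P i) f i x).
Proof.
move=> tf; elim: r => [|i r IH].
  by under eq_fun do rewrite big_nil; exact: tame_cst.
under eq_fun do rewrite big_cons.
by case: (P i) => //; exact: tameM.
Qed.

Lemma E_prod n (f : 'I_n -> R -> R) : (forall k, tame1 (f k)) ->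
  \int[gT n]_J (\prod_(k < n) f k (tnth J k)) = \prod_(k < n) \int[g1]_x f k x.
Proof.
elim: n f => [|n IH] f tf.
  by under eq_Rintegral do rewrite big_ord0; rewrite EC big_ord0.
have tp m (g : 'I_m -> R -> R) : (forall k, tame1 (g k)) -> tame (fun J : m.-tuple R => \prod_(k < m) g k (tnth J k)).
  by move=> tg; apply: tame_prod => k; exact: tame_coord.
rewrite (ES (tp _ _ tf)) big_ord_recl.
transitivity (\int[g1]_x (f ord0 x * \prod_(k < n) \int[g1]_x f (lift ord0 k) x)).
  apply: eq_Rintegral => x _; rewrite -(IH (fun k => f (lift ord0 k)))// -EZ; last exact: (tp _ (fun k => f (lift ord0 k))).
  by apply: eq_Rintegral => s _; rewrite big_ord_recl tnth0; under eq_bigr do rewrite tnthS.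
by rewrite RintegralZr//; exact: tame1_integrable.
Qed.

Definition monom n (l : seq 'I_n) (J : n.-tuple R) : R := \prod_(k <- l) tnth J k.

Lemma tame_monom n (l : seq 'I_n) : tame (monom l).
Proof. by apply: tame_prod => k; exact: tame_tnth. Qed.

Lemma monomE n (l : seq 'I_n) J : monom l J = \prod_(k < n) tnth J k ^+ count_mem k l.
Proof.
rewrite /monom; elim: l => [|a l IH].
  by rewrite big_nil big1// => k _; rewrite expr0.
rewrite big_cons IH [in RHS](bigD1 a)//= [in LHS](bigD1 a)//= eqxx add1n exprS mulrA.
congr (_ * _); apply: eq_bigr => k /negbTE ka.
by rewrite eq_sym ka add0n.
Qed.

Lemma E_monom n (l : seq 'I_n) :
  \int[gT n]_J monom l J = \prod_(k < n) mom (count_mem k l).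
Proof.
under eq_Rintegral do rewrite monomE.
by rewrite (E_prod (f := fun k x => x ^+ count_mem k l))// => k; exact: tame1_exp.
Qed.

(** Nonnegativity allows a lower bound on the quadratic form of the path vector to discard every
    pair of paths except those differing by one step. *)
Lemma E_monom_ge0 n (l : seq 'I_n) : 0 <= \int[gT n]_J monom l J.
Proof. by rewrite E_monom; apply: prodr_ge0 => k _; exact: mom_ge0. Qed.

Lemma E_monom_eq0 n (l : seq 'I_n) k : count_mem k l = 1%N -> \int[gT n]_J monom l J = 0.
Proof. by move=> h; rewrite E_monom (bigD1 k)//= h mom1 mul0r. Qed.

Lemma E_monom_dbl n (l l' : seq 'I_n) : uniq l -> perm_eq l' (l ++ l) -> \int[gT n]_J monom l' J = 1.
Proof.
move=> ul pl; rewrite E_monom big1// => k _.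
move/permP : pl => ->; rewrite count_cat (count_uniq_mem k ul).
by case: (k \in l); rewrite ?mom0// mom2.
Qed.

Lemma E_CS n (f g : n.-tuple R -> R) : tame f -> tame g ->
  (\int[gT n]_J (f J * g J)) ^+ 2 <= (\int[gT n]_J f J ^+ 2) * (\int[gT n]_J g J ^+ 2).
Proof.
move=> tf tg; set a := \int[gT n]_J f J ^+ 2; set b := \int[gT n]_J g J ^+ 2.
set p := \int[gT n]_J (f J * g J).
have a0 : 0 <= a by apply: E_ge0 => J; exact: sqr_ge0.
have b0 : 0 <= b by apply: E_ge0 => J; exact: sqr_ge0.
have H x y : 0 <= x ^+ 2 * a + (2 * x * y * p + y ^+ 2 * b).
  have -> : x ^+ 2 * a + (2 * x * y * p + y ^+ 2 * b) = \int[gT n]_J ((x * f J + y * g J) ^+ 2).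
    rewrite /a /b /p -!EZ; try exact: tameX; try exact: tameM.
    rewrite -!ED; try by tm.
    by apply: eq_Rintegral => J _; ring.
  by apply: E_ge0 => J; exact: sqr_ge0.
(* In the degenerate case the quadratic is affine in y. If p were nonzero, y = - (a + 1) / p would
   give the negative value - a - 2. *)
have [b00|bn0] := eqVneq b 0.
  have h1 := H 1 (- p * (a + 1)); have h2 := H (- 1) p.
  rewrite b00 mulr0.
  have : 0 <= a - 2 * p ^+ 2 * (a + 1).
    by move: h1; rewrite b00 [X in 0 <= X](_ : _ = a - 2 * p ^+ 2 * (a + 1)); last by ring.
  move=> h3; have h4 : 0 <= p ^+ 2 by exact: sqr_ge0.
  rewrite leNgt; apply/negP => p2.
  have := H 1 (- (a + 1) / p); rewrite b00 mulr0 addr0 expr1n mul1r mulr1.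
  have pn0 : p != 0 by move: p2; apply: contraTneq => ->; rewrite expr0n/= ltxx.
  rewrite -mulrA divfK//; lra.
have bp : 0 < b by rewrite lt_def bn0.
have := H b (- p).
rewrite [X in 0 <= X](_ : _ = b * (a * b - p ^+ 2)); last by ring.
by rewrite pmulr_rge0// subr_ge0.
Qed.

(** Multilinear polynomials of degree at most d, by splitting off the first coordinate as A + x B.
    The factor B has degree at most d - 1, and vanishes when d = 0. This is the decomposition on
    which the fourth-moment induction runs. *)
Fixpoint mlin n d : (n.-tuple R -> R) -> Prop :=
  match n return (n.-tuple R -> R) -> Prop with
  | 0 => fun _ => True
  | n'.+1 => fun f => exists A B : n'.-tuple R -> R,
      [/\ mlin d A, (if d is d'.+1 then mlin d' B else forall s, B s = 0) &
          forall (x : R) (s : n'.-tuple R), f [tuple of x :: s] = A s + x * B s]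
  end.

Lemma mlin_ext n d (f g : n.-tuple R -> R) : f =1 g -> mlin d f -> mlin d g.
Proof. by move=> /funext ->. Qed.

Lemma mlin_const n d (a : R) : mlin d (fun _ : n.-tuple R => a).
Proof.
elim: n d a => [//|n IH] d a /=; exists (fun=> a), (fun=> 0); split; first exact: IH.
  by case: d => // d; exact: IH.
by move=> x s; rewrite mulr0 addr0.
Qed.

Lemma mlinD n d (f g : n.-tuple R -> R) : mlin d f -> mlin d g -> mlin d (fun x => f x + g x).
Proof.
elim: n d f g => [//|n IH] d f g /= [A [B [hA hB fE]]] [A' [B' [hA' hB' gE]]].
exists (fun s => A s + A' s), (fun s => B s + B' s); split.
- exact: IH.
- by case: d hA hA' hB hB' => [_ _ h1 h2 s|d _ _ h1 h2]; [rewrite h1 h2 addr0|exact: IH].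
- by move=> x s; rewrite fE gE; ring.
Qed.

Lemma mlinZ n d (a : R) (f : n.-tuple R -> R) : mlin d f -> mlin d (fun x => a * f x).
Proof.
elim: n d f => [//|n IH] d f /= [A [B [hA hB fE]]].
exists (fun s => a * A s), (fun s => a * B s); split.
- exact: IH.
- by case: d hA hB => [_ h1 s|d _ h1]; [rewrite h1 mulr0|exact: IH].
- by move=> x s; rewrite fE; ring.
Qed.

Lemma mlin_sum n d (I : Type) (r : seq I) (P : pred I) (f : I -> n.-tuple R -> R) :
  (forall i, P i -> mlin d (f i)) -> mlin d (fun x => \sum_(i <- r | P i) f i x).
Proof.
move=> hf; elim: r => [|i r IH].
  by apply: (mlin_ext (f := fun=> 0)); [move=> x; rewrite big_nil|exact: mlin_const].
case Pi : (P i); last by apply: mlin_ext IH => x; rewrite big_cons Pi.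
apply: (mlin_ext (f := fun x => f i x + \sum_(i <- r | P i) f i x)).
  by move=> x; rewrite big_cons Pi.
by apply: mlinD => //; exact: hf.
Qed.

Lemma mlin_prod n d (e : 'I_n -> bool) : (\sum_(k < n) e k <= d)%N ->
  mlin d (fun J : n.-tuple R => \prod_(k < n) tnth J k ^+ e k).
Proof.
elim: n d e => [//|n IH] d e; rewrite big_ord_recl => ed /=.
case e0 : (e ord0) ed => /= ed.
  exists (fun=> 0), (fun s => \prod_(k < n) tnth s k ^+ e (lift ord0 k)); split.
  - exact: mlin_const.
  - by case: d ed => [//|d]; rewrite add1n ltnS => ed; exact: (IH d (fun k => e (lift ord0 k))).
  - move=> x s; rewrite add0r big_ord_recl tnth0 e0 expr1; congr (_ * _).
    by under eq_bigr do rewrite tnthS.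
exists (fun s => \prod_(k < n) tnth s k ^+ e (lift ord0 k)), (fun=> 0); split.
- exact: (IH d (fun k => e (lift ord0 k))).
- by case: d ed => // d _; exact: mlin_const.
- move=> x s; rewrite mulr0 addr0 big_ord_recl tnth0 e0 expr0 mul1r.
  by under eq_bigr do rewrite tnthS.
Qed.

Lemma mlin_monom n d (l : seq 'I_n) : uniq l -> (size l <= d)%N -> mlin d (monom l).
Proof.
move=> ul sl; apply: (mlin_ext (f := fun J => \prod_(k < n) tnth J k ^+ (k \in l))).
  by move=> J; rewrite monomE; apply: eq_bigr => k _; rewrite count_uniq_mem.
apply: mlin_prod; apply: leq_trans sl.
rewrite (eq_bigr (fun k => if k \in l then 1%N else 0%N)); last by move=> k _; case: (k \in l).
by rewrite -big_mkcond sum1_card card_size.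
Qed.

Lemma tame_tail n (f : n.-tuple R -> R) : tame f ->
  tame (fun J : n.+1.-tuple R => f [tuple of behead J]).
Proof.
move=> [mf [C C0 fC]]; apply: (@tame_bnd _ _ _ C C) => //.
  by apply: (measurableT_comp mf); exact: measurable_behead.
move=> J; rewrite (le_trans (fC _))// ler_wpM2l// ler_expR ler_wpM2l//.
by rewrite [in leRHS](tuple_eta J) nrm1_cons lerDr.
Qed.

Lemma E_head_tail n (g : R -> R) (f : n.-tuple R -> R) : tame1 g -> tame f ->
  \int[gT n.+1]_J (g (thead J) * f [tuple of behead J]) = \int[g1]_x g x * \int[gT n]_s f s.
Proof.
move=> tg tf; rewrite ES; last first.
  apply: tameM; last exact: tame_tail.
  by have := @tame_coord n.+1 g ord0 tg.
rewrite -RintegralZr//; last exact: tame1_integrable.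
apply: eq_Rintegral => x _; rewrite -EZ//; apply: eq_Rintegral => s _.
by congr (g _ * f _); apply: val_inj.
Qed.

Lemma mlin_split n (f : n.+1.-tuple R -> R) (A B : n.-tuple R -> R) :
  (forall (x : R) (s : n.-tuple R), f [tuple of x :: s] = A s + x * B s) ->
  f = fun J => A [tuple of behead J] + thead J * B [tuple of behead J].
Proof. by move=> fE; apply/funext => J; rewrite {1}(tuple_eta J) fE. Qed.

Lemma mlin_tame n d (f : n.-tuple R -> R) : mlin d f -> tame f.
Proof.
elim: n d f => [|n IH] d f.
  move=> _; have -> : f = fun _ => f [tuple] by apply/funext => x; rewrite tuple0.
  exact: tame_cst.
move=> /= [A [B [hA hB fE]]].
have tB : tame B.
  case: d hA hB => [_ h|d _ h]; last exact: IH h.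
  have -> : B = fun=> 0 by apply/funext.
  exact: tame_cst.
rewrite (mlin_split fE); apply: tameD; first exact: tame_tail (IH _ _ hA).
apply: tameM; [exact: tame_tnth|exact: tame_tail].
Qed.

Lemma E_pow_mlin n (A B : n.-tuple R -> R) e e' e'' : tame A -> tame B ->
  \int[gT n.+1]_J (thead J ^+ e * (A [tuple of behead J] ^+ e' * B [tuple of behead J] ^+ e'')) =
  mom e * \int[gT n]_s (A s ^+ e' * B s ^+ e'').
Proof.
move=> tA tB.
rewrite (E_head_tail (g := fun x => x ^+ e) (f := fun s => A s ^+ e' * B s ^+ e''))//.
- exact: tame1_exp.
- by tm.
Qed.

(** For f = A + x B the odd moments of x vanish, so the fourth moment is E A^4 + 6 E A^2 B^2 + 3 E
    B^4 and the second is E A^2 + E B^2. The drop in degree gives B a spare factor 9, which pays for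
    the mixed term through the Cauchy-Schwarz inequality. *)
Lemma mlin_hypercontractive n d (f : n.-tuple R -> R) : mlin d f ->
  \int[gT n]_J f J ^+ 4 <= 9 ^+ d * (\int[gT n]_J f J ^+ 2) ^+ 2.
Proof.
elim: n d f => [|n IH] d f.
  move=> _; have -> : f = fun _ => f [tuple] by apply/funext => x; rewrite tuple0.
  rewrite !EC -exprM ler_peMl//; last by rewrite exprn_ege1// ler1n.
  by rewrite (exprM _ 2 2) sqr_ge0.
move=> hf; have [A [B [hA hB fE]]] := hf.
have tA := mlin_tame hA.
have [tB B4] : tame B /\ \int[gT n]_s B s ^+ 4 * 9 <= 9 ^+ d * (\int[gT n]_s B s ^+ 2) ^+ 2.
  case: d hf hA hB => [_ _ h|d _ _ h].
    have -> : B = fun=> 0 by apply/funext.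
    by split; [exact: tame_cst|rewrite !EC !expr0n/= !mul0r mulr0].
  split; first exact: mlin_tame h.
  by rewrite mulrC exprS -mulrA ler_wpM2l// IH.
have A4 := IH _ _ hA.
have tt (g : n.-tuple R -> R) : tame g -> tame (fun J : n.+1.-tuple R => g [tuple of behead J]) by exact: tame_tail.
have th : tame (fun J : n.+1.-tuple R => thead J) by exact: tame_tnth.
set a := \int[gT n]_s A s ^+ 2 in A4 *; set b := \int[gT n]_s B s ^+ 2 in B4 *.
have a0 : 0 <= a by apply: E_ge0 => s; exact: sqr_ge0.
have b0 : 0 <= b by apply: E_ge0 => s; exact: sqr_ge0.
have pE e e' e'' := E_pow_mlin e e' e'' tA tB.
have tp e e' e'' : tame (fun J : n.+1.-tuple R => thead J ^+ e * (A [tuple of behead J] ^+ e' * B [tuple of behead J] ^+ e'')).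
  by apply: tameM; [exact: tameX|apply: tameM; apply: tameX; exact: tt].
have f2 : \int[gT n.+1]_J f J ^+ 2 = a + b.
  rewrite (mlin_split fE).
  transitivity (\int[gT n.+1]_J (thead J ^+ 0 * (A [tuple of behead J] ^+ 2 * B [tuple of behead J] ^+ 0) +
    (2 * (thead J ^+ 1 * (A [tuple of behead J] ^+ 1 * B [tuple of behead J] ^+ 1)) +
     thead J ^+ 2 * (A [tuple of behead J] ^+ 0 * B [tuple of behead J] ^+ 2)))).
    by apply: eq_Rintegral => J _; ring.
  have t0 := tp 0%N 2%N 0%N; have t1 := tp 1%N 1%N 1%N; have t2 := tp 2%N 0%N 2%N.
  rewrite (ED t0 (tameD (tameZ 2 t1) t2)) (ED (tameZ 2 t1) t2) (EZ 2 t1).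
  rewrite !pE mom0 mom1 mom2 !mul1r !mul0r mulr0 add0r.
  by congr (_ + _); apply: eq_Rintegral => s _; rewrite ?expr0 ?mulr1 ?mul1r.
set ab := \int[gT n]_s (A s ^+ 2 * B s ^+ 2).
have f4 : \int[gT n.+1]_J f J ^+ 4 = \int[gT n]_s A s ^+ 4 + (6 * ab + 3 * \int[gT n]_s B s ^+ 4).
  rewrite (mlin_split fE).
  transitivity (\int[gT n.+1]_J (thead J ^+ 0 * (A [tuple of behead J] ^+ 4 * B [tuple of behead J] ^+ 0) +
    (4 * (thead J ^+ 1 * (A [tuple of behead J] ^+ 3 * B [tuple of behead J] ^+ 1)) +
     (6 * (thead J ^+ 2 * (A [tuple of behead J] ^+ 2 * B [tuple of behead J] ^+ 2)) +
     (4 * (thead J ^+ 3 * (A [tuple of behead J] ^+ 1 * B [tuple of behead J] ^+ 3)) +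
     thead J ^+ 4 * (A [tuple of behead J] ^+ 0 * B [tuple of behead J] ^+ 4)))))).
    by apply: eq_Rintegral => J _; ring.
  have t1 := tp 1%N 3%N 1%N; have t2 := tp 2%N 2%N 2%N; have t3 := tp 3%N 1%N 3%N; have t4 := tp 4%N 0%N 4%N.
  have t0 := tp 0%N 4%N 0%N.
  have u3 := tameD (tameZ 4 t3) t4; have u2 := tameD (tameZ 6 t2) u3; have u1 := tameD (tameZ 4 t1) u2.
  rewrite (ED t0 u1) (ED (tameZ 4 t1) u2) (ED (tameZ 6 t2) u3) (ED (tameZ 4 t3) t4).
  rewrite (EZ 4 t1) (EZ 6 t2) (EZ 4 t3).
  rewrite !pE mom0 mom1 mom2 mom3 mom4 !mul1r !mul0r !mulr0 !add0r.
  congr (_ + (_ + 3 * _)); apply: eq_Rintegral => s _; rewrite ?expr0 ?mulr1 ?mul1r//.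
have ab2 : ab ^+ 2 <= (\int[gT n]_s A s ^+ 4) * (\int[gT n]_s B s ^+ 4).
  have := E_CS (tameX 2 tA) (tameX 2 tB).
  by rewrite -/ab; under [X in _ <= X * _ -> _]eq_Rintegral do rewrite -exprM;
     under [X in _ <= _ * X -> _]eq_Rintegral do rewrite -exprM.
have ab0 : 0 <= ab by apply: E_ge0 => s; rewrite mulr_ge0 ?sqr_ge0.
have EB0 : 0 <= \int[gT n]_s B s ^+ 4 by apply: E_ge0 => s; rewrite (exprM _ 2 2) sqr_ge0.
rewrite f2 f4; move: A4 B4 ab2 EB0; move: (\int[gT n]_s A s ^+ 4) (\int[gT n]_s B s ^+ 4) => x y.
have c0 : 0 < 9 ^+ d :> R by rewrite exprn_gt0.
move: (9 ^+ d) c0 => c c0 A4 B4 ab2 y0.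
(* Squared, this is Cauchy-Schwarz followed by the bounds on A and B; 3^2 = 9 is exactly the factor
   gained from the lower degree of B. *)
have abc : 3 * ab <= c * (a * b).
  have c0' := ltW c0.
  rewrite -ler_sqr ?nnegrE; [|by rewrite mulr_ge0|by rewrite !mulr_ge0].
  rewrite exprMn (_ : 3 ^+ 2 = 9); last by ring.
  apply: (@le_trans _ _ (x * (y * 9))).
    by rewrite mulrC mulrA ler_wpM2r.
  apply: (@le_trans _ _ ((c * a ^+ 2) * (c * b ^+ 2))); last by apply: eq_lerR; ring.
  apply: (@le_trans _ _ ((c * a ^+ 2) * (y * 9))).
    by rewrite ler_wpM2r// mulr_ge0.
  by rewrite ler_wpM2l// mulr_ge0// sqr_ge0.
have -> : c * (a + b) ^+ 2 = c * a ^+ 2 + 2 * (c * (a * b)) + c * b ^+ 2 by ring.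
move: (c * a ^+ 2) (c * b ^+ 2) (c * (a * b)) A4 B4 abc => u v w; lra.
Qed.

End gaussian_moments.

(** * Self-avoiding paths and the top eigenvalue *)

Section edge_index.
Variable N : nat.

Lemma pr_subproof (i j : 'I_N) : (i * N + j < N * N)%N.
Proof.
apply: (@leq_trans (i * N + N)); first by rewrite ltn_add2l.
by rewrite -mulSnr leq_mul2r ltn_ord orbT.
Qed.

(** Row-major position, the indexing of the couplings in [hamil]. *)
Definition pr (i j : 'I_N) : 'I_(N * N) := Ordinal (pr_subproof i j).

Lemma pr_inj i j i' j' : pr i j = pr i' j' -> i = i' /\ j = j'.
Proof.
move=> /(congr1 val)/= h.
have N0 : (0 < N)%N by rewrite (leq_ltn_trans _ (ltn_ord i)).
have := congr1 (modn^~ N) h; have := congr1 (divn^~ N) h.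
rewrite !divnMDl// !modnMDl !divn_small// !modn_small// !addn0 => h1 h2.
by split; apply: val_inj.
Qed.

Lemma sum_pr (V : nmodType) (F : 'I_(N * N) -> V) :
  \sum_(k < N * N) F k = \sum_(i < N) \sum_(j < N) F (pr i j).
Proof.
rewrite pair_bigA/= (reindex (fun p : 'I_N * 'I_N => pr p.1 p.2))//=.
apply: onW_bij.
have inj : injective (fun p : 'I_N * 'I_N => pr p.1 p.2).
  by move=> [i j] [i' j'] /pr_inj/= [-> ->].
by apply: inj_card_bij => //; rewrite card_prod !card_ord.
Qed.

End edge_index.

Section self_avoiding_paths.
Variables (N : nat) (r : 'I_N).

(* A path is a list of oriented steps, the last step coming first; the orientation of a
   step tells which of the two entries J_ij, J_ji of its edge is used. *)
Definition pstep := (bool * 'I_N)%type.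

Definition ep (p : seq pstep) : 'I_N := if p is s :: _ then s.2 else r.
Definition verts (p : seq pstep) : seq 'I_N := rcons (map snd p) r.
Definition ev (o : bool) (i j : 'I_N) := if o then pr i j else pr j i.
Fixpoint vars (p : seq pstep) : seq 'I_(N * N) :=
  if p is s :: q then ev s.1 (ep q) s.2 :: vars q else [::].
Fixpoint valid (p : seq pstep) : bool :=
  if p is s :: q then (s.2 \notin verts q) && valid q else true.

Lemma ep_verts p : ep p \in verts p.
Proof. by case: p => [|s p]; rewrite /verts ?mem_seq1//= in_cons eqxx. Qed.

Lemma verts_cons s p : verts (s :: p) = s.2 :: verts p. Proof. by []. Qed.

Lemma valid_uniq p : valid p = uniq (verts p).
Proof. by elim: p => //= s p ->. Qed.

Lemma vars_sub p i j : pr i j \in vars p -> (i \in verts p) && (j \in verts p).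
Proof.
elim: p => [//|s p IH]; rewrite in_cons verts_cons !in_cons => /orP[/eqP|/IH/andP[-> ->]]; last by rewrite !orbT.
rewrite /ev; case: s.1 => /pr_inj[-> ->]; rewrite eqxx ep_verts ?orbT//.
Qed.

Lemma head_var_notin s p : s.2 \notin verts p -> ev s.1 (ep p) s.2 \notin vars p.
Proof.
move=> sp; apply/negP; rewrite /ev; case: s.1 => /vars_sub/andP[h1 h2].
  by rewrite h2 in sp.
by rewrite h1 in sp.
Qed.

Lemma vars_uniq p : valid p -> uniq (vars p).
Proof. by elim: p => //= s p IH /andP[sp /IH ->]; rewrite head_var_notin. Qed.

Lemma size_vars p : size (vars p) = size p.
Proof. by elim: p => //= s p ->. Qed.

Lemma ev_inj o o' i i' j : i != j -> i' != j -> ev o i j = ev o' i' j -> o = o' /\ i = i'.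
Proof.
rewrite /ev => /negP ij /negP i'j; case: o; case: o' => /pr_inj[h1 h2] //.
- by case: ij; rewrite h1.
- by case: ij; rewrite h2.
Qed.

(** The end point of a self-avoiding path lies on its last edge only. Two paths with the same
    variables and the same end point therefore share the last edge with its orientation; remove it
    and recurse. *)
Lemma vars_inj p p' : valid p -> valid p' -> ep p = ep p' -> vars p =i vars p' -> p = p'.
Proof.
elim: p p' => [|s p IH] [|s' p'] //.
- by move=> _ _ _ /(_ (ev s'.1 (ep p') s'.2)); rewrite /= in_cons eqxx in_nil.
- by move=> _ _ _ /(_ (ev s.1 (ep p) s.2)); rewrite /= in_cons eqxx in_nil.
move=> /andP[sp vp] /andP[sp' vp']; rewrite [ep (s :: p)]/= [ep (s' :: p')]/= => ss' vv.
have dis q e i o : i \notin verts q -> e \in vars q -> e = ev o (ep p) i -> False.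
  move=> iq eq; rewrite /ev; case: o => ee; move: eq; rewrite ee => /vars_sub/andP[h1 h2].
    by rewrite h2 in iq.
  by rewrite h1 in iq.
have neq q i : i \notin verts q -> ep q != i.
  by apply: contra => /eqP <-; exact: ep_verts.
have hd : ev s.1 (ep p) s.2 = ev s'.1 (ep p') s'.2.
  have := vv (ev s.1 (ep p) s.2); rewrite /= !in_cons eqxx /= => /esym/orP[/eqP//|h].
  by case: (dis p' _ s.2 s.1 _ h erefl); rewrite ss'.
have [oo ee] : s.1 = s'.1 /\ ep p = ep p'.
  by move: hd; rewrite ss'; apply: ev_inj; apply: neq; rewrite -?ss'// ss'.
have -> : s = s' by rewrite (surjective_pairing s) (surjective_pairing s') oo ss'.
congr (_ :: _); apply: IH => // e.
have := vv e; rewrite /= !in_cons hd.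
case: eqP => [->|//] _.
rewrite -{1}hd (negbTE (head_var_notin sp)).
by rewrite (negbTE (head_var_notin sp')).
Qed.

Fixpoint paths k : seq (seq pstep) :=
  if k is k'.+1 then
    [seq s :: p | p <- paths k', s <- [seq s <- enum {: pstep} | s.2 \notin verts p]]
  else [:: [::]].

Lemma pathsP k p : p \in paths k -> valid p && (size p == k).
Proof.
elim: k p => [|k IH] p /=; first by rewrite mem_seq1 => /eqP ->.
move=> /allpairsPdep[q [s [/IH/andP[vq /eqP sq]]]].
by rewrite mem_filter => /andP[sv _] -> /=; rewrite sv vq sq eqxx.
Qed.

Lemma paths_uniq k : uniq (paths k).
Proof.
elim: k => [//|k IH] /=; apply: allpairs_uniq_dep => //.
- by move=> p _; rewrite filter_uniq// enum_uniq.
- by move=> [p s] [p' s'] _ _ /= [-> ->].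
Qed.

Lemma card_notin (p : seq pstep) (o : bool) : valid p ->
  \sum_(s <- [seq s <- enum {: pstep} | s.2 \notin verts p] | s.1 == o) 1 = (N - (size p).+1)%N.
Proof.
move=> vp; rewrite big_filter_cond big_enum_cond/=.
rewrite (reindex_onto (fun i : 'I_N => (o, i)) snd)/=; last first.
  by move=> [b i] /= /andP[_ /eqP ->].
under eq_bigl do rewrite !eqxx !andbT.
rewrite sum1_card.
have := cardC (mem (verts p)); rewrite card_ord.
rewrite (card_uniqP _); last by rewrite -valid_uniq.
rewrite size_rcons size_map => h; rewrite -[X in (X - _)%N]h addKn.
by apply: eq_card => x; rewrite !inE.
Qed.

Lemma big_paths (V : nmodType) k (F : seq pstep -> V) :
  \sum_(p <- paths k.+1) F p =
  \sum_(p <- paths k) \sum_(s <- [seq s <- enum {: pstep} | s.2 \notin verts p]) F (s :: p).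
Proof. by rewrite big_allpairs_dep. Qed.

Lemma big_paths_rec k :
  (\sum_(p <- paths k) \sum_(s <- [seq s <- enum {: pstep} | s.2 \notin verts p]) 1 =
  size (paths k) * (2 * (N - k.+1)))%N.
Proof.
rewrite -sum1_size big_distrl/= big_seq_cond [RHS]big_seq_cond.
apply: eq_bigr => p /andP[/pathsP/andP[vp /eqP sp] _].
rewrite mul1n (bigID (fun s : pstep => s.1 == true))/= (card_notin _ vp).
under eq_bigl do rewrite -[~~ _]/(~~ (_ == true)) eqb_id -eqbF_neg.
by rewrite (card_notin _ vp) sp mul2n addnn.
Qed.

(** A path of k steps occupies k + 1 vertices, the root included, and each new step chooses one of
    two orientations. *)
Lemma size_pathsS k : size (paths k.+1) = (size (paths k) * (2 * (N - k.+1)))%N.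
Proof.
by rewrite -big_paths_rec// -sum1_size /= big_allpairs_dep.
Qed.

End self_avoiding_paths.

Section path_polynomials.
Variable R : realType.
Local Notation gT := (@gaussT R).
Variables (N : nat) (r : 'I_N).
Implicit Types (p q : seq (pstep N)) (J : (N * N).-tuple R).

Definition allpaths K := \big[cat/[::]]_(k < K.+1) paths r k.

Lemma big_allpaths (V : nmodType) K (F : seq (pstep N) -> V) :
  \sum_(p <- allpaths K) F p = \sum_(k < K.+1) \sum_(p <- paths r k) F p.
Proof.
rewrite /allpaths; elim: K.+1 => [|k IH]; first by rewrite !big_ord0 big_nil.
by rewrite !big_ord_recr/= big_cat/= IH.
Qed.

Lemma allpathsP K p : p \in allpaths K -> valid r p && (size p <= K)%N.
Proof.
rewrite /allpaths; elim/big_ind: _ => // [a b ha hb|k _ /pathsP/andP[-> /eqP ->]].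
  by rewrite mem_cat => /orP[/ha|/hb].
by rewrite /= -ltnS.
Qed.

Lemma allpaths_uniq K : uniq (allpaths K).
Proof.
elim: K => [|K IH]; first by rewrite /allpaths big_ord_recr/= big_ord0.
rewrite /allpaths big_ord_recr/= cat_uniq -/(allpaths K) IH (paths_uniq r K.+1) andbT.
apply/hasPn => p /(@pathsP _ r K.+1)/andP[_ /eqP sp]; apply/negP => /allpathsP/andP[_].
by rewrite sp ltnn.
Qed.

Lemma monom_cat n (l l' : seq 'I_n) (J : n.-tuple R) : monom (l ++ l') J = monom l J * monom l' J.
Proof. exact: big_cat. Qed.

Lemma monom_cons n k (l : seq 'I_n) (J : n.-tuple R) : monom (k :: l) J = tnth J k * monom l J.
Proof. exact: big_cons. Qed.

Variables (K : nat) (c : R).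
Hypothesis c_ge0 : 0 <= c.

(** The weight c will be 1 / sqrt(2 N). There are about (2 N)^k paths of length k, so each length
    contributes about 1 to the expected squared norm of the vector. *)
Definition saw (i : 'I_N) J : R :=
  \sum_(p <- allpaths K | ep r p == i) c ^+ size p * monom (vars r p) J.

Lemma mlin_saw i : mlin K (saw i).
Proof.
rewrite /saw.
under eq_fun => J do rewrite big_seq_cond.
apply: mlin_sum => p /andP[/allpathsP/andP[vp sp] _].
by apply: mlinZ; apply: mlin_monom; [exact: vars_uniq|rewrite size_vars].
Qed.

(* For distinct paths with the same end point some edge variable occurs exactly once. *)
Lemma E_vars_orthogonal p p' : valid r p -> valid r p' -> ep r p = ep r p' -> p != p' ->
  \int[gT (N * N)]_J monom (vars r p ++ vars r p') J = 0.
Proof.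
move=> vp vp' epp' pp'.
have : ~~ [forall k, (k \in vars r p) == (k \in vars r p')].
  apply/negP => /forallP h; case/eqP: pp'; apply: (@vars_inj _ r) => // k.
  exact/eqP/h.
rewrite negb_forall => /existsP[k hk]; apply: (@E_monom_eq0 _ _ _ k).
rewrite count_cat !count_uniq_mem ?vars_uniq//.
by case: (k \in vars r p) hk; case: (k \in vars r p').
Qed.

Lemma E_vars_sqr p : valid r p -> \int[gT (N * N)]_J monom (vars r p ++ vars r p) J = 1.
Proof. by move=> vp; exact: (@E_monom_dbl R _ _ _ (vars_uniq vp) (perm_refl _)). Qed.

Lemma E_saw2 i : \int[gT (N * N)]_J (saw i J ^+ 2) =
  \sum_(p <- allpaths K | ep r p == i) (c ^+ 2) ^+ size p.
Proof.
transitivity (\int[gT (N * N)]_J (\sum_(p <- allpaths K | ep r p == i)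
   \sum_(p' <- allpaths K | ep r p' == i)
   (c ^+ size p * c ^+ size p') * monom (vars r p ++ vars r p') J)).
  apply: eq_Rintegral => J _; rewrite expr2 /saw big_distrl/=.
  apply: eq_bigr => p _; rewrite big_distrr/=; apply: eq_bigr => p' _.
  by rewrite monom_cat; ring.
rewrite E_sum; last by move=> p; apply: tame_sum => p'; apply: tameZ; exact: tame_monom.
rewrite big_seq_cond [RHS]big_seq_cond; apply: eq_bigr => p /andP[pK /eqP epi].
have /andP[vp _] := allpathsP pK.
rewrite E_sum; last by move=> p'; apply: tameZ; exact: tame_monom.
rewrite big_mkcond (bigD1_seq p) ?allpaths_uniq//= epi eqxx EZ ?E_vars_sqr//; last exact: tame_monom.
rewrite mulr1 -exprD addnn -mul2n exprM big_seq_cond big1 ?addr0// => p' /andP[p'K p'p].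
case: ifP => // /eqP ep'i; have /andP[vp' _] := allpathsP p'K.
rewrite EZ ?E_vars_orthogonal ?mulr0//; first by rewrite epi ep'i.
- by rewrite eq_sym.
- exact: tame_monom.
Qed.

Lemma E_saw2_sum : \sum_i \int[gT (N * N)]_J (saw i J ^+ 2) =
  \sum_(k < K.+1) (size (paths r k))%:R * (c ^+ 2) ^+ k.
Proof.
under eq_bigr do rewrite E_saw2.
transitivity (\sum_(p <- allpaths K) (c ^+ 2) ^+ size p).
  rewrite (exchange_big_dep xpredT)//=; apply: eq_bigr => p _.
  by under eq_bigl do rewrite eq_sym; rewrite big_pred1_eq.
rewrite big_allpaths; apply: eq_bigr => k _.
rewrite big_seq_cond (eq_bigr (fun=> (c ^+ 2) ^+ k)); last first.
  by move=> p /andP[/pathsP/andP[_ /eqP ->]].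
by rewrite -big_seq_cond big_const_seq count_predT iter_addr_0 mulr_natl.
Qed.

Definition saw_corr p p' : R := (c ^+ size p * c ^+ size p') *
  \int[gT (N * N)]_J monom (pr (ep r p) (ep r p') :: vars r p ++ vars r p') J.

Lemma saw_corr_ge0 p p' : 0 <= saw_corr p p'.
Proof. by rewrite /saw_corr !mulr_ge0 ?exprn_ge0// E_monom_ge0. Qed.

(** If one path extends the other by one step, the entry joining their end points is the added edge,
    so every variable occurs exactly twice and the expectation is 1. The orientation of the step
    decides which order of the pair has this property, as J_ij and J_ji are independent. *)
Lemma saw_corr_cons p (s : pstep N) : valid r (s :: p) ->
  (if s.1 then saw_corr p (s :: p) else saw_corr (s :: p) p) = c ^+ (size p).*2.+1.
Proof.
move=> vsp; have h l := @E_monom_dbl R _ _ l (vars_uniq vsp).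
have -> : c ^+ (size p).*2.+1 = c ^+ size p * c ^+ (size p).+1.
  by rewrite -exprD addnS addnn.
have [s1|s1] := boolP s.1; rewrite /saw_corr [size (s :: p)]/= [ep r (s :: p)]/=.
  rewrite (h (pr (ep r p) s.2 :: vars r p ++ vars r (s :: p))) ?mulr1//.
  by rewrite /= /ev s1 perm_refl.
rewrite (h (pr s.2 (ep r p) :: vars r (s :: p) ++ vars r p)) ?mulr1 1?mulrC//.
by rewrite /= /ev (negbTE s1) perm_cons -[X in perm_eq X]cat_cons perm_catC.
Qed.

Lemma saw_form_corr : \int[gT (N * N)]_J (\sum_i \sum_j tnth J (pr i j) * saw i J * saw j J) =
  \sum_(p <- allpaths K) \sum_(p' <- allpaths K) saw_corr p p'.
Proof.
have tm2 (k : 'I_(N * N)) l : tame (@monom R _ (k :: l)) by exact: tame_monom.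
transitivity (\int[gT (N * N)]_J (\sum_(p <- allpaths K) \sum_(p' <- allpaths K)
   (c ^+ size p * c ^+ size p') * monom (pr (ep r p) (ep r p') :: vars r p ++ vars r p') J)).
  apply: eq_Rintegral => J _.
  transitivity (\sum_i \sum_j \sum_(p <- allpaths K | ep r p == i) \sum_(p' <- allpaths K | ep r p' == j)
    (c ^+ size p * c ^+ size p') * monom (pr (ep r p) (ep r p') :: vars r p ++ vars r p') J).
    apply: eq_bigr => i _; apply: eq_bigr => j _.
    rewrite /saw -mulrA big_distrl/= big_distrr/=; apply: eq_bigr => p /eqP pi.
    rewrite !big_distrr/=; apply: eq_bigr => p' /eqP pj.
    by rewrite monom_cons monom_cat pi pj; ring.
  transitivity (\sum_i \sum_(p <- allpaths K | ep r p == i) \sum_(p' <- allpaths K)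
    (c ^+ size p * c ^+ size p') * monom (pr (ep r p) (ep r p') :: vars r p ++ vars r p') J).
    apply: eq_bigr => i _; rewrite exchange_big/=; apply: eq_bigr => p _.
    rewrite (exchange_big_dep xpredT)//=; apply: eq_bigr => p' _.
    by under eq_bigl do rewrite eq_sym; rewrite big_pred1_eq.
  rewrite (exchange_big_dep xpredT)//=; apply: eq_bigr => p _.
  by under eq_bigl do rewrite eq_sym; rewrite big_pred1_eq.
rewrite E_sum; last by move=> p; apply: tame_sum => p'; exact: tameZ.
apply: eq_bigr => p _; rewrite E_sum; last by move=> p'; exact: tameZ.
by apply: eq_bigr => p' _; rewrite EZ.
Qed.

(** Every path of length k + 1 forms one contributing pair with the path it extends, in the order
    given by its orientation. All other pairs are nonnegative and are dropped. *)
Lemma saw_corr_adjacent k :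
  (size (paths r k.+1))%:R * c ^+ k.*2.+1 <=
  \sum_(p <- paths r k) \sum_(p' <- paths r k.+1) saw_corr p p' +
  \sum_(p <- paths r k.+1) \sum_(p' <- paths r k) saw_corr p p'.
Proof.
rewrite [X in _ + X]exchange_big/= -big_split/=.
set st := fun p => [seq s <- enum {: pstep N} | s.2 \notin verts r p].
have -> : (size (paths r k.+1))%:R * c ^+ k.*2.+1 = \sum_(p <- paths r k) \sum_(s <- st p) c ^+ k.*2.+1.
  rewrite -(big_paths r k (fun=> c ^+ k.*2.+1)).
  by rewrite big_const_seq count_predT iter_addr_0 mulr_natl.
rewrite big_seq_cond [leRHS]big_seq_cond; apply: ler_sum => p /andP[pk _].
rewrite !big_paths -big_split/= (bigD1_seq p) ?paths_uniq//=.
rewrite -[leLHS]addr0; apply: lerD; last first.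
  by apply: sumr_ge0 => q _; apply: addr_ge0; apply: sumr_ge0 => s _; exact: saw_corr_ge0.
rewrite -big_split/= big_seq_cond [leRHS]big_seq_cond; apply: ler_sum => s /andP[].
have /andP[vp /eqP sp] := pathsP pk.
rewrite mem_filter => /andP[sp' _] _.
have := @saw_corr_cons p s; rewrite /= sp' vp => /(_ erefl); rewrite sp => <-.
by case: ifP => _; rewrite ?lerDl ?lerDr saw_corr_ge0.
Qed.

End path_polynomials.

Section path_test_vector.
Variable R : realType.
Local Notation gT := (@gaussT R).

(** The scaled number is the product of the factors 1 - j / N for j = 1, ..., k, each at least 1 - K
    / N. *)
Lemma size_paths_scaled N (r : 'I_N) (K k : nat) : (0 < N)%N -> (k <= K)%N ->
  (1 : R) - K%:R * k%:R / N%:R <= (size (paths r k))%:R * ((2 * N%:R)^-1) ^+ k <= (1 : R).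
Proof.
move=> N0; have N0' : 0 < N%:R :> R by rewrite ltr0n.
elim: k => [|k IH] kK; first by rewrite mulr0 mul0r subr0 expr0 mulr1/= lexx.
have /andP[h1 h2] := IH (ltnW kK).
set a := (size (paths r k))%:R * _ in h1 h2.
have a0 : 0 <= a by rewrite /a mulr_ge0// exprn_ge0// invr_ge0 mulr_ge0.
have -> : (size (paths r k.+1))%:R * ((2 * N%:R)^-1) ^+ k.+1 = a * ((N - k.+1)%:R / N%:R) :> R.
  by rewrite size_pathsS !natrM exprS /a; field; rewrite gt_eqF.
(* When k + 1 exceeds N the truncated subtraction makes the count 0, but then K (k + 1) is at least
   N and the claimed lower bound is not positive. *)
have [kN|kN] := leqP k.+1 N; last first.
  have /eqP -> : (N - k.+1)%N == 0%N by rewrite subn_eq0 ltnW.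
  rewrite mul0r mulr0 ler01 andbT subr_le0 ler_pdivlMr// mul1r.
  rewrite -natrM ler_nat (leq_trans (ltnW kN))// leq_pmull//.
  by rewrite (leq_ltn_trans _ kK).
have tt : ((0 : R) <= (N - k.+1)%:R / N%:R) && ((N - k.+1)%:R / N%:R <= (1 : R)).
  by rewrite divr_ge0//= ler_pdivrMr// mul1r ler_nat leq_subr.
have te : 1 - (N - k.+1)%:R / N%:R <= K%:R / N%:R :> R.
  rewrite natrB// mulrBl divff ?gt_eqF// opprB addrCA subrr addr0.
  by rewrite ler_pM2r ?invr_gt0// ler_nat.
have -> : K%:R * k.+1%:R / N%:R = K%:R * k%:R / N%:R + K%:R / N%:R :> R.
  by rewrite -natr1; ring.
move: h1 h2 tt te; set t := _ / N%:R; set u := _ / N%:R; set v := _ / N%:R.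
clear -a0; clearbody a t u v; move=> h1 h2 /andP[t0 t1] te.
apply/andP; split; last by nra.
have : a * (1 - u) <= 1 - u by rewrite ler_piMl// subr_ge0.
lra.
Qed.

(** The expected squared norm is at most K + 1 and the expected form about K sqrt(2 N), one term for
    each pair of consecutive lengths. The quotient approaches sqrt(2 N) when N grows first and K
    afterwards. *)
Lemma path_test_vector N (r : 'I_N) K : (0 < N)%N ->
  exists w : 'I_N -> (N * N).-tuple R -> R,
  [/\ forall i, mlin K (w i),
      \sum_i \int[gT (N * N)]_J (w i J ^+ 2) <= K.+1%:R &
      Num.sqrt (2 * N%:R) * (K%:R * (1 - K%:R ^+ 2 / N%:R)) <=
      \int[gT (N * N)]_J (\sum_i \sum_j tnth J (pr i j) * w i J * w j J)].
Proof.
move=> N0; have N0' : 0 < N%:R :> R by rewrite ltr0n.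
set S := Num.sqrt (2 * N%:R) : R.
have S2 : S ^+ 2 = 2 * N%:R by rewrite sqr_sqrtr// mulr_ge0.
have S0 : 0 < S by rewrite sqrtr_gt0 mulr_gt0.
pose c := S^-1.
have c0 : 0 <= c by rewrite invr_ge0 ltW.
have c2 : c ^+ 2 = (2 * N%:R)^-1 by rewrite /c exprVn S2.
exists (fun i => @saw R N r K c i); split=> [i||]; first exact: mlin_saw.
  rewrite E_saw2_sum// c2; apply: le_trans (_ : \sum_(k < K.+1) (1 : R) <= _).
    apply: ler_sum => k _; have kK : (k <= K)%N by rewrite -ltnS.
    by have /andP[_ ->] := size_paths_scaled r N0 kK.
  by rewrite sumr_const card_ord.
rewrite saw_form_corr//.
have grow k : (k <= K)%N -> (S * (1 - K%:R ^+ 2 / N%:R)) * k%:R <=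
    \sum_(p <- allpaths r k) \sum_(p' <- allpaths r k) saw_corr r c p p'.
  elim: k => [|k IH] kK.
    rewrite mulr0; apply: sumr_ge0 => p _; apply: sumr_ge0 => p' _; exact: saw_corr_ge0.
  have -> : allpaths r k.+1 = allpaths r k ++ paths r k.+1 by rewrite /allpaths big_ord_recr.
  have sp s s1 s2 : \sum_(p <- s) \sum_(p' <- s1 ++ s2) saw_corr r c p p' =
      \sum_(p <- s) \sum_(p' <- s1) saw_corr r c p p' + \sum_(p <- s) \sum_(p' <- s2) saw_corr r c p p'.
    by rewrite -big_split; apply: eq_bigr => p _; rewrite big_cat.
  rewrite big_cat !sp.
  have := IH (ltnW kK).
  have := @saw_corr_adjacent R N r c c0 k.
  have h (s s' : seq (seq (pstep N))) : 0 <= \sum_(p <- s) \sum_(p' <- s') saw_corr r c p p'.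
    apply: sumr_ge0 => p _; apply: sumr_ge0 => p' _; exact: saw_corr_ge0.
  have hp1 : \sum_(p <- paths r k) \sum_(p' <- paths r k.+1) saw_corr r c p p' <=
    \sum_(p <- allpaths r k) \sum_(p' <- paths r k.+1) saw_corr r c p p'.
    by rewrite /allpaths big_ord_recr [leRHS]big_cat lerDr; exact: h.
  have hp2 : \sum_(p <- paths r k.+1) \sum_(p' <- paths r k) saw_corr r c p p' <=
    \sum_(p <- paths r k.+1) \sum_(p' <- allpaths r k) saw_corr r c p p'.
    apply: ler_sum => p _; rewrite /allpaths big_ord_recr [leRHS]big_cat lerDr.
    by apply: sumr_ge0 => p' _; exact: saw_corr_ge0.
  (* An adjacent pair carries c^(2 k + 1), which is sqrt(2 N) times the normalization c^(2 (k + 1))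
     of the longer paths. *)
  have hk : S * (1 - K%:R ^+ 2 / N%:R) <= (size (paths r k.+1))%:R * c ^+ k.*2.+1.
    have -> : (size (paths r k.+1))%:R * c ^+ k.*2.+1 =
        S * ((size (paths r k.+1))%:R * ((2 * N%:R)^-1) ^+ k.+1).
      rewrite -c2 -exprM mul2n doubleS exprS [in RHS]exprS exprS [S * _]mulrCA [S * _]mulrA /c mulfV ?mul1r//.
      by rewrite gt_eqF.
    apply: ler_wpM2l; first exact: ltW.
    have /andP[+ _] := size_paths_scaled r N0 kK; apply: le_trans.
    rewrite lerD2l lerN2 ler_pM2r ?invr_gt0// expr2 ler_wpM2l//.
    by rewrite ler_nat.
  have := h (paths r k.+1) (paths r k.+1).
  move: hp1 hp2 hk; rewrite -natr1.
  move: (S * (1 - _)) (_ * c ^+ _) => A1 A2.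
  move: (\sum_(p <- allpaths r k) \sum_(p' <- allpaths r k) _) (\sum_(p <- allpaths r k) \sum_(p' <- paths r k.+1) _)
   (\sum_(p <- paths r k.+1) \sum_(p' <- allpaths r k) _) (\sum_(p <- paths r k) \sum_(p' <- paths r k.+1) _)
   (\sum_(p <- paths r k.+1) \sum_(p' <- paths r k) _) (\sum_(p <- paths r k.+1) \sum_(p' <- paths r k.+1) _)
   => B1 B2 B3 B4 B5 B6 h1 h2 h3 h4 h5 h6.
  by apply: (@le_trans _ _ ((B1 + B2) + (B3 + B6))) => //; lra.
have := grow K (leqnn K); apply: le_trans.
by apply: eq_lerR; ring.
Qed.

(** Needed to control the covariance of the random squared norm with the top eigenvalue: expand the
    square and combine Cauchy-Schwarz with the fourth-moment bound for each component. *)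
Lemma E_sqr_norm_mlin n d m (w : 'I_m -> n.-tuple R -> R) : (forall i, mlin d (w i)) ->
  \int[gT n]_J ((\sum_i w i J ^+ 2) ^+ 2) <= 9 ^+ d * (\sum_i \int[gT n]_J (w i J ^+ 2)) ^+ 2.
Proof.
move=> hw; have tw i : tame (w i) by exact: mlin_tame (hw i).
have tw2 i : tame (fun J => w i J ^+ 2) by exact: tameX.
set e := fun i => \int[gT n]_J (w i J ^+ 2).
have e0 i : 0 <= e i by apply: E_ge0 => J; exact: sqr_ge0.
have cs i j : \int[gT n]_J (w i J ^+ 2 * w j J ^+ 2) <= 9 ^+ d * (e i * e j).
  rewrite -(@ler_pXn2r _ 2)// ?nnegrE; last 2 first.
  - by apply: E_ge0 => J; rewrite mulr_ge0// sqr_ge0.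
  - by rewrite !mulr_ge0// exprn_ge0.
  apply: (le_trans (E_CS (tw2 i) (tw2 j))).
  have -> : (9 ^+ d * (e i * e j)) ^+ 2 = (9 ^+ d * e i ^+ 2) * (9 ^+ d * e j ^+ 2) by ring.
  have h k : \int[gT n]_J ((w k J ^+ 2) ^+ 2) <= 9 ^+ d * e k ^+ 2.
    under eq_Rintegral do rewrite -exprM.
    exact: mlin_hypercontractive.
  by apply: ler_pM => //; apply: E_ge0 => J; exact: sqr_ge0.
rewrite (_ : \int[gT n]_J _ = \sum_i \sum_j \int[gT n]_J (w i J ^+ 2 * w j J ^+ 2)).
  rewrite expr2 big_distrl/= big_distrr/=; apply: ler_sum => i _.
  by rewrite !big_distrr/=; apply: ler_sum => j _; exact: cs.
transitivity (\int[gT n]_J (\sum_i \sum_j (w i J ^+ 2 * w j J ^+ 2))).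
  apply: eq_Rintegral => J _; rewrite expr2 big_distrl/=; apply: eq_bigr => i _.
  by rewrite big_distrr.
rewrite E_sum; last by move=> i; apply: tame_sum => j; exact: tameM.
by apply: eq_bigr => i _; rewrite E_sum// => j; exact: tameM.
Qed.
End path_test_vector.

(** * Efron-Stein inequality and fluctuations of the top eigenvalue *)

Section efron_stein.
Variable R : realType.
Local Notation g1 := (@gauss1 R).
Local Notation gT := (@gaussT R).

(** The square of the positive part of a, written with the absolute value so that algebraic
    identities apply. One-sided differences suffice for the variance, and for a supremum only one
    side is easy to bound. *)
Definition psq (a : R) : R := (a + `|a|) ^+ 2 / 4.

Lemma psq_ge0 a : 0 <= psq a.
Proof. by rewrite /psq divr_ge0// sqr_ge0. Qed.

Lemma psq_le_sqr a : psq a <= a ^+ 2.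
Proof.
rewrite /psq; have [a0|a0] := ger0P a; first by apply: eq_lerR; field.
by rewrite subrr expr0n mul0r sqr_ge0.
Qed.

Lemma psqDN a : psq a + psq (- a) = a ^+ 2.
Proof.
rewrite /psq normrN; have := real_normK (num_real a); set b := `|a| => h.
have -> : (a + b) ^+ 2 / 4 + (- a + b) ^+ 2 / 4 = (a ^+ 2 + b ^+ 2) / 2 by field.
by rewrite h; field.
Qed.

Lemma psq_convex m y : psq m + (m + `|m|) * (y - m) <= psq y.
Proof.
rewrite /psq; have [m0|m0] := ger0P m; last first.
  by rewrite subrr expr0n !mul0r addr0 -/(psq y) psq_ge0.
have h := sqr_ge0 (y - m).
have [y0|y0] := ger0P y.
  by have -> : (y + y) ^+ 2 / 4 = (m + m) ^+ 2 / 4 + (m + m) * (y - m) + (y - m) ^+ 2; [field|rewrite lerDl].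
have -> : (m + m) ^+ 2 / 4 + (m + m) * (y - m) = m * (2 * y - m) by field.
by rewrite subrr expr0n mul0r mulr_ge0_le0//; lra.
Qed.

Lemma psq_le a b : a <= b -> psq a <= psq b.
Proof.
rewrite /psq => ab; have [a0|a0] := ger0P a; have [b0|b0] := ger0P b.
- by rewrite ler_pM2r ?invr_gt0// ler_sqr ?nnegrE ?addr_ge0// lerD.
- by move: ab; rewrite leNgt (lt_le_trans b0).
- by rewrite subrr expr0n mul0r divr_ge0// sqr_ge0.
- by rewrite !subrr.
Qed.

Lemma psq_le_abs a b : psq (a - b) <= (`|a| + `|b|) ^+ 2.
Proof.
apply: (le_trans (psq_le_sqr _)); rewrite -(real_normK (num_real (a - b))).
by rewrite ler_sqr ?nnegrE ?addr_ge0// ler_normB.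
Qed.

Lemma measurable_psq : measurable_fun setT psq.
Proof. by rewrite /psq; meas. Qed.

Lemma tame_psqB n (f g : n.-tuple R -> R) : tame f -> tame g -> tame (fun x => psq (f x - g x)).
Proof.
move=> tf tg; apply: (tame_le (g := fun x => (`|f x| + `|g x|) ^+ 2)).
- apply: (measurableT_comp measurable_psq); case: tf => mf _; case: tg => mg _.
  exact: measurable_funB.
- by apply: tameX; apply: tameD; exact: tame_norm.
- by move=> x; rewrite ger0_norm ?psq_ge0// ger0_norm ?sqr_ge0// psq_le_abs.
Qed.

Lemma tame2_psqB n (f g : n.-tuple R * R -> R) : tame2 f -> tame2 g -> tame2 (fun p => psq (f p - g p)).
Proof.
move=> [mf [C C0 fC]] [mg [D D0 gD]]; split.
  by apply: (measurableT_comp measurable_psq); exact: measurable_funB.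
exists ((C + D) ^+ 2 + 2 * (C + D)).
  by rewrite addr_ge0 ?sqr_ge0// mulr_ge0// addr_ge0.
move=> x t; rewrite ger0_norm ?psq_ge0//; set u := nrm1 x + `|t|.
have u0 : 0 <= u by rewrite addr_ge0// nrm1_ge0.
apply: (le_trans (psq_le_abs _ _)).
have h : `|f (x, t)| + `|g (x, t)| <= (C + D) * expR ((C + D) * u).
  rewrite [in leRHS]mulrDl; apply: lerD.
    apply: (le_trans (fC x t)); rewrite ler_wpM2l// ler_expR ler_wpM2r// lerDl//.
  by apply: (le_trans (gD x t)); rewrite ler_wpM2l// ler_expR ler_wpM2r// lerDr.
apply: (@le_trans _ _ (((C + D) * expR ((C + D) * u)) ^+ 2)).
  by rewrite ler_sqr ?nnegrE// ?addr_ge0// mulr_ge0 ?expR_ge0// addr_ge0.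
rewrite exprMn -expRM_natl.
apply: ler_pM; rewrite ?sqr_ge0 ?expR_ge0//.
  by rewrite lerDl mulr_ge0// addr_ge0.
rewrite ler_expR [leLHS](_ : _ = (2 * (C + D)) * u); last by rewrite mulrA.
by rewrite ler_wpM2r// lerDr sqr_ge0.
Qed.

Lemma tame2_cst1 n (f : n.-tuple R -> R) : tame f -> tame2 (fun p : n.-tuple R * R => f p.1).
Proof.
move=> [mf [C C0 fC]]; split; first by apply: measurableT_comp => //; exact: measurable_fst.
exists C => // x t; rewrite (le_trans (fC x))// ler_wpM2l// ler_expR ler_wpM2l//.
by rewrite lerDl.
Qed.

Lemma E_psq_jensen n (f : n.-tuple R -> R) : tame f -> tame (fun x => psq (f x)) ->
  psq (\int[gT n]_x f x) <= \int[gT n]_x psq (f x).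
Proof.
move=> tf tp; set m := \int[gT n]_x f x.
rewrite [leLHS](_ : _ = \int[gT n]_x ((psq m - (m + `|m|) * m) + (m + `|m|) * f x)).
  apply: E_le => //; first by apply: tameD; [exact: tame_cst|exact: tameZ].
  by move=> x; rewrite -addrA -[- (_ * m) + _]addrC -mulrBr psq_convex.
by rewrite ED ?EZ ?EC//; [rewrite -/m subrK|exact: tame_cst|exact: tameZ].
Qed.

Lemma tame11_int (f : R * R -> R) (C : R) : measurable_fun setT f -> 0 <= C ->
  (forall u t, `|f (u, t)| <= C * expR (C * (`|u| + `|t|))) ->
  (forall u, tame1 (fun t => f (u, t))) /\ tame1 (fun u => \int[g1]_t f (u, t)).
Proof.
move=> mf C0 fC.
have h (x : R) : tame1 (fun t => f (x, t)).
  apply: (@tame1_bnd _ _ (C * expR (C * `|x|)) C) => //.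
  - by apply: measurableT_comp => //; exact: measurable_pair1.
  - by rewrite mulr_ge0 ?expR_ge0.
  - by move=> t; rewrite (le_trans (fC x t))// mulrDr expRD mulrA.
split=> //.
apply: (@tame1_bnd _ _ (C * gauss1_mom C) C) => //.
- exact: measurable_Rint_param.
- by rewrite mulr_ge0// gauss1_mom_ge0.
move=> x; apply: (le_trans (le_normr_Rintegral _ _)) => //.
  exact: tame1_integrable (h x).
rewrite mulrAC /gauss1_mom -RintegralZl//; last exact: integrable_expR_norm.
apply: le_Rintegral => //.
- exact: integrable_norm (tame1_integrable (h x)).
- have := integrableZl (R:=R) measurableT (C * expR (C * `|x|)) (integrable_expR_norm C0).
  by [].
- by move=> t _; rewrite (le_trans (fC x t))// mulrDr expRD mulrA.
Qed.

Lemma tame11_swap (f : R * R -> R) (C : R) : measurable_fun setT f -> 0 <= C ->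
  (forall u t, `|f (u, t)| <= C * expR (C * (`|u| + `|t|))) ->
  \int[g1]_u \int[g1]_t f (u, t) = \int[g1]_t \int[g1]_u f (u, t).
Proof.
move=> mf C0 fC.
have [h1 h2] := @tame11_int f C mf C0 fC.
have [h3 _] : (forall u, tame1 (fun t => f (t, u))) /\ tame1 (fun u => \int[g1]_t f (t, u)).
  apply: (@tame11_int (fun p => f (p.2, p.1)) C) => //; last by move=> u t; rewrite (le_trans (fC t u))// addrC.
  by apply: measurableT_comp => //; apply/measurable_fun_pairP; split; [exact: measurable_snd|exact: measurable_fst].
have [_ h4] : (forall u, tame1 (fun t => `|f (u, t)|)) /\ tame1 (fun u => \int[g1]_t `|f (u, t)|).
  apply: (@tame11_int (fun p => `|f p|) C) => //; last by move=> u t; rewrite normr_id.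
  by meas.
apply: RFubini => //.
- by move=> x; exact: tame1_integrable.
- by move=> x; exact: tame1_integrable.
- exact: tame1_integrable.
Qed.

Lemma tame11_psqB (h : R -> R) : tame1 h ->
  exists2 C : R, 0 <= C & forall u t, `|psq (h u - h t)| <= C * expR (C * (`|u| + `|t|)).
Proof.
move=> [mh [C C0 hC]]; exists ((2 * C) ^+ 2 + 2 * C).
  by rewrite addr_ge0 ?sqr_ge0// mulr_ge0.
move=> u t; rewrite ger0_norm ?psq_ge0//; apply: (le_trans (psq_le_abs _ _)).
apply: (@le_trans _ _ ((2 * C * expR (C * (`|u| + `|t|))) ^+ 2)).
  rewrite ler_sqr ?nnegrE ?addr_ge0 ?mulr_ge0 ?expR_ge0//.
  rewrite -mulrA mulr2n mulrDl mul1r; apply: lerD.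
    by apply: (le_trans (hC _)); rewrite ler_wpM2l// ler_expR ler_wpM2l// lerDl.
  by apply: (le_trans (hC _)); rewrite ler_wpM2l// ler_expR ler_wpM2l// lerDr.
rewrite exprMn -expRM_natl; apply: ler_pM; rewrite ?sqr_ge0 ?expR_ge0//.
  by rewrite lerDl mulr_ge0.
by rewrite ler_expR mulrA ler_wpM2r ?addr_ge0// lerDr sqr_ge0.
Qed.

Lemma tame1_psqB (h : R -> R) : tame1 h ->
  (forall u, tame1 (fun t => psq (h u - h t))) /\ tame1 (fun u => \int[g1]_t psq (h u - h t)).
Proof.
move=> th; have [C C0 hC] := tame11_psqB th; have [mh _] := th.
apply: (@tame11_int (fun p => psq (h p.1 - h p.2)) C) => //.
apply: (measurableT_comp measurable_psq); apply: measurable_funB.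
  by apply: measurableT_comp => //; exact: measurable_fst.
by apply: measurableT_comp => //; exact: measurable_snd.
Qed.

(** Half the mean square of h(u) - h(t) for independent u and t is the variance; by symmetry the
    positive and the negative part contribute equally, so the positive part alone gives the whole
    variance. *)
Lemma gauss1_var (h : R -> R) : tame1 h ->
  \int[g1]_u (h u ^+ 2) - (\int[g1]_u h u) ^+ 2 = \int[g1]_u \int[g1]_t psq (h u - h t).
Proof.
move=> th; have [C C0 hC] := tame11_psqB th; have [mh _] := th.
have [h1 h2] := tame1_psqB th.
have mf : measurable_fun setT (fun p : R * R => psq (h p.1 - h p.2)).
  apply: (measurableT_comp measurable_psq); apply: measurable_funB.
    by apply: measurableT_comp => //; exact: measurable_fst.
  by apply: measurableT_comp => //; exact: measurable_snd.
have th2 : tame1 (fun u => h u ^+ 2) by exact: tame1X.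
have i1 := tame1_integrable th; have i2 := tame1_integrable th2.
set m := \int[g1]_u h u; set q := \int[g1]_u (h u ^+ 2); set S := \int[g1]_u \int[g1]_t _.
have [h3 h4] : (forall u, tame1 (fun t => psq (h t - h u))) /\ tame1 (fun u => \int[g1]_t psq (h t - h u)).
  apply: (@tame11_int (fun p => psq (h p.2 - h p.1)) C) => //.
    apply: (measurableT_comp measurable_psq); apply: measurable_funB.
      by apply: measurableT_comp => //; exact: measurable_snd.
    by apply: measurableT_comp => //; exact: measurable_fst.
  by move=> u t /=; rewrite (le_trans (hC t u))// [`|t| + _]addrC.
suff : S + S = 2 * q - 2 * m ^+ 2 by move: S (m ^+ 2) q => x y z; clear; lra.
have sw : S = \int[g1]_t \int[g1]_u psq (h u - h t).
  exact: (@tame11_swap (fun p => psq (h p.1 - h p.2)) C).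
clear hC mf C0 C.
rewrite {2}sw {sw} /S -RintegralD//; [|exact: tame1_integrable..].
transitivity (\int[g1]_u (h u ^+ 2 + (q - 2 * m * h u))); last first.
  rewrite RintegralD//; last first.
    apply: tame1_integrable; apply: tame1D; first exact: tame1_cst.
    by under eq_fun do rewrite -mulNr; apply: tame1M => //; exact: tame1_cst.
  rewrite RintegralB//; [|exact: (tame1_integrable (tame1_cst q))|
     by apply: (@tame1_integrable _ (fun u => 2 * m * h u)); apply: tame1M => //; exact: tame1_cst].
  by rewrite E1C RintegralZl// -/q -/m; ring.
apply: eq_Rintegral => u _; rewrite -RintegralD//; [|exact: tame1_integrable..].
transitivity (\int[g1]_t (h u ^+ 2 + (h t ^+ 2 - 2 * h u * h t))).
  by apply: eq_Rintegral => t _; rewrite -[X in psq X + _]opprB addrC psqDN; ring.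
have i3 : tame1 (fun t => 2 * h u * h t) by apply: tame1M => //; exact: tame1_cst.
rewrite RintegralD//; [|exact: (tame1_integrable (tame1_cst _))|]; last first.
  apply: tame1_integrable; apply: tame1D => //.
  by under eq_fun do rewrite -mulNr; apply: tame1M => //; exact: tame1_cst.
rewrite E1C RintegralB//; last exact: tame1_integrable.
by rewrite RintegralZl// -/q -/m; ring.
Qed.

Lemma tame1_sum (I : Type) (r : seq I) (P : pred I) (F : I -> R -> R) :
  (forall i, tame1 (F i)) -> tame1 (fun x => \sum_(i <- r | P i) F i x).
Proof.
move=> tF; elim: r => [|i r IH].
  by under eq_fun do rewrite big_nil; exact: tame1_cst.
under eq_fun do rewrite big_cons.
by case: (P i) => //; exact: tame1D.
Qed.

Lemma E1_sum (I : Type) (r : seq I) (P : pred I) (F : I -> R -> R) :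
  (forall i, tame1 (F i)) ->
  \int[g1]_x (\sum_(i <- r | P i) F i x) = \sum_(i <- r | P i) \int[g1]_x F i x.
Proof.
move=> tF; elim: r => [|i r IH].
  by under eq_Rintegral do rewrite big_nil; rewrite big_nil E1C.
under eq_Rintegral do rewrite big_cons.
rewrite big_cons; case: (P i) => //; rewrite RintegralD ?IH//; apply: tame1_integrable => //.
exact: tame1_sum.
Qed.

(** Condition on the first coordinate. The mean of the conditional variance is handled by induction;
    the variance of the conditional mean is a one-dimensional variance, and convexity of [psq] moves
    the remaining average outside. *)
Lemma efron_stein n (f : n.-tuple R -> R) : tame f ->
  \int[gT n]_x (f x ^+ 2) - (\int[gT n]_x f x) ^+ 2 <=
  \sum_(k < n) \int[gT n]_x \int[g1]_t psq (f x - f (upd x k t)).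
Proof.
have tG m (g : m.-tuple R -> R) k : tame g -> tame (fun x => \int[g1]_t psq (g x - g (upd x k t))).
  move=> tg; apply: (@tame2_int_r _ _ (fun p => psq (g p.1 - g (upd p.1 k p.2)))).
  by apply: (@tame2_psqB _ (fun p => g p.1)); [exact: tame2_cst1|exact: tame_upd].
elim: n f => [|n IH] f tf.
  rewrite big_ord0; have -> : f = fun _ => f [tuple] by apply/funext => x; rewrite tuple0.
  by rewrite !EC subrr.
have tf2 : tame (fun x => f x ^+ 2) by exact: tameX.
have tu u : tame (fun s : n.-tuple R => f [tuple of u :: s]).
  exact: (@tame2_l _ _ _ u (tame_cons tf)).
set h := fun u => \int[gT n]_s f [tuple of u :: s].
have th : tame1 h by exact: (tame2_int_l (tame_cons tf)).
have th2 : tame1 (fun u => h u ^+ 2) by exact: tame1X.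
set G := fun k x => \int[g1]_t psq (f x - f (upd x k t)).
have tGk k : tame (G k) by exact: tG.
have tg1 k : tame1 (fun u => \int[gT n]_s G k [tuple of u :: s]).
  exact: (tame2_int_l (tame_cons (tGk k))).
rewrite big_ord_recl (ES (tGk ord0)).
under eq_bigr do rewrite (ES (tGk _)).
rewrite (ES tf2) (ES tf) -/h.
rewrite -E1_sum; [|by move=> i; exact: tg1].
have step1 : \int[g1]_t \int[gT n]_s (f [tuple of t :: s] ^+ 2) <=
   \int[g1]_t (h t ^+ 2 + \sum_(i < n) \int[gT n]_s G (lift ord0 i) [tuple of t :: s]).
  apply: le_Rintegral => //.
  - exact: tame1_integrable (tame2_int_l (tame_cons tf2)).
  - apply: tame1_integrable; apply: tame1D => //; apply: tame1_sum => i; exact: tg1.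
  move=> u _; have := IH _ (tu u); rewrite lerBlDl => /le_trans; apply.
  rewrite lerD2l; apply: ler_sum => i _; apply: eq_lerR.
  by apply: eq_Rintegral => s _; apply: eq_Rintegral => t _; rewrite upd_consS.
have step2 : \int[g1]_u (h u ^+ 2) - (\int[g1]_u h u) ^+ 2 <=
    \int[g1]_u \int[gT n]_s G ord0 [tuple of u :: s].
  rewrite gauss1_var//; apply: le_Rintegral => //.
  - by apply: tame1_integrable; case: (tame1_psqB th).
  - exact: tame1_integrable.
  move=> u _.
  have t2 : tame2 (fun p : n.-tuple R * R => psq (f [tuple of u :: p.1] - f [tuple of p.2 :: p.1])).
    by apply: (@tame2_psqB _ (fun p => f [tuple of u :: p.1])); [exact: (tame2_cst1 (tu u))|exact: tame_cons].
  apply: (@le_trans _ _ (\int[g1]_t \int[gT n]_s psq (f [tuple of u :: s] - f [tuple of t :: s]))).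
    apply: le_Rintegral => //.
    - by apply: tame1_integrable; case: (tame1_psqB th).
    - exact: tame1_integrable (tame2_int_l t2).
    move=> t _; rewrite -EB//; apply: E_psq_jensen; first exact: tameB.
    exact: tame_psqB.
  rewrite -(tame2_swap t2); apply: eq_lerR; apply: eq_Rintegral => s _.
  by apply: eq_Rintegral => t _; rewrite upd_cons0.
move: step1; rewrite RintegralD//; [|exact: tame1_integrable|by apply: tame1_integrable; apply: tame1_sum => i; exact: tg1].
by move: step2; move: (\int[_]_t _) (\int[_]_t _) (\int[_]_x _) => A B C; lra.
Qed.

End efron_stein.

Section rows_and_columns.
Variable N : nat.

Lemma ord_sqr_gt0 (k : 'I_(N * N)) : (0 < N)%N.
Proof. by case: N k => [[]|//]. Qed.

Lemma rw_subproof (k : 'I_(N * N)) : (k %/ N < N)%N.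
Proof. by rewrite ltn_divLR ?ltn_ord// (ord_sqr_gt0 k). Qed.
Lemma cl_subproof (k : 'I_(N * N)) : (k %% N < N)%N.
Proof. by rewrite ltn_mod (ord_sqr_gt0 k). Qed.

Definition rw (k : 'I_(N * N)) : 'I_N := Ordinal (rw_subproof k).
Definition cl (k : 'I_(N * N)) : 'I_N := Ordinal (cl_subproof k).

Lemma rw_pr i j : rw (pr i j) = i.
Proof.
apply: val_inj => /=; have N0 : (0 < N)%N by rewrite (leq_ltn_trans _ (ltn_ord i)).
by rewrite divnMDl// divn_small// addn0.
Qed.

Lemma cl_pr i j : cl (pr i j) = j.
Proof. by apply: val_inj => /=; rewrite modnMDl modn_small. Qed.

End rows_and_columns.

Section top_eigenvalue.
Variable R : realType.
Local Notation g1 := (@gauss1 R).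
Local Notation gT := (@gaussT R).
Variable N : nat.
Implicit Types (J : (N * N).-tuple R) (v : 'I_N -> R).

Definition qform J v := \sum_k tnth J k * (v (rw k) * v (cl k)).
Definition sqn v := \sum_i v i ^+ 2.

Lemma qformE J v : qform J v = \sum_i \sum_j tnth J (pr i j) * v i * v j.
Proof.
rewrite /qform sum_pr; apply: eq_bigr => i _; apply: eq_bigr => j _.
by rewrite rw_pr cl_pr mulrA.
Qed.

Lemma sqn_ge0 v : 0 <= sqn v.
Proof. by apply: sumr_ge0 => i _; exact: sqr_ge0. Qed.

Lemma sqr_le_sqn v i : v i ^+ 2 <= sqn v.
Proof. by rewrite /sqn (bigD1 i)//= lerDl sumr_ge0// => j _; exact: sqr_ge0. Qed.

Lemma mul_le_sqn v i j : `|v i * v j| <= sqn v.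
Proof.
have hi := sqr_le_sqn v i; have hj := sqr_le_sqn v j.
rewrite normrM -(real_normK (num_real (v i))) in hi *.
rewrite -(real_normK (num_real (v j))) in hj.
move: hi hj (normr_ge0 (v i)) (normr_ge0 (v j)) (sqr_ge0 (`|v i| - `|v j|)).
move: (`|v i|) (`|v j|) (sqn v) => a b s; nra.
Qed.

Lemma qform_bound J v : `|qform J v| <= nrm1 J * sqn v.
Proof.
rewrite /qform (le_trans (ler_norm_sum _ _ _))// /nrm1 mulr_suml.
by apply: ler_sum => k _; rewrite normrM ler_wpM2l// mul_le_sqn.
Qed.

(** Division by zero gives 0, so the null vector has quotient 0. *)
Definition rayleigh J v := qform J v / sqn v.

Lemma rayleigh_bound J v : `|rayleigh J v| <= nrm1 J.
Proof.
rewrite /rayleigh normrM normfV (ger0_norm (sqn_ge0 v)).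
have [->|v0] := eqVneq (sqn v) 0; first by rewrite invr0 mulr0 nrm1_ge0.
have s0 : 0 < sqn v by rewrite lt0r v0 sqn_ge0.
by rewrite ler_pdivrMr// qform_bound.
Qed.

(* An enumeration of the integer vectors; the supremum below is thus countable,
   hence measurable. *)
Definition intvec (k : nat) : 'I_N -> R :=
  if unpickle k is Some a then fun i => ((a : {ffun 'I_N -> int}) i)%:~R else fun _ => 0.

(** The null vector is among the integer vectors, so this is the larger of 0 and the top eigenvalue
    of the symmetric part of J. *)
Definition Lam J := sups (fun k => rayleigh J (intvec k)) 0.

Lemma rayleigh_has_ubound J : has_ubound (range (fun k => rayleigh J (intvec k))).
Proof.
exists (nrm1 J) => _ [k _ <-]; exact: le_trans (ler_norm _) (rayleigh_bound _ _).
Qed.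

Lemma LamE J : Lam J = sup (range (fun k => rayleigh J (intvec k))).
Proof.
rewrite /Lam /sups /sdrop; congr sup; apply/seteqP; split => x [k _ <-]; by exists k.
Qed.

Lemma rayleigh_intvec_le J k : rayleigh J (intvec k) <= Lam J.
Proof.
by rewrite LamE; apply: sup_upper_bound; [split; [exists (rayleigh J (intvec 0)), 0%N|exact: rayleigh_has_ubound]|exists k].
Qed.

Lemma Lam_adherent J e : 0 < e -> exists k, Lam J - e < rayleigh J (intvec k).
Proof.
move=> e0; have [] := @sup_adherent _ (range (fun k => rayleigh J (intvec k))) e e0.
  by split; [exists (rayleigh J (intvec 0)), 0%N|exact: rayleigh_has_ubound].
by move=> _ [k _ <-]; rewrite LamE => h; exists k.
Qed.

Lemma rayleigh_int_le J (a : 'I_N -> int) : rayleigh J (fun i => (a i)%:~R) <= Lam J.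
Proof.
have := rayleigh_intvec_le J (pickle [ffun i => a i]).
rewrite /intvec pickleK; congr (rayleigh _ _ <= _).
by apply/funext => i; rewrite ffunE.
Qed.

Lemma Lam_ge0 J : 0 <= Lam J.
Proof.
apply: le_trans (rayleigh_int_le J (fun=> 0)); rewrite /rayleigh /qform big1 ?mul0r//.
by move=> k _; rewrite !mulr0.
Qed.

Lemma Lam_le J : Lam J <= nrm1 J.
Proof.
rewrite LamE; apply: ge_sup; first by exists (rayleigh J (intvec 0)), 0%N.
by move=> _ [k _ <-]; exact: le_trans (ler_norm _) (rayleigh_bound _ _).
Qed.

Lemma measurable_rayleigh v : measurable_fun setT (fun J => rayleigh J v).
Proof.
rewrite /rayleigh /qform; apply: measurable_funM => //.
apply: measurable_sum => k; apply: measurable_funM => //; exact: measurable_tnth.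
Qed.

Lemma tame_Lam : tame Lam.
Proof.
apply: (tame_le (g := @nrm1 R _)); last 2 first.
- exact: tame_nrm1.
- by move=> J; rewrite !ger0_norm ?Lam_le ?Lam_ge0 ?nrm1_ge0.
apply: measurable_fun_sups => [J _|k]; first exact: rayleigh_has_ubound.
exact: measurable_rayleigh.
Qed.

Lemma qform_int_le J (a : 'I_N -> int) :
  qform J (fun i => (a i)%:~R) <= Lam J * sqn (fun i => (a i)%:~R).
Proof.
have := rayleigh_int_le J a; rewrite /rayleigh; set v := fun i => (a i)%:~R.
have [s0 _|s0] := eqVneq (sqn v) 0.
  have := qform_bound J v; rewrite s0 !mulr0 normr_le0 => /eqP ->.
  exact: lexx.
have s1 : 0 < sqn v by rewrite lt0r s0 sqn_ge0.
by rewrite ler_pdivrMr.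
Qed.

Lemma qformZ J a v : qform J (fun i => a * v i) = a ^+ 2 * qform J v.
Proof. by rewrite /qform mulr_sumr; apply: eq_bigr => k _; ring. Qed.

Lemma sqnZ a v : sqn (fun i => a * v i) = a ^+ 2 * sqn v.
Proof. by rewrite /sqn mulr_sumr; apply: eq_bigr => k _; ring. Qed.

(* Rounding m v to an integer vector changes both sides by O(1/m) after rescaling. *)
Lemma qform_le_Lam J v : qform J v <= Lam J * sqn v.
Proof.
set V := Num.sqrt (sqn v) + 1.
have V1 : 1 <= V by rewrite lerDr sqrtr_ge0.
have vV i : `|v i| <= V.
  rewrite (@le_trans _ _ (Num.sqrt (sqn v)))// ?lerDl//.
  by rewrite -sqrtr_sqr ler_wsqrtr// sqr_le_sqn.
apply: (@le_addM_invn _ _ _ (nrm1 J * (3 * V) + Lam J * \sum_(i < N) (3 * V))) => m.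
set M := m.+1%:R : R; have M0 : 0 < M by rewrite ltr0n.
set u := fun i => M^-1 * (Num.floor (M * v i))%:~R.
have uv i : `|u i - v i| <= M^-1.
  have /andP[h1 h2] : (Num.floor (M * v i))%:~R <= M * v i < (Num.floor (M * v i) + 1)%:~R.
    by rewrite floor_itv.
  rewrite intrD in h2.
  have -> : u i - v i = M^-1 * ((Num.floor (M * v i))%:~R - M * v i) by rewrite /u; field; rewrite gt_eqF.
  have Mi : 0 <= M^-1 by rewrite invr_ge0 ltW.
  rewrite normrM (ger0_norm Mi) ler_piMr//.
  rewrite ler0_norm ?subr_le0// opprB; apply: ltW; rewrite ltrBlDl.
  exact: h2.
have uV i : `|u i| <= 2 * V.
  rewrite -[u i](subrK (v i)) (le_trans (ler_normD _ _))// mulr2n mulrDl mul1r.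
  rewrite lerD// (le_trans (uv i))// (le_trans _ V1)// invf_le1// ler1n//.
have uuvv i j : `|u i * u j - v i * v j| <= 3 * V / M.
  have -> : u i * u j - v i * v j = u i * (u j - v j) + (u i - v i) * v j by ring.
  apply: (le_trans (ler_normD _ _)); rewrite (normrM (u i)) (normrM _ (v j)).
  have -> : 3 * V / M = (2 * V) * M^-1 + M^-1 * V by ring.
  by apply: lerD; apply: ler_pM.
have h1 : qform J v <= qform J u + nrm1 J * (3 * V / M).
  rewrite -lerBlDl /qform -sumrB (le_trans (ler_norm _))// (le_trans (ler_norm_sum _ _ _))//.
  rewrite /nrm1 mulr_suml; apply: ler_sum => k _.
  by rewrite -mulrBr normrM ler_wpM2l// distrC uuvv.
have h2 : sqn u <= sqn v + \sum_(i < N) (3 * V / M).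
  rewrite -lerBlDl /sqn -sumrB; apply: ler_sum => i _.
  by rewrite !expr2 (le_trans (ler_norm _)).
have h3 : qform J u <= Lam J * sqn u.
  rewrite /u qformZ sqnZ mulrCA ler_wpM2l ?sqr_ge0//; exact: qform_int_le.
apply: (le_trans h1); apply: (@le_trans _ _ (Lam J * (sqn v + \sum_(i < N) (3 * V / M)) + nrm1 J * (3 * V / M))).
  by rewrite lerD2r (le_trans h3)// ler_wpM2l ?Lam_ge0.
rewrite -mulr_suml -/M; apply: eq_lerR; clear.
by move: V (\sum_(i < N) (3 * V)) (Lam J) (sqn v) (nrm1 J) M^-1 => *; ring.
Qed.

Lemma qform_upd J k t v : qform (upd J k t) v = qform J v - (tnth J k - t) * (v (rw k) * v (cl k)).
Proof.
rewrite /qform (bigD1 k)//= tnth_upd eqxx [in RHS](bigD1 k)//=.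
rewrite (eq_bigr (fun i => tnth J i * (v (rw i) * v (cl i)))); first by ring.
by move=> i /negbTE ik; rewrite tnth_upd ik.
Qed.

(** The squared entries are not uniformly bounded, so they are cut at level T. For T of order N the
    N^2 sixth powers contribute only O(1) after division by T^2; the fourth-power analogue, divided
    by T, would contribute order N. *)
Lemma sqr_le_trunc (x T : R) : 0 < T -> x ^+ 2 <= T + x ^+ 6 / T ^+ 2.
Proof.
move=> T0; have [h|h] := leP (x ^+ 2) T.
  by rewrite (le_trans h)// lerDl divr_ge0 ?sqr_ge0// (exprM _ 3 2) sqr_ge0.
apply: (@le_trans _ _ (x ^+ 6 / T ^+ 2)); last by rewrite lerDr ltW.
rewrite ler_pdivlMr ?exprn_gt0//.
rewrite (_ : x ^+ 6 = x ^+ 2 * (x ^+ 2) ^+ 2); last by ring.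
by rewrite ler_wpM2l ?sqr_ge0// ler_sqr ?nnegrE ?sqr_ge0// ltW.
Qed.

(** Testing the resampled matrix against a near-maximizer v of the original one bounds Lam J - Lam
    J' from above by (J_k - t) p_k plus the slack. The p_k^2 add up to at most 1, so J_k^2 may be
    replaced by a bound uniform in k. *)
Lemma Lam_resample_bound J (T : R) : (0 < N)%N -> 0 < T ->
  \sum_k \int[g1]_t psq (Lam J - Lam (upd J k t)) <=
  2 * (2 + T) + (2 / T ^+ 2) * \sum_k tnth J k ^+ 6.
Proof.
move=> N0 T0; have N0' : 0 < N%:R :> R by rewrite ltr0n.
(* The slack 1 / N is chosen so that its square, summed over the N^2 coordinates, contributes
   O(1). *)
have [a ha] := @Lam_adherent J N%:R^-1 (ltac:(by rewrite invr_gt0)).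
set v := intvec a in ha; set p := fun k => v (rw k) * v (cl k) / sqn v.
have tU k : tame1 (fun t => psq (Lam J - Lam (upd J k t))).
  apply: (tame2_r (f := fun q => psq (Lam q.1 - Lam (upd q.1 k q.2)))).
  apply: (@tame2_psqB _ _ (fun q => Lam q.1)); first exact: tame2_cst1 tame_Lam.
  exact: tame_upd tame_Lam.
have tq k : tame1 (fun t : R => 2 * (N%:R^-1 ^+ 2 + p k ^+ 2 * (tnth J k ^+ 2)) + (2 * p k ^+ 2 * t ^+ 2 + (- (4 * p k ^+ 2 * tnth J k)) * t)).
  apply: tame1D; first exact: tame1_cst.
  by apply: tame1D; apply: tame1M; [exact: tame1_cst|exact: (tame1X 2 (tame1_id R))|exact: tame1_cst|exact: tame1_id].
have step k : \int[g1]_t psq (Lam J - Lam (upd J k t)) <=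
    2 * N%:R^-1 ^+ 2 + 2 * p k ^+ 2 * (tnth J k ^+ 2 + 1).
  apply: (@le_trans _ _ (\int[g1]_t (2 * (N%:R^-1 ^+ 2 + p k ^+ 2 * (tnth J k ^+ 2)) + (2 * p k ^+ 2 * t ^+ 2 + (- (4 * p k ^+ 2 * tnth J k)) * t)))).
    apply: le_Rintegral => //; [exact: tame1_integrable..|].
    move=> t _.
    have h : Lam J - Lam (upd J k t) <= N%:R^-1 + (tnth J k - t) * p k.
      have h1 : rayleigh (upd J k t) v = rayleigh J v - (tnth J k - t) * p k.
        by rewrite /rayleigh qform_upd /p; ring.
      have := rayleigh_intvec_le (upd J k t) a; rewrite -/v h1.
      by move: ha; clear; lra.
    apply: (le_trans (psq_le h)); apply: (le_trans (psq_le_sqr _)).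
    have := sqr_ge0 (N%:R^-1 - (tnth J k - t) * p k).
    rewrite -subr_ge0 => h'; rewrite -subr_ge0 (le_trans h')//.
    by apply: eq_lerR; ring.
  rewrite RintegralD//; [|exact: (tame1_integrable (tame1_cst _))|]; last first.
    apply: tame1_integrable; apply: tame1D; apply: tame1M; [exact: tame1_cst|exact: (tame1X 2 (tame1_id R))|exact: tame1_cst|exact: tame1_id].
  have t2 : tame1 (fun t : R => t ^+ 2) by exact: (tame1X 2 (tame1_id R)).
  rewrite E1C RintegralD//; last 2 first.
  - by apply: (@tame1_integrable _ (fun t => 2 * p k ^+ 2 * t ^+ 2)); apply: tame1M => //; exact: tame1_cst.
  - by apply: (@tame1_integrable _ (fun t => - (4 * p k ^+ 2 * tnth J k) * t)); apply: tame1M; [exact: tame1_cst|exact: tame1_id].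
  rewrite !RintegralZl//; [|exact: (tame1_integrable (@tame1_id R))|exact: tame1_integrable].
  have m1 : \int[g1]_t t = 0 by rewrite -(@mom1 R) /mom; apply: eq_Rintegral => t _; rewrite expr1.
  have m2 : \int[g1]_t (t ^+ 2) = 1 by exact: mom2.
  by rewrite m1 m2; apply: eq_lerR; ring.
have p1 : \sum_k p k ^+ 2 <= 1.
  rewrite sum_pr (eq_bigr (fun i => v i ^+ 2 / sqn v * \sum_j (v j ^+ 2 / sqn v))); last first.
    move=> i _; rewrite mulr_sumr; apply: eq_bigr => j _; rewrite /p rw_pr cl_pr; ring.
  rewrite -mulr_suml -!mulr_suml -/(sqn v).
  have [->|s0] := eqVneq (sqn v) 0; first by rewrite !mul0r.
  by rewrite divff// mulr1.
set S := \sum_k tnth J k ^+ 6.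
have S6 k : tnth J k ^+ 6 <= S.
  by rewrite /S (bigD1 k)//= lerDl sumr_ge0// => i _; rewrite (exprM _ 3 2) sqr_ge0.
apply: (@le_trans _ _ (\sum_k (2 * N%:R^-1 ^+ 2 + 2 * p k ^+ 2 * (T + S / T ^+ 2 + 1)))).
  apply: ler_sum => k _; apply: (le_trans (step k)); rewrite lerD2l ler_wpM2l//.
    by apply: mulr_ge0 => //; exact: sqr_ge0.
  rewrite lerD2r (le_trans (sqr_le_trunc _ T0))// lerD2l ler_wpM2r// invr_ge0 sqr_ge0//.
rewrite big_split/= sumr_const card_ord -mulr_suml -mulr_sumr.
have -> : (2 * N%:R^-1 ^+ 2) *+ (N * N) = 2 :> R.
  by rewrite -mulr_natr natrM; field; rewrite gt_eqF.
have -> : 2 * (2 + T) + 2 / T ^+ 2 * S = 2 + 2 * 1 * (T + S / T ^+ 2 + 1) by ring.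
have S0 : 0 <= S by apply: sumr_ge0 => i _; rewrite (exprM _ 3 2) sqr_ge0.
have TS0 : 0 <= T + S / T ^+ 2 + 1.
  by apply: addr_ge0 => //; apply: addr_ge0; [exact: ltW|apply: divr_ge0 => //; exact: sqr_ge0].
by rewrite lerD2l ler_wpM2r// ler_wpM2l.
Qed.

(** The sixth moment 15 of the N^2 entries, times 2 / T^2, gives the second term. With T = t N the
    bound is of order t N + 1 / t^2, hence an arbitrarily small multiple of N for large N. *)
Lemma Lam_var (T : R) : (0 < N)%N -> 0 < T ->
  \int[gT _]_J (Lam J ^+ 2) - (\int[gT _]_J Lam J) ^+ 2 <=
  2 * (2 + T) + 30 * (N%:R / T) ^+ 2.
Proof.
move=> N0 T0; have tL := tame_Lam.
have t6 k : tame (fun J : (N * N).-tuple R => tnth J k ^+ 6) by apply: tameX; exact: tame_tnth.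
have tG k : tame (fun J => \int[g1]_t psq (Lam J - Lam (upd J k t))).
  apply: (@tame2_int_r _ _ (fun p => psq (Lam p.1 - Lam (upd p.1 k p.2)))).
  by apply: (@tame2_psqB _ _ (fun p => Lam p.1)); [exact: tame2_cst1|exact: tame_upd].
apply: (le_trans (efron_stein tL)).
rewrite -E_sum//.
apply: (@le_trans _ _ (\int[gT _]_J (2 * (2 + T) + (2 / T ^+ 2) * \sum_k tnth J k ^+ 6))).
  apply: E_le; first exact: tame_sum.
    by apply: tameD; [exact: tame_cst|apply: tameZ; exact: tame_sum].
  by move=> J; exact: Lam_resample_bound.
rewrite ED; [|exact: tame_cst|by apply: tameZ; exact: tame_sum].
rewrite EC EZ; last exact: tame_sum.
have m6 k : \int[gT (N * N)]_J (tnth J k ^+ 6) = 15.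
  transitivity (\int[gT (N * N)]_J monom (nseq 6 k) J).
    by apply: eq_Rintegral => J _; rewrite /monom /= !big_cons big_nil; ring.
  rewrite E_monom (bigD1 k)//= eqxx /= !momS mom0 big1 ?mulr1; last first.
    by move=> i /negbTE ik; rewrite eq_sym ik mom0.
  by ring.
rewrite E_sum// (eq_bigr (fun=> 15)); last by move=> k _; exact: m6.
have -> : \sum_(i < N * N) 15 = 15 * (N%:R * N%:R) :> R.
  by rewrite sumr_const card_ord -natrM mulr_natr.
apply: eq_lerR.
by move: T0; clear => T0; field; rewrite gt_eqF.
Qed.

End top_eigenvalue.

Section top_eigenvalue_mean.
Variable R : realType.
Local Notation gT := (@gaussT R).

(** The form of the path vector is at most [Lam] times its random squared norm. Replacing [Lam] by
    its mean costs a covariance, bounded by the standard deviation of [Lam] times the root of the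
    fourth moment of the norm; 3^K is the square root of 9^K. *)
Lemma E_Lam_path N K (T : R) : (0 < N)%N -> 0 < T ->
  Num.sqrt (2 * N%:R) * (K%:R * (1 - K%:R ^+ 2 / N%:R)) <=
  K.+1%:R * (\int[gT (N * N)]_J Lam J + 3 ^+ K * Num.sqrt (2 * (2 + T) + 30 * (N%:R / T) ^+ 2)).
Proof.
move=> N0 T0; have [w [mw w2 wJw]] := @path_test_vector R N (Ordinal N0) K N0.
have tw i : tame (w i) := mlin_tame (mw i).
have tw2 i : tame (fun J => w i J ^+ 2) by exact: tameX.
have tL := @tame_Lam R N.
set m := \int[gT (N * N)]_J Lam J; set V := 2 * (2 + T) + _.
set W := fun J => \sum_i w i J ^+ 2.
have tW : tame W by exact: tame_sum.
have EW : \int[gT (N * N)]_J W J = \sum_i \int[gT (N * N)]_J (w i J ^+ 2) by rewrite /W E_sum.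
set e := \int[gT (N * N)]_J W J in EW.
have e0 : 0 <= e by apply: E_ge0 => J; apply: sumr_ge0 => i _; exact: sqr_ge0.
have tLm : tame (fun J : (N * N).-tuple R => Lam J - m) by exact: (tameB tL (tame_cst _ m)).
have m0 : 0 <= m by apply: E_ge0 => J; exact: Lam_ge0.
have V0 : 0 <= V.
  have := sqr_ge0 (N%:R / T); rewrite /V; move: T0; move: (_ ^+ 2) => x; clear; lra.
have eK : e <= K.+1%:R by rewrite EW.
have cov : \int[gT (N * N)]_J ((Lam J - m) * W J) <= 3 ^+ K * Num.sqrt V * e.
  apply: (le_trans (ler_norm _)).
  rewrite -(@ler_pXn2r _ 2)// ?nnegrE// ?mulr_ge0 ?exprn_ge0 ?sqrtr_ge0//.
  rewrite real_normK ?num_real//; apply: (le_trans (E_CS tLm tW)).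
  rewrite !exprMn sqr_sqrtr// -exprM mulnC exprM.
  have -> : (3 ^+ 2) ^+ K * V * e ^+ 2 = V * (9 ^+ K * e ^+ 2).
    by have -> : (3 ^+ 2 : R) = 9; [ring|ring].
  apply: ler_pM.
  - by apply: E_ge0 => J; exact: sqr_ge0.
  - by apply: E_ge0 => J; exact: sqr_ge0.
  - have := @Lam_var R N T N0 T0; rewrite -/m -/V; apply: le_trans; apply: eq_lerR.
    transitivity (\int[gT (N * N)]_J ((Lam J ^+ 2 - (2 * m) * Lam J) + m ^+ 2)).
      by apply: eq_Rintegral => J _; ring.
    rewrite ED; [|by apply: tameB; [exact: tameX|exact: tameZ]|exact: tame_cst].
    by rewrite EC EB ?EZ//; [rewrite -/m; ring|exact: tameX|exact: tameZ].
  - by rewrite EW; exact: E_sqr_norm_mlin.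
apply: (le_trans wJw).
apply: (@le_trans _ _ (\int[gT (N * N)]_J (m * W J + (Lam J - m) * W J))).
  apply: E_le.
  - by apply: tame_sum => i; apply: tame_sum => j; do 2?apply: tameM => //; exact: tame_tnth.
  - by apply: tameD; [exact: tameZ|exact: tameM].
  move=> J; have := qform_le_Lam J (w^~ J); rewrite qformE => /le_trans; apply; apply: eq_lerR.
  by rewrite -mulrDl addrCA subrr addr0.
rewrite ED ?EZ//; [|exact: tameZ|exact: tameM].
apply: (@le_trans _ _ (m * e + 3 ^+ K * Num.sqrt V * e)); first by rewrite lerD2l.
rewrite -mulrDl mulrC ler_wpM2r// addr_ge0// mulr_ge0 ?exprn_ge0 ?sqrtr_ge0//.
Qed.

Lemma E_Lam_lower (d : R) : 0 < d -> exists N0, forall N, (N0 <= N)%N -> (0 < N)%N ->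
  Num.sqrt (2 * N%:R) * (1 - d) <= \int[gT (N * N)]_J Lam J.
Proof.
(* Three losses share d equally: 1 / (K + 1) from the quotient K / (K + 1), K^2 / N from the path
   count, and the covariance term. *)
move=> d0; pose K := Num.trunc (3 / d).
have K1 : K.+1%:R^-1 <= d / 3 :> R.
  by rewrite -[leRHS]invf_div lef_pV2 ?posrE ?divr_gt0// ltW// truncnS_gt.
(* For large N the variance bound is at most 4 t N, and this t makes 9^K 4 t N equal to the square
   of sqrt(2 N) d / 3. *)
pose t := (d / 3) ^+ 2 / 9 ^+ K / 2 : R.
have t0 : 0 < t by rewrite !divr_gt0 ?exprn_gt0// divr_gt0.
exists (maxn (Num.trunc (K%:R ^+ 2 * (3 / d))).+1 (Num.trunc ((4 + 30 / t ^+ 2) / (2 * t))).+1) => N.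
rewrite geq_max => /andP[hN1 hN2] N0.
have N0' : 0 < N%:R :> R by rewrite ltr0n.
have h1 : K%:R ^+ 2 / N%:R <= d / 3.
  rewrite ler_pdivrMr// mulrC -ler_pdivrMr ?divr_gt0// invf_div (le_trans (ltW (truncnS_gt _)))// ler_nat//.
have h2 : 4 + 30 / t ^+ 2 <= 2 * t * N%:R.
  rewrite [leRHS]mulrC -ler_pdivrMr ?mulr_gt0// (le_trans (ltW (truncnS_gt _)))// ler_nat//.
have := @E_Lam_path N K (t * N%:R) N0 (mulr_gt0 t0 N0').
set S := Num.sqrt (2 * N%:R); set V := 2 * (2 + _) + _; set m := \int[_]_J _.
have S0 : 0 <= S by exact: sqrtr_ge0.
have VS : 3 ^+ K * Num.sqrt V <= S * (d / 3).
  rewrite -(@ler_pXn2r _ 2)// ?nnegrE; [|by rewrite mulr_ge0 ?exprn_ge0 ?sqrtr_ge0|by rewrite mulr_ge0 ?divr_ge0// ltW].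
  have VE : V = 4 + 30 / t ^+ 2 + 2 * t * N%:R.
    by rewrite /V; field; rewrite !gt_eqF.
  have V0 : 0 <= V.
    have : 0 <= 30 / t ^+ 2 by rewrite divr_ge0 ?sqr_ge0.
    have : 0 <= t * N%:R by rewrite mulr_ge0// ltW.
    by rewrite VE -mulrA; move: (30 / _) (t * _) => x y; clear; lra.
  rewrite exprMn [leRHS]exprMn sqr_sqrtr// sqr_sqrtr ?mulr_ge0// -exprM mulnC exprM.
  have -> : (3 ^+ 2 : R) = 9 by ring.
  apply: (@le_trans _ _ (9 ^+ K * (4 * t * N%:R))).
    by rewrite ler_wpM2l ?exprn_ge0// VE; move: h2; clear; lra.
  by apply: eq_lerR; rewrite /t; field; rewrite gt_eqF// exprn_gt0.
move=> h.
have Kp : 0 < K.+1%:R :> R by rewrite ltr0n.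
have : S * (K%:R / K.+1%:R * (1 - K%:R ^+ 2 / N%:R)) <= m + S * (d / 3).
  apply: (@le_trans _ _ (m + 3 ^+ K * Num.sqrt V)); last by rewrite lerD2l.
  rewrite -(ler_pM2l Kp); apply: le_trans h; apply: eq_lerR; field.
  by rewrite !gt_eqF.
have : S * (1 - d / 3 - d / 3) <= S * (K%:R / K.+1%:R * (1 - K%:R ^+ 2 / N%:R)).
  rewrite ler_wpM2l//.
  have -> : K%:R / K.+1%:R = 1 - K.+1%:R^-1 :> R by rewrite -natr1; field; rewrite natr1 gt_eqF.
  have : 0 <= K.+1%:R^-1 :> R by rewrite invr_ge0.
  have : 0 <= K%:R ^+ 2 / N%:R :> R by rewrite divr_ge0 ?sqr_ge0.
  move: K1 h1; move: (_ / N%:R) (K.+1%:R^-1) => a b; clear; nra.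
move=> a b; have := le_trans a b; clear; move: S m => s x; lra.
Qed.

End top_eigenvalue_mean.

Section gaussian_vectors.
Variable R : realType.
Local Notation g1 := (@gauss1 R).
Local Notation gT := (@gaussT R).

Lemma gaussT_quadratic n (b : 'I_n -> R) (v : R) : 0 < v ->
  (\int[gT n]_z (expR (\sum_(i < n) (b i * tnth z i - (v - 1) * tnth z i ^+ 2 / 2)))%:E =
   ((Num.sqrt v)^-1 ^+ n * expR (\sum_(i < n) b i ^+ 2 / (2 * v)))%:E)%E.
Proof.
move=> v0.
have mq m (c : 'I_m -> R) : measurable_fun setT (fun z : m.-tuple R =>
    (expR (\sum_(i < m) (c i * tnth z i - (v - 1) * tnth z i ^+ 2 / 2)))%:E).
  apply/measurable_EFinP; apply: (measurableT_comp (@measurable_expR _)).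
  apply: measurable_sum => i.
  have mt : measurable_fun setT (fun z : m.-tuple R => tnth z i) by exact: measurable_tnth.
  by meas.
elim: n b => [|n IH] b.
  by rewrite integral_gaussT0; [rewrite !big_ord0 expr0 mul1r|exact: mq].
rewrite ge0_integral_gaussTS; [|exact: mq|by move=> z; rewrite lee_fin expR_ge0].
have [K KE] : exists K, K = ((Num.sqrt v)^-1 ^+ n * expR (\sum_(i < n) b (lift ord0 i) ^+ 2 / (2 * v))) by eexists.
rewrite (eq_integral (fun x : R => (expR (b ord0 * x - (v - 1) * x ^+ 2 / 2))%:E * K%:E)%E); last first.
  move=> x _; rewrite KE -IH -ge0_integralZl//; last exact: mq.
  apply: eq_integral => s _; rewrite -EFinM -expRD big_ord_recl tnth0; congr (expR (_ + _))%:E.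
  by apply: eq_bigr => i _; rewrite tnthS.
rewrite ge0_integralZr//=; last 2 first.
- by apply/measurable_EFinP; apply: (measurableT_comp (@measurable_expR _)); meas.
- by rewrite lee_fin KE mulr_ge0 ?exprn_ge0 ?invr_ge0 ?sqrtr_ge0 ?expR_ge0.
rewrite gauss1_quadratic// -EFinM KE big_ord_recl expRD (exprS _ n); congr _%:E.
by move: (expR _) (expR _) => x y; ring.
Qed.

Definition ltup n m (x : (n + m).-tuple R) : n.-tuple R := [tuple tnth x (lshift m i) | i < n].
Definition rtup n m (x : (n + m).-tuple R) : m.-tuple R := [tuple tnth x (rshift n i) | i < m].

Lemma tnth_ltup n m (x : (n + m).-tuple R) i : tnth (ltup x) i = tnth x (lshift m i).
Proof. exact: tnth_mktuple. Qed.

Lemma tnth_rtup n m (x : (n + m).-tuple R) i : tnth (rtup x) i = tnth x (rshift n i).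
Proof. exact: tnth_mktuple. Qed.

Lemma measurable_ltup n m : measurable_fun setT (@ltup n m).
Proof.
apply/measurable_fun_tnthP => i; rewrite (_ : _ \o _ = fun x => tnth x (lshift m i)).
  exact: measurable_tnth.
by apply/funext => x; rewrite /= tnth_ltup.
Qed.

Lemma measurable_rtup n m : measurable_fun setT (@rtup n m).
Proof.
apply/measurable_fun_tnthP => i; rewrite (_ : _ \o _ = fun x => tnth x (rshift n i)).
  exact: measurable_tnth.
by apply/funext => x; rewrite /= tnth_rtup.
Qed.

Lemma nrm1_split n m (x : (n + m).-tuple R) : nrm1 x = nrm1 (ltup x) + nrm1 (rtup x).
Proof.
rewrite /nrm1 big_split_ord; congr (_ + _); apply: eq_bigr => i _.
  by rewrite tnth_ltup.
by rewrite tnth_rtup.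
Qed.

Lemma tame_ltup n m (f : n.-tuple R -> R) : tame f -> tame (fun x : (n + m).-tuple R => f (ltup x)).
Proof.
move=> [mf [C C0 fC]]; split; first by apply: measurableT_comp => //; exact: measurable_ltup.
exists C => // x; rewrite (le_trans (fC _))// ler_wpM2l// ler_expR ler_wpM2l//.
by rewrite nrm1_split lerDl nrm1_ge0.
Qed.

Lemma tame_rtup n m (f : m.-tuple R -> R) : tame f -> tame (fun x : (n + m).-tuple R => f (rtup x)).
Proof.
move=> [mf [C C0 fC]]; split; first by apply: measurableT_comp => //; exact: measurable_rtup.
exists C => // x; rewrite (le_trans (fC _))// ler_wpM2l// ler_expR ler_wpM2l//.
by rewrite nrm1_split lerDr nrm1_ge0.
Qed.

Lemma E_ltup n m (f : n.-tuple R -> R) : tame f ->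
  \int[gT (n + m)]_x f (ltup x) = \int[gT n]_x f x.
Proof.
elim: n f => [|n IH] f tf.
  rewrite (_ : f = fun _ => f [tuple]) ?EC//.
  by apply/funext => x; rewrite tuple0.
rewrite (ES (n := n + m) (tame_ltup m tf)) (ES tf); apply: eq_Rintegral => t _.
rewrite -IH; last exact: (tame2_l t (tame_cons tf)).
apply: eq_Rintegral => s _; congr f; apply: eq_from_tnth => i; rewrite tnth_ltup.
case: (unliftP ord0 i) => [j ->|->].
  rewrite tnthS tnth_ltup.
  by rewrite (_ : lshift m (lift ord0 j) = lift ord0 (lshift m j)) ?tnthS//; apply: val_inj.
by rewrite tnth0 (_ : lshift m ord0 = ord0) ?tnth0//; apply: val_inj.
Qed.

Lemma E_rtup n m (f : m.-tuple R -> R) : tame f ->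
  \int[gT (n + m)]_x f (rtup x) = \int[gT m]_x f x.
Proof.
elim: n => [|n IH] tf.
  apply: eq_Rintegral => x _; congr f; apply: eq_from_tnth => i; rewrite tnth_rtup.
  by congr tnth; apply: val_inj.
rewrite (ES (n := n + m) (tame_rtup n.+1 tf)) -(IH tf).
rewrite -[RHS]E1C; apply: eq_Rintegral => t _.
apply: eq_Rintegral => s _; congr f; apply: eq_from_tnth => i; rewrite !tnth_rtup.
by rewrite (_ : rshift n.+1 i = lift ord0 (rshift n i)) ?tnthS//; apply: val_inj.
Qed.

End gaussian_vectors.

(** * Guerra's upper bound *)

Section model.
Variable R : realType.
Local Notation g1 := (@gauss1 R).
Local Notation gT := (@gaussT R).
Variables (beta lambda : R) (N : nat).
Hypothesis beta0 : 0 < beta.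
Implicit Types (J : (N * N).-tuple R) (z : N.-tuple R).

Definition bN : R := beta / Num.sqrt (2 * N%:R).
Definition cz (k : 'I_(N * N)) z : R := bN * (tnth z (rw k) * tnth z (cl k)).
Definition sqt z : R := sqn (tnth z).
Definition hm J z : R := bN * qform J (tnth z) - beta ^+ 2 / (4 * N%:R) * sqt z ^+ 2 + lambda / 2 * sqt z.

Lemma bN_ge0 : 0 <= bN.
Proof. by rewrite /bN divr_ge0 ?sqrtr_ge0// ltW. Qed.

Lemma bN_sqr : bN ^+ 2 = beta ^+ 2 / (2 * N%:R).
Proof. by rewrite /bN expr_div_n sqr_sqrtr// mulr_ge0. Qed.

Lemma hamilE J z : hamil beta lambda N J z = hm J z.
Proof.
rewrite /hamil /hm /sqt /sqn qformE.
have -> : \sum_(i < N) nth 0 z i ^+ 2 = \sum_(i < N) tnth z i ^+ 2.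
  by apply: eq_bigr => i _; rewrite (tnth_nth 0).
congr (_ * _ - _ + _); apply: eq_bigr => i _; apply: eq_bigr => j _.
by rewrite !(tnth_nth 0).
Qed.

Lemma sum_prod_sqr (v : 'I_N -> R) : \sum_k (v (rw k) * v (cl k)) ^+ 2 = sqn v ^+ 2.
Proof.
rewrite sum_pr expr2 /sqn mulr_suml; apply: eq_bigr => i _.
by rewrite mulr_sumr; apply: eq_bigr => j _; rewrite rw_pr cl_pr exprMn.
Qed.

(** The squares of the coefficients sum to beta^2 |z|^4 / (2 N), so the quartic term of the model is
    exactly the normalization in [ham] at unit strength. *)
Lemma hm_cz J z : hm J z = \sum_k (tnth J k * cz k z - cz k z ^+ 2 / 2) + lambda / 2 * sqt z.
Proof.
congr (_ + _); rewrite sumrB; congr (_ - _).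
  by rewrite /qform mulr_sumr; apply: eq_bigr => k _; rewrite /cz; ring.
under eq_bigr do rewrite /cz exprMn.
rewrite -mulr_suml -mulr_sumr sum_prod_sqr bN_sqr -/(sqt z) invfM invfM.
have -> : (4 : R)^-1 = 2^-1 * 2^-1 by field.
by ring.
Qed.

Lemma measurable_sqt : measurable_fun setT sqt.
Proof.
apply: measurable_sum => i.
have mt : measurable_fun setT (fun z => tnth z i) by exact: measurable_tnth.
by meas.
Qed.

Lemma measurable_hm2 : measurable_fun setT (fun p : (N * N).-tuple R * N.-tuple R => hm p.1 p.2).
Proof.
have ms : measurable_fun setT (fun p : (N * N).-tuple R * N.-tuple R => sqt p.2).
  by apply: (measurableT_comp measurable_sqt); exact: measurable_snd.
have mq : measurable_fun setT (fun p : (N * N).-tuple R * N.-tuple R => qform p.1 (tnth p.2)).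
  apply: measurable_sum => k.
  have mt i : measurable_fun setT (fun p : (N * N).-tuple R * N.-tuple R => tnth p.2 i).
    by apply: (measurableT_comp (@measurable_tnth _ _ _ i)); exact: measurable_snd.
  have mj i : measurable_fun setT (fun p : (N * N).-tuple R * N.-tuple R => tnth p.1 i).
    by apply: (measurableT_comp (@measurable_tnth _ _ _ i)); exact: measurable_fst.
  by apply: measurable_funM => //; exact: measurable_funM.
by rewrite /hm; meas.
Qed.

Lemma measurable_hm J : measurable_fun setT (hm J).
Proof. by apply: (measurableT_comp measurable_hm2 (g := fun z => (J, z))); exact: measurable_pair1. Qed.

Lemma sqt_ge0 z : 0 <= sqt z. Proof. exact: sqn_ge0. Qed.

Definition growth J : R := bN * nrm1 J + `|lambda| / 2.

Lemma growth_ge0 J : 0 <= growth J.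
Proof. by rewrite addr_ge0 ?divr_ge0// mulr_ge0 ?nrm1_ge0// bN_ge0. Qed.

Lemma hm_abs J z : `|hm J z + beta ^+ 2 / (4 * N%:R) * sqt z ^+ 2| <= growth J * sqt z.
Proof.
rewrite /hm addrAC subrK (le_trans (ler_normD _ _))// /growth mulrDl lerD//.
  rewrite normrM (ger0_norm bN_ge0) -mulrA ler_wpM2l ?bN_ge0//.
  exact: qform_bound.
rewrite normrM (ger0_norm (sqt_ge0 z)) ler_wpM2r ?sqt_ge0//.
by rewrite normrM [`|2^-1|]ger0_norm.
Qed.

Hypothesis N0 : (0 < N)%N.

Let Np : 0 < N%:R :> R. Proof. by rewrite ltr0n. Qed.

Definition hmax J : R := growth J ^+ 2 * N%:R / beta ^+ 2.

(** The quartic term dominates: the exponent lies below a concave parabola in |z|^2, and [hmax]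
    bounds its maximum. Hence the weight is bounded even without truncation. *)
Lemma hm_le J z : hm J z <= hmax J.
Proof.
have := le_trans (ler_norm _) (hm_abs J z); rewrite -lerBrDr => /le_trans; apply.
rewrite /hmax; move: (growth J) (sqt z) => a s; rewrite -subr_ge0.
have -> : a ^+ 2 * N%:R / beta ^+ 2 - (a * s - beta ^+ 2 / (4 * N%:R) * s ^+ 2) =
   N%:R / beta ^+ 2 * (a - beta ^+ 2 * s / (2 * N%:R)) ^+ 2.
  by field; rewrite !gt_eqF.
by rewrite mulr_ge0 ?sqr_ge0// divr_ge0 ?sqr_ge0.
Qed.

Lemma bm_exp_hm J : bm (fun z => expR (hm J z)).
Proof.
split; first by apply: (measurableT_comp (@measurable_expR _)); exact: measurable_hm.
by exists (expR (hmax J)); rewrite ?expR_ge0// => z; rewrite ger0_norm ?expR_ge0// ler_expR hm_le.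
Qed.

(** The parameter r bounds the squared norm. The cutoff makes the couplings bounded, as the Gibbs
    machinery requires. *)
Definition ball (r : R) z : R := if sqt z <= r then 1 else 0.

Lemma measurable_ball r : measurable_fun setT (ball r).
Proof.
apply: measurable_fun_ifT => //.
exact: measurable_fun_ler measurable_sqt (measurable_cst _).
Qed.

Lemma ball_itv r z : 0 <= ball r z <= 1.
Proof. by rewrite /ball; case: (sqt z <= r); rewrite /= ?ler01 ?lexx. Qed.

Lemma bm_ball r : bm (ball r).
Proof.
split; first exact: measurable_ball.
by exists 1 => // z; have /andP[? ?] := ball_itv r z; rewrite ger0_norm.
Qed.

Lemma tame_sqt : tame sqt.
Proof. by apply: tame_sum => i; apply: tameX; exact: tame_tnth. Qed.

Lemma E_tnth_sqr n (i : 'I_n) : \int[gT n]_z (tnth z i ^+ 2) = 1.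
Proof.
rewrite -(@E_monom_dbl R n [:: i] [:: i; i])//.
by apply: eq_Rintegral => z _; rewrite /monom !big_cons big_nil; ring.
Qed.

Lemma E_sqt : \int[gT N]_z sqt z = N%:R.
Proof.
rewrite /sqt /sqn E_sum; last by move=> i; apply: tameX; exact: tame_tnth.
under eq_bigr do rewrite E_tnth_sqr.
by rewrite sumr_const card_ord.
Qed.

Lemma ball_ge_half r : 2 * N%:R <= r -> 1 / 2 <= \int[gT N]_z ball r z.
Proof.
move=> hr; have r0 : 0 < r by rewrite (lt_le_trans _ hr)// mulr_gt0.
apply: (@le_trans _ _ (\int[gT N]_z (1 - r^-1 * sqt z))).
  rewrite EB ?EZ ?EC ?E_sqt; [|exact: tame_sqt|exact: tame_cst|by apply: tameZ; exact: tame_sqt].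
  have : r^-1 * N%:R <= 1 / 2.
    by rewrite mulrC ler_pdivrMr// mul1r mulrC ler_pdivlMr// mulrC.
  lra.
apply: le_Rintegral => //.
- by apply: tame_integrable; apply: tameB; [exact: tame_cst|apply: tameZ; exact: tame_sqt].
- by apply: bm_integrable; exact: bm_ball.
move=> z _; rewrite /ball; have [h|h] := leP (sqt z) r.
  by rewrite lerBlDr lerDl mulr_ge0 ?invr_ge0 ?sqt_ge0// ltW.
by rewrite subr_le0 mulrC ler_pdivlMr// mul1r ltW.
Qed.

Definition Zr J : R := \int[gT N]_z expR (hm J z).
Definition Zt r J : R := \int[gT N]_z (ball r z * expR (hm J z)).

Lemma bm_Zt r J : bm (fun z => ball r z * expR (hm J z)).
Proof. by apply: bmM; [exact: bm_ball|exact: bm_exp_hm]. Qed.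

Lemma Zt_mono r r' J : r <= r' -> Zt r J <= Zt r' J.
Proof.
move=> rr'; apply: bI_le => [||z]; try exact: bm_Zt.
rewrite ler_wpM2r ?expR_ge0// /ball.
have [h|_] := leP (sqt z) r; last by case: ifP.
by rewrite (le_trans h rr').
Qed.

Lemma Zt_le_Zr r J : Zt r J <= Zr J.
Proof.
apply: bI_le => [||z]; [exact: bm_Zt|exact: bm_exp_hm|].
by have /andP[? ?] := ball_itv r z; rewrite ler_piMl ?expR_ge0.
Qed.

Lemma Zr_le J : Zr J <= expR (hmax J).
Proof.
rewrite -[leRHS](bIC (gT N)); apply: bI_le => [||z]; [exact: bm_exp_hm|exact: bm_cst|].
by rewrite ler_expR hm_le.
Qed.

(** On |z|^2 <= 2 N the exponent is at least - growth 2 N - beta^2 N, and this ball has mass at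
    least 1/2, whence the term ln 2. *)
Definition hmin J : R := growth J * (2 * N%:R) + beta ^+ 2 * N%:R + ln 2.

Lemma Zt_ge J : expR (- hmin J) <= Zt (2 * N%:R) J.
Proof.
have -> : expR (- hmin J) = expR (- (growth J * (2 * N%:R) + beta ^+ 2 * N%:R)) * (1 / 2).
  by rewrite /hmin opprD expRD expRN [expR (- ln 2)]expRN lnK ?posrE// mul1r -expRN.
apply: (le_trans (ler_wpM2l (expR_ge0 _) (ball_ge_half (lexx _)))).
rewrite -bIZ; last exact: bm_ball.
apply: bI_le => [||z]; [by apply: bmZ; exact: bm_ball|exact: bm_Zt|].
rewrite mulrC /ball; have [h|h] := leP (sqt z) (2 * N%:R); last by rewrite !mul0r.
rewrite !mul1r ler_expR.
have := hm_abs J z; rewrite ler_norml => /andP[+ _].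
rewrite -lerBlDr; apply: le_trans; rewrite opprD lerD//.
  by rewrite lerN2 ler_wpM2l ?growth_ge0.
rewrite lerN2; apply: (@le_trans _ _ (beta ^+ 2 / (4 * N%:R) * (2 * N%:R) ^+ 2)).
  by rewrite ler_wpM2l ?divr_ge0 ?sqr_ge0 ?mulr_ge0// ler_sqr ?nnegrE ?sqt_ge0// mulr_ge0.
by apply: eq_lerR; field; rewrite gt_eqF.
Qed.

Lemma Zt_gt0 r J : 2 * N%:R <= r -> 0 < Zt r J.
Proof. by move=> hr; rewrite (lt_le_trans (expR_gt0 _) (le_trans (Zt_ge J) (Zt_mono J hr))). Qed.

Lemma Zr_gt0 J : 0 < Zr J.
Proof. exact: lt_le_trans (Zt_gt0 J (lexx _)) (Zt_le_Zr _ J). Qed.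

Lemma measurable_Zr : measurable_fun setT Zr.
Proof.
apply: (@measurable_Rint_param _ _ _ _ R (gT N) (fun p : (N * N).-tuple R * N.-tuple R => expR (hm p.1 p.2))).
by apply: (measurableT_comp (@measurable_expR _)); exact: measurable_hm2.
Qed.

Lemma measurable_Zt r : measurable_fun setT (Zt r).
Proof.
apply: (@measurable_Rint_param _ _ _ _ R (gT N) (fun p : (N * N).-tuple R * N.-tuple R => ball r p.2 * expR (hm p.1 p.2))).
apply: measurable_funM; first by apply: (measurableT_comp (measurable_ball r)); exact: measurable_snd.
by apply: (measurableT_comp (@measurable_expR _)); exact: measurable_hm2.
Qed.

Lemma tame_growth : tame growth.
Proof. by apply: tameD; [apply: tameZ; exact: tame_nrm1|exact: tame_cst]. Qed.

(** A quadratic polynomial in the l1 norm of J: although Z itself may be as large as the exponential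
    of such a polynomial, its logarithm stays [tame]. *)
Definition lnbound J : R := hmax J + hmin J.

Lemma tame_lnbound : tame lnbound.
Proof.
apply: tameD.
  rewrite /hmax; under eq_fun do rewrite -mulrA mulrC.
  by apply: tameZ; apply: tameX; exact: tame_growth.
apply: tameD; last exact: tame_cst.
apply: tameD; last exact: tame_cst.
by under eq_fun do rewrite mulrC; apply: tameZ; exact: tame_growth.
Qed.

Lemma hmax_ge0 J : 0 <= hmax J.
Proof. by rewrite divr_ge0 ?sqr_ge0// mulr_ge0 ?sqr_ge0. Qed.

Lemma hmin_ge0 J : 0 <= hmin J.
Proof.
rewrite !addr_ge0 ?ln_ge0 ?ler1n//; first by rewrite mulr_ge0 ?growth_ge0 ?mulr_ge0.
by rewrite mulr_ge0 ?sqr_ge0.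
Qed.

Lemma ln_Z_bound J (x : R) : Zt (2 * N%:R) J <= x -> x <= Zr J -> `|ln x| <= `|lnbound J|.
Proof.
move=> h1 h2; have x0 : 0 < x by rewrite (lt_le_trans (Zt_gt0 J (lexx _))).
have b0 : 0 <= lnbound J by apply: addr_ge0; [exact: hmax_ge0|exact: hmin_ge0].
rewrite (ger0_norm b0) ler_norml; apply/andP; split.
  rewrite -ler_expR lnK ?posrE// (le_trans _ h1)// (le_trans _ (Zt_ge J))//.
  by rewrite ler_expR lerN2 lerDr hmax_ge0.
rewrite -ler_expR lnK ?posrE// (le_trans h2)// (le_trans (Zr_le J))//.
by rewrite ler_expR lerDl hmin_ge0.
Qed.

Lemma tame_lnZr : tame (fun J => ln (Zr J)).
Proof.
apply: (tame_le _ tame_lnbound) => [|J]; last by apply: ln_Z_bound => //; exact: Zt_le_Zr.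
by apply: measurableT_comp => //; exact: measurable_Zr.
Qed.

Lemma tame_lnZt r : 2 * N%:R <= r -> tame (fun J => ln (Zt r J)).
Proof.
move=> hr; apply: (tame_le _ tame_lnbound) => [|J]; last by apply: ln_Z_bound; [exact: Zt_mono|exact: Zt_le_Zr].
by apply: measurableT_comp => //; exact: measurable_Zt.
Qed.

Lemma ZN_Zr J : ZN beta lambda N J = (Zr J)%:E.
Proof.
rewrite /ZN gauss_exp_ge0//.
- rewrite /Zr /Rintegral fineK; last first.
    by apply: integrable_fin_num => //; apply: bm_integrable; exact: bm_exp_hm.
  by apply: eq_integral => z _; rewrite hamilE.
- under eq_fun do rewrite hamilE.
  by apply/measurable_EFinP; exact: (bm_exp_hm J).1.
Qed.

(** In the statement [fine] and [ln] act on a finite positive number, so no default value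
    intervenes. *)
Lemma AN_Zr : AN beta lambda N = (N%:R^-1 * \int[gT (N * N)]_J ln (Zr J))%:E.
Proof.
have E : (fun J => ln (fine (ZN beta lambda N J))) = (fun J => ln (Zr J)).
  by apply/funext => J; rewrite ZN_Zr.
by rewrite /AN (gauss_exp_tame (f := fun s => ln (fine (ZN beta lambda N s)))) ?E ?EFinM//; exact: tame_lnZr.
Qed.

End model.

Lemma le_of_diff_sqr (R : realFieldType) (x y z : R) : x <= y -> 0 <= z - 2 * y + x -> x <= z.
Proof. lra. Qed.

Section upper_bound.
Variable R : realType.
Local Notation g1 := (@gauss1 R).
Local Notation gT := (@gaussT R).
Variables (beta lambda : R) (N : nat) (r Q : R).
Hypothesis beta0 : 0 < beta.
Hypothesis N0 : (0 < N)%N.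
Hypothesis hr : 2 * N%:R <= r.
Hypothesis Q0 : 0 <= Q.
Hypothesis v0 : 0 < 1 - lambda + beta ^+ 2 * Q.
Implicit Types (J : (N * N).-tuple R) (z : N.-tuple R).

Definition kap : R := beta * Num.sqrt Q.
(** The N^2 couplings come first, followed by N independent fields of variance beta^2 Q; one
    gaussian tuple of length N^2 + N drives both. *)
Definition cmix (k : 'I_(N * N + N)) z : R :=
  match fintype.split k with
  | inl k' => ball r z * cz beta k' z
  | inr i => ball r z * (kap * tnth z i)
  end.
Definition rmix z : R := ball r z * expR (lambda / 2 * sqt z).
Definition pmix (k : 'I_(N * N + N)) : bool := if fintype.split k is inl _ then true else false.

Let Np : 0 < N%:R :> R. Proof. by rewrite ltr0n. Qed.
Let r0 : 0 < r. Proof. by rewrite (lt_le_trans _ hr)// mulr_gt0. Qed.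

Lemma kap_sqr : kap ^+ 2 = beta ^+ 2 * Q.
Proof. by rewrite /kap exprMn sqr_sqrtr. Qed.

Lemma kap_ge0 : 0 <= kap.
Proof. by rewrite mulr_ge0 ?sqrtr_ge0// ltW. Qed.

Lemma cmix_l k z : cmix (lshift N k) z = ball r z * cz beta k z.
Proof. by rewrite /cmix (unsplitK (inl k)). Qed.
Lemma cmix_r i z : cmix (rshift (N * N) i) z = ball r z * (kap * tnth z i).
Proof. by rewrite /cmix (unsplitK (inr i)). Qed.
Lemma pmix_l k : pmix (lshift N k) = true.
Proof. by rewrite /pmix (unsplitK (inl k)). Qed.
Lemma pmix_r i : pmix (rshift (N * N) i) = false.
Proof. by rewrite /pmix (unsplitK (inr i)). Qed.

Lemma ball_sqr z : ball r z * ball r z = ball r z.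
Proof. by rewrite /ball; case: ifP => _; rewrite ?mulr1 ?mulr0. Qed.

Lemma ball_mul_le (f : N.-tuple R -> R) B z : 0 <= B -> (sqt z <= r -> `|f z| <= B) ->
  `|ball r z * f z| <= B.
Proof.
move=> B0 h; rewrite /ball; case: ifP => [/h|_]; first by rewrite mul1r.
by rewrite mul0r normr0.
Qed.

Lemma cz_le k z : sqt z <= r -> `|cz beta k z| <= bN beta N * r.
Proof.
move=> zr; rewrite /cz normrM (ger0_norm (bN_ge0 N beta0)) ler_wpM2l ?bN_ge0//.
exact: le_trans (mul_le_sqn (tnth z) _ _) zr.
Qed.

Lemma tnth_le_ball i z : sqt z <= r -> `|tnth z i| <= 1 + r.
Proof.
move=> zr; have := le_trans (sqr_le_sqn (tnth z) i) zr.
rewrite -(real_normK (num_real (tnth z i))); move: (`|_|) (normr_ge0 (tnth z i)) => x x0 h.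
have [x1|x1] := leP x 1; first by rewrite (le_trans x1)// lerDl ltW.
by rewrite (le_trans _ (le_trans h _)) ?lerDr// expr2 ler_peMl// ltW.
Qed.

Let D := bN beta N * r + kap * (1 + r).

Let D0 : 0 <= D.
Proof.
have h := ltW r0; apply: addr_ge0; apply: mulr_ge0 => //; first exact: bN_ge0.
  exact: kap_ge0.
exact: addr_ge0.
Qed.

Lemma measurable_tnth_pair n (i j : 'I_n) : measurable_fun setT (fun z : n.-tuple R => tnth z i * tnth z j).
Proof. by apply: measurable_funM; exact: measurable_tnth. Qed.

Let mc k : measurable_fun setT (cmix k).
Proof.
rewrite -(splitK k); case: (fintype.split k) => [k'|i] /=.
  have -> : cmix (lshift N k') = fun z => ball r z * cz beta k' z by apply/funext => z; rewrite cmix_l.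
  apply: measurable_funM; first exact: measurable_ball.
  by apply: measurable_funM => //; exact: measurable_tnth_pair.
have -> : cmix (rshift (N * N) i) = fun z => ball r z * (kap * tnth z i) by apply/funext => z; rewrite cmix_r.
apply: measurable_funM; first exact: measurable_ball.
by apply: measurable_funM => //; exact: measurable_tnth.
Qed.

Let cD k z : `|cmix k z| <= D.
Proof.
rewrite -(splitK k); case: (fintype.split k) => [k'|i] /=.
  rewrite cmix_l; apply: (@ball_mul_le (cz beta k')) => // zr.
  rewrite (le_trans (cz_le k' zr))// lerDl mulr_ge0 ?kap_ge0// addr_ge0// ltW//.
rewrite cmix_r; apply: (@ball_mul_le (fun z => kap * tnth z i)) => // zr.
rewrite normrM (ger0_norm kap_ge0) (@le_trans _ _ (kap * (1 + r)))//.
  by rewrite ler_wpM2l ?kap_ge0// tnth_le_ball.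
by rewrite lerDr mulr_ge0 ?bN_ge0// ltW.
Qed.

Let brho : bm rmix.
Proof.
split.
  apply: measurable_funM; first exact: measurable_ball.
  apply: (measurableT_comp (@measurable_expR _)); apply: measurable_funM => //.
  exact: measurable_sqt.
exists (expR (`|lambda / 2| * r)) => [|z]; first exact: expR_ge0.
apply: (@ball_mul_le (fun z => expR (lambda / 2 * sqt z))) => [|zr]; first exact: expR_ge0.
rewrite ger0_norm ?expR_ge0// ler_expR (le_trans (ler_norm _))// normrM.
by rewrite ler_wpM2l// ger0_norm// sqt_ge0.
Qed.

Let rho0 z : 0 <= rmix z.
Proof. by rewrite /rmix mulr_ge0 ?expR_ge0//; have /andP[] := ball_itv r z. Qed.

Let rho_gt0 : 0 < \int[gT N]_z rmix z.
Proof.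
apply: (@lt_le_trans _ _ (expR (- (`|lambda / 2| * r)) * \int[gT N]_z ball r z)).
  rewrite mulr_gt0 ?expR_gt0// (lt_le_trans _ (ball_ge_half N0 hr))//.
rewrite -bIZ; last exact: bm_ball.
apply: bI_le => // [|z]; first by apply: bmZ; exact: bm_ball.
rewrite mulrC /rmix /ball; case: ifP => [zr|_]; last by rewrite !mul0r.
rewrite !mul1r ler_expR lerNl (le_trans (ler_norm _))// normrN normrM.
by rewrite ler_wpM2l// ger0_norm// sqt_ge0.
Qed.

Let avm := av (gT N) rmix cmix.

Let bm_coord i : bm (fun z => ball r z * tnth z i).
Proof.
split; first by apply: measurable_funM; [exact: measurable_ball|exact: measurable_tnth].
exists (1 + r) => [|z]; first by rewrite addr_ge0// ltW.
apply: (@ball_mul_le (fun z => tnth z i)); first by rewrite addr_ge0// ltW.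
exact: tnth_le_ball.
Qed.

Let bm_pair i j : bm (fun z => ball r z * (tnth z i * tnth z j)).
Proof.
split; first by apply: measurable_funM; [exact: measurable_ball|exact: measurable_tnth_pair].
exists r => [|z]; first exact: ltW.
apply: (@ball_mul_le (fun z => tnth z i * tnth z j)); first exact: ltW.
by move=> zr; exact: le_trans (mul_le_sqn (tnth z) i j) zr.
Qed.

(** With C the averaged matrix z z^T, the variance of the linear form m.z gives |m|^4 <= sum of C_ij
    m_i m_j, and expanding the nonnegative |C - m m^T|^2 turns this into |m|^4 <= |C|^2. *)
Let corr_ge a (J : (N * N + N).-tuple R) (m := fun i => avm a J (fun z => ball r z * tnth z i)) :
  sqn m ^+ 2 <= \sum_k avm a J (fun z => ball r z * (tnth z (rw k) * tnth z (cl k))) ^+ 2.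
Proof.
set C := fun k => avm a J (fun z => ball r z * (tnth z (rw k) * tnth z (cl k))).
have h1 : sqn m ^+ 2 <= \sum_k C k * (m (rw k) * m (cl k)).
  have bl : bm (fun z => \sum_i m i * (ball r z * tnth z i)) by apply: bm_sum => i; exact: bmZ.
  have := @av_sqr _ _ _ (gT N) _ _ _ D D0 brho rho0 rho_gt0 mc cD a J _ bl.
  rewrite (@av_sum _ _ _ (gT N) _ _ _ D D0 brho rho0 rho_gt0 mc cD); last by move=> i; exact: bmZ.
  rewrite (eq_bigr (fun i => m i ^+ 2)); last by move=> i _; rewrite (avZ (gT N) D0 brho mc cD)// expr2.
  move=> /le_trans; apply; apply: eq_lerR.
  transitivity (avm a J (fun z => \sum_k (m (rw k) * m (cl k)) * (ball r z * (tnth z (rw k) * tnth z (cl k))))).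
    congr (av _ _ _ _ _ _); apply/funext => z.
    rewrite expr2 sum_pr mulr_suml; apply: eq_bigr => i _; rewrite mulr_sumr; apply: eq_bigr => j _.
    by rewrite rw_pr cl_pr -[in RHS]ball_sqr; ring.
  rewrite /avm (@av_sum _ _ _ (gT N) _ _ _ D D0 brho rho0 rho_gt0 mc cD); last by move=> k; exact: bmZ.
  by apply: eq_bigr => k _; rewrite (avZ (gT N) D0 brho mc cD)// mulrC.
have h2 : 0 <= \sum_k (C k - m (rw k) * m (cl k)) ^+ 2 by apply: sumr_ge0 => k _; exact: sqr_ge0.
have h3 : \sum_k (C k - m (rw k) * m (cl k)) ^+ 2 =
    \sum_k C k ^+ 2 - 2 * (\sum_k C k * (m (rw k) * m (cl k))) + sqn m ^+ 2.
  rewrite -(sum_prod_sqr m) mulr_sumr -sumrB -big_split/=; apply: eq_bigr => k _; ring.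
by rewrite h3 in h2; exact: le_of_diff_sqr h1 h2.
Qed.

(** After [corr_ge] the difference of the two sides is at least beta^2 (|m|^2 - N Q)^2 / (2 N), a
    square; the constant is what completing this square requires. *)
Let overlap a (J : (N * N + N).-tuple R) : \sum_(k < N * N + N | ~~ pmix k) avm a J (cmix k) ^+ 2 <=
  \sum_(k < N * N + N | pmix k) avm a J (cmix k) ^+ 2 + N%:R * beta ^+ 2 * Q ^+ 2 / 2.
Proof.
set m := fun i => avm a J (fun z => ball r z * tnth z i).
have -> : \sum_(k < N * N + N | ~~ pmix k) avm a J (cmix k) ^+ 2 = kap ^+ 2 * sqn m.
  rewrite big_mkcond big_split_ord/= big1 ?add0r; last by move=> k _; rewrite pmix_l.
  rewrite mulr_sumr; apply: eq_bigr => i _; rewrite pmix_r/= -exprMn; congr (_ ^+ 2).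
  rewrite /m /avm -(avZ (gT N) D0 brho mc cD)//; congr (av _ _ _ _ _ _).
  by apply/funext => z; rewrite cmix_r; ring.
have -> : \sum_(k < N * N + N | pmix k) avm a J (cmix k) ^+ 2 =
   bN beta N ^+ 2 * \sum_k avm a J (fun z => ball r z * (tnth z (rw k) * tnth z (cl k))) ^+ 2.
  rewrite big_mkcond big_split_ord/= [X in _ + X]big1 ?addr0; last by move=> k _; rewrite pmix_r.
  rewrite mulr_sumr; apply: eq_bigr => k _; rewrite pmix_l/= -exprMn; congr (_ ^+ 2).
  rewrite /avm -(avZ (gT N) D0 brho mc cD)//; congr (av _ _ _ _ _ _).
  by apply/funext => z; rewrite cmix_l /cz; ring.
apply: (@le_trans _ _ (bN beta N ^+ 2 * sqn m ^+ 2 + N%:R * beta ^+ 2 * Q ^+ 2 / 2)); last first.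
  by rewrite lerD2r ler_wpM2l ?sqr_ge0//; exact: corr_ge.
rewrite kap_sqr bN_sqr -subr_ge0; move: (sqn m) => s.
have -> : beta ^+ 2 / (2 * N%:R) * s ^+ 2 + N%:R * beta ^+ 2 * Q ^+ 2 / 2 - beta ^+ 2 * Q * s =
  beta ^+ 2 / (2 * N%:R) * (s - N%:R * Q) ^+ 2 by field; rewrite gt_eqF.
by rewrite mulr_ge0 ?sqr_ge0// divr_ge0 ?sqr_ge0// mulr_ge0.
Qed.

Let Zf_couplings (J : (N * N + N).-tuple R) : Zf (gT N) rmix cmix (fun k => if pmix k then 1 else 0) J = Zt beta lambda r (ltup J).
Proof.
apply: eq_Rintegral => z _; rewrite /wgt /rmix /ball; case: ifP => [zr|_]; last by rewrite !mul0r.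
rewrite mul1r mul1r -expRD hm_cz; congr expR; rewrite addrC; congr (_ + _).
rewrite /ham big_split_ord/= [X in _ + X]big1 ?addr0; last first.
  by move=> i _; rewrite pmix_r; ring.
by apply: eq_bigr => k _; rewrite pmix_l cmix_l /ball zr tnth_ltup; ring.
Qed.

(** Once the cutoff is dropped, the integral factorizes over the sites. The normalization of the
    fields adds beta^2 Q to the quadratic coefficient, which becomes 1 - lambda + beta^2 Q. *)
Let Zf_fields (J : (N * N + N).-tuple R) : Zf (gT N) rmix cmix (fun k => if pmix k then 0 else 1) J <=
  sigma beta lambda Q ^+ N * expR (\sum_i (kap * tnth (rtup J) i) ^+ 2 / (2 * (1 - lambda + beta ^+ 2 * Q))).
Proof.
have bw := @bm_wgt _ _ _ _ _ _ _ D0 brho mc cD (fun k => if pmix k then 0 else 1) J.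
have hq := gaussT_quadratic (fun i => kap * tnth (rtup J) i) v0.
rewrite -lee_fin /sigma -hq /Zf /Rintegral fineK; last first.
  by apply: integrable_fin_num => //; exact: bm_integrable.
apply: ge0_le_integral => //.
- by move=> z _; rewrite lee_fin wgt_ge0.
- by apply/measurable_EFinP; exact: bw.1.
- apply/measurable_EFinP; apply: (measurableT_comp (@measurable_expR _)); apply: measurable_sum => i.
  have mt : measurable_fun setT (fun z : N.-tuple R => tnth z i) by exact: measurable_tnth.
  by meas.
move=> z _; rewrite lee_fin /wgt /rmix /ball; case: ifP => [zr|_]; last by rewrite !mul0r expR_ge0.
rewrite mul1r -expRD ler_expR /ham big_split_ord/= big1 ?add0r; last first.
  by move=> k _; rewrite pmix_l; ring.
rewrite /sqt /sqn mulr_sumr -big_split/=; apply: ler_sum => i _.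
rewrite pmix_r cmix_r /ball zr tnth_rtup; apply: eq_lerR.
have -> : 1 - lambda + beta ^+ 2 * Q - 1 = kap ^+ 2 - lambda by rewrite kap_sqr; ring.
by field.
Qed.

(** The replica symmetric functional: the value of [Ahat] when x vanishes on [0, Q). *)
Definition UB (Q : R) : R := ln (sigma beta lambda Q) +
  beta ^+ 2 * Q / (2 * (1 - lambda + beta ^+ 2 * Q)) + beta ^+ 2 / 4 * Q ^+ 2.

Lemma E_lnZt_le : \int[gT (N * N)]_J ln (Zt beta lambda r J) <= N%:R * UB Q.
Proof.
have tl := tame_lnZt lambda beta0 N0 hr.
rewrite -(E_ltup N tl).
have -> : \int[gT (N * N + N)]_x ln (Zt beta lambda r (ltup x)) =
    free (gT N) rmix cmix (fun k => if pmix k then 1 else 0).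
  by apply: eq_Rintegral => J _; rewrite Zf_couplings.
have := @rs_interpolation _ _ _ (gT N) rmix _ cmix D D0 brho rho0 rho_gt0 mc cD pmix _ overlap.
move=> /le_trans; apply.
have s0 : 0 < sigma beta lambda Q by rewrite invr_gt0 sqrtr_gt0.
set v := 1 - lambda + beta ^+ 2 * Q; have v1 : 0 < v := v0.
have tx i : tame (fun h : N.-tuple R => kap ^+ 2 / (2 * v) * tnth h i ^+ 2).
  by apply: tameZ; apply: tameX; exact: tame_tnth.
have tq : tame (fun h : N.-tuple R => N%:R * ln (sigma beta lambda Q) + \sum_i kap ^+ 2 / (2 * v) * tnth h i ^+ 2).
  by apply: tameD; [exact: tame_cst|exact: tame_sum].
have : free (gT N) rmix cmix (fun k => if pmix k then 0 else 1) <=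
    \int[gT (N * N + N)]_J (N%:R * ln (sigma beta lambda Q) + \sum_i kap ^+ 2 / (2 * v) * tnth (rtup J) i ^+ 2).
  apply: E_le.
  - exact: (@tame_lnZf _ _ _ (gT N) _ _ _ D D0 brho rho0 rho_gt0 mc cD).
  - exact: (tame_rtup (N * N) tq).
  move=> J; have Z0 := @Zf_gt0 _ _ _ (gT N) _ _ _ D D0 brho rho0 rho_gt0 mc cD (fun k => if pmix k then 0 else 1) J.
  have := Zf_fields J; rewrite -ler_ln ?posrE//; last by rewrite mulr_gt0 ?exprn_gt0 ?expR_gt0.
  move=> /le_trans; apply; rewrite lnM ?posrE ?exprn_gt0 ?expR_gt0// lnXn// expRK -[ln _ *+ N]mulr_natl lerD2l.
  by apply: eq_lerR; apply: eq_bigr => i _; rewrite exprMn -/v; ring.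
rewrite (E_rtup (N * N) tq) ED; [|exact: tame_cst|exact: tame_sum].
rewrite EC E_sum// (eq_bigr (fun=> kap ^+ 2 / (2 * v))); last first.
  by move=> i _; rewrite EZ ?E_tnth_sqr ?mulr1//; apply: tameX; exact: tame_tnth.
rewrite sumr_const card_ord => h; rewrite -lerBrDr (le_trans h)//; apply: eq_lerR.
by rewrite /UB kap_sqr -/v -[_ *+ N]mulr_natl; field; rewrite gt_eqF.
Qed.

End upper_bound.

Section untruncated.
Variable R : realType.
Local Notation gT := (@gaussT R).
Variables (beta lambda : R) (N : nat).
Hypothesis beta0 : 0 < beta.
Hypothesis N0 : (0 < N)%N.
Implicit Types (J : (N * N).-tuple R) (z : N.-tuple R).
Let Np : 0 < N%:R :> R. Proof. by rewrite ltr0n. Qed.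
Local Notation Zr := (@Zr R beta lambda N).
Local Notation Zt := (@Zt R beta lambda N).
Local Notation a := (@lnbound R beta lambda N).

Lemma Zr_sub_Zt J r : 0 < r -> Zr J - Zt r J <= expR (hmax beta lambda J) * (N%:R / r).
Proof.
move=> r0.
have bh := bm_exp_hm lambda beta0 N0 J; have bt := bm_Zt lambda beta0 N0 r J.
rewrite /Zr /Zt -(RintegralB measurableT (bm_integrable _ bh) (bm_integrable _ bt)).
have ti : tame (fun z : N.-tuple R => r^-1 * (expR (hmax beta lambda J) * sqt z)).
  by apply: tameZ; apply: tameZ; exact: tame_sqt.
have -> : expR (hmax beta lambda J) * (N%:R / r) = \int[gT N]_z (r^-1 * (expR (hmax beta lambda J) * sqt z)).
  rewrite EZ; last by apply: tameZ; exact: tame_sqt.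
  by rewrite EZ ?E_sqt; [ring|exact: tame_sqt].
apply: le_Rintegral => //.
- by apply: bm_integrable; exact: bmB.
- exact: tame_integrable.
move=> z _; rewrite -{1}[expR (hm _ _ _ _)]mul1r -mulrBl /ball; have [zr|zr] := leP (sqt z) r.
  by rewrite subrr mul0r !mulr_ge0 ?invr_ge0 ?expR_ge0 ?sqt_ge0// ltW.
rewrite subr0 mul1r mulrCA (@le_trans _ _ (expR (hmax beta lambda J)))//.
  by rewrite ler_expR hm_le.
by rewrite ler_peMr ?expR_ge0// mulrC ler_pdivlMr// mul1r ltW.
Qed.

(** If the logarithmic bound on J is at most L, the part outside the ball is a small fraction of Z
    by Markov's inequality. For the other J, the crude bound 2 a is at most 2 a^2 / L. *)
Lemma lnZr_sub_lnZt J r L : 2 * N%:R <= r -> 0 < L ->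
  ln (Zr J) - ln (Zt r J) <= 2 * (a J ^+ 2 / L) + N%:R / r * expR L.
Proof.
move=> hr L0; have r0 : 0 < r by rewrite (lt_le_trans _ hr)// mulr_gt0.
have a0 : 0 <= a J by apply: addr_ge0; [exact: hmax_ge0|exact: hmin_ge0].
have Zt0 := Zt_gt0 lambda beta0 N0 J hr.
have e0 : 0 <= N%:R / r * expR L by rewrite mulr_ge0 ?expR_ge0// divr_ge0// ltW.
have l0 : 0 <= 2 * (a J ^+ 2 / L) by rewrite mulr_ge0// divr_ge0 ?sqr_ge0// ltW.
have [aL|aL] := leP (a J) L.
  rewrite (@le_trans _ _ (N%:R / r * expR (a J)))//; last first.
    by rewrite (le_trans _ (_ : N%:R / r * expR L <= _)) ?lerDr// ler_wpM2l ?ler_expR// divr_ge0// ltW.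
  rewrite -ln_div ?posrE ?Zr_gt0//.
  have Zd : 0 < Zr J / Zt r J by rewrite divr_gt0// Zr_gt0.
  apply: (@le_trans _ _ (Zr J / Zt r J - 1)).
    by rewrite lerBrDl -[leRHS]lnK ?posrE// expR_ge1Dx.
  have -> : Zr J / Zt r J - 1 = (Zr J - Zt r J) / Zt r J by field; rewrite gt_eqF.
  rewrite ler_pdivrMr// (le_trans (Zr_sub_Zt J r0))//.
  rewrite /lnbound expRD; have h := le_trans (Zt_ge lambda beta0 N0 J) (Zt_mono lambda beta0 N0 J hr).
  rewrite (@le_trans _ _ (N%:R / r * (expR (hmax beta lambda J) * expR (hmin beta lambda J)) * expR (- hmin beta lambda J)))//.
    rewrite -!mulrA -expRD subrr expR0 mulr1; apply: eq_lerR; ring.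
  by rewrite ler_wpM2l// mulr_ge0 ?divr_ge0 ?mulr_ge0 ?expR_ge0// ltW.
apply: (@le_trans _ _ (2 * (a J ^+ 2 / L))); last by rewrite lerDl.
apply: (@le_trans _ _ (2 * a J)).
  have := ln_Z_bound beta0 N0 (Zt_le_Zr lambda beta0 N0 (2 * N%:R) J) (lexx _).
  have := ln_Z_bound beta0 N0 (Zt_mono lambda beta0 N0 J hr) (Zt_le_Zr lambda beta0 N0 r J).
  rewrite (ger0_norm a0) !ler_norml => /andP[h1 _] /andP[_ h2].
  move: h1 h2; move: (ln _) (ln _) (lnbound _ _ _) => x y b; lra.
by rewrite ler_pM2l// ler_pdivlMr// expr2 ler_wpM2l// ltW.
Qed.

Lemma E_lnZr_le Q : 0 <= Q -> 0 < 1 - lambda + beta ^+ 2 * Q ->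
  \int[gT (N * N)]_J ln (Zr J) <= N%:R * UB beta lambda Q.
Proof.
move=> Q0 v0; have ta := tame_lnbound beta lambda N.
have ta2 : tame (fun J => a J ^+ 2) by exact: tameX.
(* Two nested limits: for a fixed level l + 1 the radius, growing with m, goes to infinity; then the
   level does. *)
apply: (@le_addM_invn _ _ _ (2 * \int[gT (N * N)]_J (a J ^+ 2))) => l.
apply: (@le_addM_invn _ _ _ (N%:R * expR l.+1%:R)) => m.
set r := 2 * N%:R + m%:R : R.
have hr : 2 * N%:R <= r by rewrite /r lerDl.
have tt := tame_lnZt lambda beta0 N0 hr; have tz := tame_lnZr lambda beta0 N0.
have : \int[gT (N * N)]_J ln (Zr J) <= \int[gT (N * N)]_J (ln (Zt r J) + ((2 / l.+1%:R) * a J ^+ 2 + N%:R / r * expR l.+1%:R)).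
  apply: E_le => //.
    by apply: tameD => //; apply: tameD; [exact: tameZ|exact: tame_cst].
  move=> J; rewrite -lerBlDl (le_trans (lnZr_sub_lnZt J hr (ltr0Sn R l)))//.
  by rewrite lerD2r; apply: eq_lerR; rewrite mulrCA mulrC [2 / _]mulrC; ring.
rewrite ED//; last by apply: tameD; [exact: tameZ|exact: tame_cst].
rewrite ED; [|exact: tameZ|exact: tame_cst].
rewrite EZ// EC => /le_trans; apply.
rewrite addrA; apply: lerD; first apply: lerD.
- exact: E_lnZt_le.
- by apply: eq_lerR; ring.
rewrite -mulrA mulrCA [leRHS]mulrAC -mulrA; rewrite [leLHS](_ : _ = N%:R * expR l.+1%:R / r); last by ring.
rewrite [leRHS](_ : _ = N%:R * expR l.+1%:R / m.+1%:R); last by ring.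
rewrite ler_wpM2l ?mulr_ge0 ?expR_ge0// lef_pV2 ?posrE//; last first.
  by rewrite (lt_le_trans _ hr)// mulr_gt0.
rewrite /r -natr1 addrC lerD2r.
by rewrite -natrM ler1n muln_gt0.
Qed.

End untruncated.

(** * Lower bound by a shift along the top eigenvector *)

Section affine_change_of_variables.
Variable R : realType.
Local Notation g1 := (@gauss1 R).
Local Notation gT := (@gaussT R).

Definition afft n (q : R) (w : 'I_n -> R) (y : n.-tuple R) : n.-tuple R :=
  [tuple q * tnth y i + w i | i < n].

Lemma tnth_afft n q (w : 'I_n -> R) y i : tnth (afft q w y) i = q * tnth y i + w i.
Proof. exact: tnth_mktuple. Qed.

Lemma afft_cons n q (w : 'I_n.+1 -> R) x (s : n.-tuple R) :
  afft q w [tuple of x :: s] = [tuple of (q * x + w ord0) :: afft q (fun i => w (lift ord0 i)) s].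
Proof.
apply: eq_from_tnth => i; rewrite tnth_afft; case: (unliftP ord0 i) => [j ->|->].
  by rewrite !tnthS tnth_afft.
by rewrite !tnth0.
Qed.

Lemma measurable_afft n q (w : 'I_n -> R) : measurable_fun setT (afft q w).
Proof.
apply/measurable_fun_tnthP => i; rewrite (_ : _ \o _ = fun y => q * tnth y i + w i); last first.
  by apply/funext => y; rewrite /= tnth_afft.
apply: measurable_funD => //; apply: measurable_funM => //; exact: measurable_tnth.
Qed.

(** The logarithm of the ratio of the standard gaussian densities at the shifted and at the original
    point. *)
Definition affw n (q : R) (w : 'I_n -> R) (y : n.-tuple R) : R :=
  \sum_(i < n) (tnth y i ^+ 2 - (q * tnth y i + w i) ^+ 2) / 2.

Lemma measurable_affw n q (w : 'I_n -> R) : measurable_fun setT (affw q w).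
Proof.
apply: measurable_sum => i.
have mt : measurable_fun setT (fun z : n.-tuple R => tnth z i) by exact: measurable_tnth.
by meas.
Qed.

Lemma gaussT_aff n (q : R) (w : 'I_n -> R) (f : n.-tuple R -> \bar R) : 0 < q ->
  measurable_fun setT f -> (forall x, 0 <= f x)%E ->
  (\int[gT n]_z f z = \int[gT n]_y (f (afft q w y) * (q ^+ n * expR (affw q w y))%:E))%E.
Proof.
move=> q0; elim: n w f => [|n IH] w f mf f0.
  rewrite !integral_gaussT0//; last first.
    apply: emeasurable_funM; first by apply: measurableT_comp => //; exact: measurable_afft.
    by apply/measurable_EFinP; apply: measurable_funM => //; apply: (measurableT_comp (@measurable_expR _)); exact: measurable_affw.
  by rewrite /affw big_ord0 expR0 expr0 mulr1 mule1; congr f; rewrite [RHS]tuple0.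
have mF := measurable_ge0_inner mf f0.
have F0 (x : R) : (0 <= \int[gT n]_s f [tuple of x :: s])%E by apply: integral_ge0.
rewrite !ge0_integral_gaussTS//; last 2 first.
- apply: emeasurable_funM; first by apply: measurableT_comp => //; exact: measurable_afft.
  by apply/measurable_EFinP; apply: measurable_funM => //; apply: (measurableT_comp (@measurable_expR _)); exact: measurable_affw.
- by move=> x; rewrite mule_ge0// lee_fin mulr_ge0 ?expR_ge0// exprn_ge0// ltW.
rewrite (gauss1_aff (w ord0) q0 mF F0).
apply: eq_integral => x _.
set w' := fun i => w (lift ord0 i).
have mfx : measurable_fun setT (fun s : n.-tuple R => f [tuple of (q * x + w ord0) :: s]) by exact: measurable_section.
rewrite (IH w' _ mfx (fun s => f0 _)) -ge0_integralZr//; last 3 first.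
- apply: emeasurable_funM; first by apply: (measurableT_comp mfx (g := afft q w')); exact: measurable_afft.
  by apply/measurable_EFinP; apply: measurable_funM => //; apply: (measurableT_comp (@measurable_expR _)); exact: measurable_affw.
- by move=> s _; rewrite mule_ge0// lee_fin mulr_ge0 ?expR_ge0// exprn_ge0// ltW.
- by rewrite lee_fin mulr_ge0 ?expR_ge0// ltW.
apply: eq_integral => s _; rewrite afft_cons -/w' -muleA; congr (_ * _)%E.
rewrite -EFinM; congr _%:E.
rewrite /affw big_ord_recl tnth0 expRD (exprS q n).
under [in RHS]eq_bigr do rewrite tnthS.
by rewrite mulrACA [q * q ^+ n]mulrC; congr (_ * _); exact: mulrC.
Qed.

End affine_change_of_variables.

Section gaussian_band.
Variable R : realType.
Local Notation g1 := (@gauss1 R).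
Local Notation gT := (@gaussT R).
Variables (N : nat) (eps : R).
Implicit Types (y z : N.-tuple R).

Definition band y : R := if `|sqt y - N%:R| <= eps * N%:R then 1 else 0.

Lemma bm_band : bm band.
Proof.
split.
  apply: measurable_fun_ifT => //; apply: measurable_fun_ler => //.
  by apply: (measurableT_comp (@normr_measurable _ _)); apply: measurable_funB => //; exact: measurable_sqt.
by exists 1 => // y; rewrite /band; case: ifP => _; rewrite ?normr0 ?normr1.
Qed.

Lemma band_ge0 y : 0 <= band y.
Proof. by rewrite /band; case: ifP. Qed.

Lemma E_sqr2 (i j : 'I_N) : \int[gT N]_y (tnth y i ^+ 2 * tnth y j ^+ 2) = if i == j then 3 else 1.
Proof.
transitivity (\int[gT N]_y monom [:: i; j; i; j] y).
  by apply: eq_Rintegral => y _; rewrite /monom !big_cons big_nil; ring.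
case: eqP => [<-|/eqP ij]; last by apply: (@E_monom_dbl _ _ [:: i; j]); rewrite //= inE ij.
rewrite E_monom (bigD1 i)//= eqxx big1 ?mulr1; first by rewrite mom4.
by move=> k /negbTE ki; rewrite eq_sym ki mom0.
Qed.

Lemma E_sqt_var : \int[gT N]_y ((sqt y - N%:R) ^+ 2) = 2 * N%:R.
Proof.
have t2 (i : 'I_N) : tame (fun y : N.-tuple R => tnth y i ^+ 2) by apply: tameX; exact: tame_tnth.
have tT : tame (fun y => sqt y ^+ 2) by apply: tameX; exact: tame_sqt.
have ET : \int[gT N]_y (sqt y ^+ 2) = N%:R ^+ 2 + 2 * N%:R.
  transitivity (\int[gT N]_y (\sum_(i < N) \sum_(j < N) tnth y i ^+ 2 * tnth y j ^+ 2)).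
    apply: eq_Rintegral => y _; rewrite expr2 /sqt /sqn mulr_suml; apply: eq_bigr => i _.
    by rewrite mulr_sumr.
  rewrite E_sum; last by move=> i; apply: tame_sum => j; exact: tameM.
  rewrite (eq_bigr (fun=> N%:R + 2)); first by rewrite sumr_const card_ord -mulr_natl; ring.
  move=> i _; rewrite E_sum; last by move=> j; exact: tameM.
  under eq_bigr do rewrite E_sqr2.
  rewrite (bigD1 i)//= eqxx.
  rewrite (eq_bigr (fun=> 1)); last by move=> j /negbTE; rewrite eq_sym => ->.
  have : \sum_(j < N) (1 : R) = N%:R by rewrite sumr_const card_ord.
  by rewrite (bigD1 i)//= => <-; ring.
transitivity (\int[gT N]_y (sqt y ^+ 2 - (2 * N%:R) * sqt y + N%:R ^+ 2)).
  by apply: eq_Rintegral => y _; ring.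
rewrite ED ?EB ?EC ?EZ ?ET ?E_sqt//; [ring|exact: tame_sqt|apply: tameZ; exact: tame_sqt| |exact: tame_cst].
by apply: tameB => //; apply: tameZ; exact: tame_sqt.
Qed.

(** Chebyshev's inequality in pointwise form: |y|^2 has variance 2 N, so the condition on N makes
    the exceptional mass at most 1/2. *)
Lemma band_ge_half : 0 < eps -> 4 / eps ^+ 2 <= N%:R -> 1 / 2 <= \int[gT N]_y band y.
Proof.
move=> e0 hN; have Np : 0 < N%:R :> R by rewrite (lt_le_trans _ hN)// divr_gt0// exprn_gt0.
have eN : 0 < eps * N%:R by rewrite mulr_gt0.
have tv : tame (fun y => (sqt y - N%:R) ^+ 2).
  by apply: tameX; apply: tameB; [exact: tame_sqt|exact: tame_cst].
apply: (@le_trans _ _ (\int[gT N]_y (1 - ((eps * N%:R) ^+ 2)^-1 * (sqt y - N%:R) ^+ 2))).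
  rewrite EB ?EZ ?EC ?E_sqt_var//; [|exact: tame_cst|exact: tameZ].
  have : ((eps * N%:R) ^+ 2)^-1 * (2 * N%:R) <= 1 / 2.
    rewrite mulrC ler_pdivrMr ?exprn_gt0//.
    have -> : 1 / 2 * (eps * N%:R) ^+ 2 = (eps ^+ 2 / 2 * N%:R) * N%:R by field.
    rewrite ler_pM2r//; have {1}-> : 2 = eps ^+ 2 / 2 * (4 / eps ^+ 2) by field; rewrite gt_eqF.
    by rewrite ler_wpM2l// divr_ge0 ?sqr_ge0.
  lra.
apply: le_Rintegral => //.
- by apply: tame_integrable; apply: tameB; [exact: tame_cst|exact: tameZ].
- by apply: bm_integrable; exact: bm_band.
move=> y _; rewrite /band; have [h|h] := leP `|sqt y - N%:R| (eps * N%:R).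
  by rewrite lerBlDr lerDl mulr_ge0 ?sqr_ge0// invr_ge0 sqr_ge0.
rewrite subr_le0 mulrC ler_pdivlMr ?exprn_gt0// mul1r.
by rewrite -(real_normK (num_real (sqt y - _))) ler_sqr ?nnegrE ?(ltW eN)// ltW.
Qed.

Definition dot y z : R := \sum_(i < N) tnth y i * tnth z i.

Lemma measurable_dot y : measurable_fun setT (dot y).
Proof.
by apply: measurable_sum => i; apply: measurable_funM => //; exact: measurable_tnth.
Qed.

(* Linearize the square with an auxiliary one-dimensional gaussian variable. *)
Lemma gaussT_exp_dot_sqr y (th : R) : 0 <= th -> th * sqt y < 1 ->
  (\int[gT N]_z (expR (th / 2 * dot y z ^+ 2))%:E = ((Num.sqrt (1 - th * sqt y))^-1)%:E)%E.
Proof.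
move=> th0 h1.
have mf : measurable_fun setT (fun p : N.-tuple R * R => (expR (Num.sqrt th * dot y p.1 * p.2))%:E).
  apply/measurable_EFinP; apply: (measurableT_comp (@measurable_expR _)).
  apply: measurable_funM => //; apply: measurable_funM => //.
  by apply: (measurableT_comp (measurable_dot y)).
transitivity (\int[gT N]_z \int[g1]_x (expR (Num.sqrt th * dot y z * x))%:E)%E.
  apply: eq_integral => z _; rewrite gauss1_mgf; congr (expR _)%:E.
  by rewrite exprMn sqr_sqrtr// mulrAC.
have := @fubini_tonelli _ _ _ _ _ (gT N) g1 _ mf (fun p => ltac:(by rewrite lee_fin expR_ge0)).
move=> /= ->.
transitivity (\int[g1]_x (expR (0 * x - ((1 - th * sqt y) - 1) * x ^+ 2 / 2))%:E)%E; last first.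
  by rewrite gauss1_quadratic ?subr_gt0// expr0n mul0r expR0 mulr1.
apply: eq_integral => x _.
transitivity (\int[gT N]_z (expR (\sum_(i < N) ((Num.sqrt th * x * tnth y i) * tnth z i - (1 - 1) * tnth z i ^+ 2 / 2)))%:E)%E.
  apply: eq_integral => z _; congr (expR _)%:E.
  by rewrite /dot -mulrA mulr_suml mulr_sumr; apply: eq_bigr => i _; ring.
rewrite gaussT_quadratic// sqrtr1 invr1 expr1n mul1r; congr (expR _)%:E.
rewrite mul0r add0r.
rewrite (eq_bigr (fun i => (th * x ^+ 2 / 2) * tnth y i ^+ 2)); last first.
  move=> i _; rewrite mulr1.
  have -> : (Num.sqrt th * x * tnth y i) ^+ 2 = Num.sqrt th ^+ 2 * x ^+ 2 * tnth y i ^+ 2 by ring.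
  by rewrite sqr_sqrtr//; ring.
by rewrite -mulr_sumr -/(sqn _) -/(sqt y); field.
Qed.

End gaussian_band.

Section shifted_exponent.
Variable R : realType.
Variables (beta lambda : R) (N : nat).
Implicit Types (J : (N * N).-tuple R) (x w : 'I_N -> R) (y : N.-tuple R).

Definition cross J x w : R := \sum_k tnth J k * (x (rw k) * w (cl k) + w (rw k) * x (cl k)).
Definition sprod x w : R := \sum_i x i * w i.

Lemma qform_aff J q x w :
  qform J (fun i => q * x i + w i) = q ^+ 2 * qform J x + q * cross J x w + qform J w.
Proof.
by rewrite /qform /cross !mulr_sumr -!big_split/=; apply: eq_bigr => k _; ring.
Qed.

Lemma sqn_aff q x w : sqn (fun i => q * x i + w i) = q ^+ 2 * sqn x + 2 * q * sprod x w + sqn w.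
Proof.
by rewrite /sqn /sprod !mulr_sumr -!big_split/=; apply: eq_bigr => k _; ring.
Qed.

Lemma crossN J x w : cross J x (fun i => - w i) = - cross J x w.
Proof. by rewrite /cross -sumrN; apply: eq_bigr => k _; ring. Qed.

Lemma sprodN x w : sprod x (fun i => - w i) = - sprod x w.
Proof. by rewrite /sprod -sumrN; apply: eq_bigr => k _; ring. Qed.

Lemma qformN J w : qform J (fun i => - w i) = qform J w.
Proof. by rewrite /qform; apply: eq_bigr => k _; ring. Qed.

Lemma sqnN w : sqn (fun i => - w i) = sqn w.
Proof. by rewrite /sqn; apply: eq_bigr => k _; ring. Qed.

Lemma sprod_sqr x w : sprod x w ^+ 2 = \sum_k (w (rw k) * w (cl k)) * (x (rw k) * x (cl k)).
Proof.
rewrite sum_pr expr2 /sprod mulr_suml; apply: eq_bigr => i _.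
by rewrite mulr_sumr; apply: eq_bigr => j _; rewrite rw_pr cl_pr; ring.
Qed.

Variables (s q : R).
Hypothesis qs : q ^+ 2 = s.

(** Everything that the substitution z = q y + w leaves in the exponent besides the normalized
    Hamiltonian of y at inverse temperature beta s. [geven] is its part even in w. *)
Definition gexp J w x : R :=
  q * bN beta N * cross J x w + bN beta N * qform J w
  - beta ^+ 2 / (4 * N%:R) * (2 * s * sqn x * sqn w + sqn w ^+ 2
      + 4 * q * sprod x w * (s * sqn x + sqn w) + 4 * s * sprod x w ^+ 2)
  - (1 - lambda) / 2 * (s * sqn x + 2 * q * sprod x w + sqn w) + sqn x / 2.

Definition geven J w x : R :=
  bN beta N * qform J w
  - beta ^+ 2 / (4 * N%:R) * (2 * s * sqn x * sqn w + sqn w ^+ 2 + 4 * s * sprod x w ^+ 2)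
  - (1 - lambda) / 2 * (s * sqn x + sqn w) + sqn x / 2.

Lemma gexp_even J w x : gexp J w x + gexp J (fun i => - w i) x = 2 * geven J w x.
Proof.
rewrite /gexp /geven crossN sprodN qformN sqnN.
by move: (beta ^+ 2 / _) (cross _ _ _) (qform _ _) (sprod _ _) (sqn x) (sqn w) (bN _ _) => *; field.
Qed.

Lemma shift_exponent J w y : hm beta lambda J (afft q w y) + affw q w y =
  (s * bN beta N * qform J (tnth y) - (s * bN beta N) ^+ 2 / 2 * sqn (tnth y) ^+ 2) + gexp J w (tnth y).
Proof.
have tE : tnth (afft q w y) = fun i => q * tnth y i + w i by apply/funext => i; rewrite tnth_afft.
have -> : affw q w y = (sqn (tnth y) - sqn (fun i => q * tnth y i + w i)) / 2.
  by rewrite /affw -mulr_suml /sqn sumrB.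
rewrite /hm /sqt tE qform_aff sqn_aff qs /gexp exprMn bN_sqr.
move: (cross _ _ _) (qform J w) (qform J _) (sprod _ _) (sqn (tnth y)) (sqn w) (bN _ _) => c A B p T W b.
by rewrite !invfM; move: (N%:R^-1) => n; rewrite -qs; field.
Qed.

End shifted_exponent.

Lemma bmN d (Z : measurableType d) (R : realType) (f : Z -> R) : bm f -> bm (fun z => - f z).
Proof. by move=> bf; under eq_fun do rewrite -mulN1r; exact: bmZ. Qed.

Lemma ler_exchange_terms (R : realFieldType) (a b c d e : R) :
  a <= b + c -> e + (d - b) - c <= e + d - a.
Proof. lra. Qed.

Section band_gibbs.
Variable R : realType.
Local Notation gT := (@gaussT R).
Variables (beta lambda : R) (N : nat) (s rho eps : R).
Hypothesis beta0 : 0 < beta.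
Hypothesis N0 : (0 < N)%N.
Hypothesis s0 : 0 < s.
Hypothesis rh0 : 0 <= rho.
Hypothesis eps0 : 0 < eps.
Hypothesis epsN : 4 / eps ^+ 2 <= N%:R.
Implicit Types (J : (N * N).-tuple R) (y : N.-tuple R) (w : 'I_N -> R).
Let Np : 0 < N%:R :> R. Proof. by rewrite ltr0n. Qed.
Let q := Num.sqrt s.
Let q0 : 0 < q. Proof. by rewrite sqrtr_gt0. Qed.
Let qs : q ^+ 2 = s. Proof. by rewrite sqr_sqrtr// ltW. Qed.
Local Notation bb := (@band R N eps).
Local Notation b1 := (s * bN beta N).

(** Equal to y on the band and to 0 outside, so that all observables are bounded everywhere and not
    merely where the weight is nonzero. *)
Definition uv y (i : 'I_N) : R := bb y * tnth y i.
Definition cb (k : 'I_(N * N)) y : R := b1 * (uv y (rw k) * uv y (cl k)).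

Lemma band_neq0 y : bb y != 0 -> [/\ bb y = 1, uv y = tnth y & `|sqn (uv y) - N%:R| <= eps * N%:R].
Proof.
rewrite /uv /band; case: ifP => [h _|_]; last by rewrite eqxx.
have -> : (fun i => 1 * tnth y i) = tnth y by apply/funext => i; rewrite mul1r.
by split.
Qed.

Lemma sqn_uv y : sqn (uv y) <= (1 + eps) * N%:R.
Proof.
have h0 : 0 <= (1 + eps) * N%:R by rewrite mulr_ge0// addr_ge0// ltW.
have [/eqP b0|/band_neq0[_ _ h]] := boolP (bb y == 0).
  by rewrite /sqn big1// => i _; rewrite /uv b0 mul0r expr0n.
by have := le_trans (ler_norm _) h; rewrite lerBlDr mulrDl mul1r addrC.
Qed.

Let b1_ge0 : 0 <= b1. Proof. by rewrite mulr_ge0 ?bN_ge0// ltW. Qed.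

Let D := b1 * ((1 + eps) * N%:R).
Let D0 : 0 <= D. Proof. by rewrite mulr_ge0// mulr_ge0// addr_ge0// ltW. Qed.

Let bm_uv i : bm (fun y => uv y i).
Proof.
split; first by apply: measurable_funM; [exact: (bm_band N eps).1|exact: measurable_tnth].
exists (1 + (1 + eps) * N%:R); first by rewrite addr_ge0// mulr_ge0// addr_ge0// ltW.
move=> y; have := le_trans (sqr_le_sqn (uv y) i) (sqn_uv y).
rewrite -(real_normK (num_real (uv y i))); move: (`|_|) (normr_ge0 (uv y i)) => x x0 h.
have [x1|x1] := leP x 1.
  by rewrite (le_trans x1)// lerDl mulr_ge0// addr_ge0// ltW.
by rewrite (le_trans _ (le_trans h _)) ?lerDr// expr2 ler_peMl// ltW.
Qed.

Let mc k : measurable_fun setT (cb k).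
Proof. by have [] := bmZ b1 (bmM (bm_uv (rw k)) (bm_uv (cl k))). Qed.

Let cD k y : `|cb k y| <= D.
Proof.
rewrite /cb normrM (ger0_norm b1_ge0) ler_wpM2l//.
exact: le_trans (mul_le_sqn (uv y) _ _) (sqn_uv y).
Qed.

Let brho : bm bb := bm_band N eps.
Let rho0 y : 0 <= bb y := band_ge0 eps y.
Let rho_gt0 : 0 < \int[gT N]_y bb y.
Proof. by rewrite (lt_le_trans _ (band_ge_half eps0 epsN))// divr_gt0. Qed.

Let one : 'I_(N * N) -> R := fun=> 1.
Let avb J := av (gT N) bb cb one J.

Let bm_sqn : bm (fun y => sqn (uv y)).
Proof. by apply: bm_sum => i; apply: bmX. Qed.
Let bm_sprod w : bm (fun y => sprod (uv y) w).
Proof. by apply: bm_sum => i; apply: bmM => //; exact: bm_cst. Qed.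
Let bm_cross J w : bm (fun y => cross J (uv y) w).
Proof.
apply: bm_sum => k; apply: bmZ; apply: bmD; apply: bmM => //; exact: bm_cst.
Qed.

Let bm_gexp J w : bm (fun y => gexp beta lambda s q J w (uv y)).
Proof.
have c (x : R) : bm (fun=> x : R) by exact: bm_cst.
have t1 := bm_sqn; have t2 := bm_sprod w; have t3 := bm_cross J w.
rewrite /gexp; repeat (first [exact: t1|exact: t2|exact: t3|exact: c|apply: bmN|apply: bmD|apply: bmX|apply: bmM]).
Qed.

Let bm_geven J w : bm (fun y => geven beta lambda s J w (uv y)).
Proof.
have c (x : R) : bm (fun=> x : R) by exact: bm_cst.
have t1 := bm_sqn; have t2 := bm_sprod w.
rewrite /geven; repeat (first [exact: t1|exact: t2|exact: c|apply: bmN|apply: bmD|apply: bmX|apply: bmM]).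
Qed.

Let ham_band J y : bb y != 0 -> ham cb one J y =
  b1 * qform J (tnth y) - b1 ^+ 2 / 2 * sqn (tnth y) ^+ 2.
Proof.
move=> /band_neq0[_ uE _]; rewrite /ham sumrB /qform mulr_sumr -sum_prod_sqr mulr_sumr.
congr (_ - _); apply: eq_bigr => k _; rewrite /one /cb uE; last by rewrite exprMn; ring.
by ring.
Qed.

(** Change variables to z = q y + w, discard the y outside the band, where the integrand is
    nonnegative, and apply Jensen's inequality to the Gibbs measure of the y-Hamiltonian. *)
Let Zr_shift J w :
  q ^+ N * (Zf (gT N) bb cb one J * expR (avb J (fun y => gexp beta lambda s q J w (uv y)))) <= Zr beta lambda J.
Proof.
have Z0 := @Zf_gt0 _ _ _ (gT N) _ _ _ D D0 brho rho0 rho_gt0 mc cD one J.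
have bg := bm_gexp J w.
have := @av_jensen _ _ _ (gT N) _ _ _ D D0 brho rho0 rho_gt0 mc cD one J _ bg.
rewrite -/(avb J) => hj.
have be : bm (fun y => q ^+ N * (expR (gexp beta lambda s q J w (uv y)) * wgt bb cb one J y)).
  by apply: bmZ; apply: bmM; [exact: bm_exp|exact: (bm_wgt D0 brho mc cD)].
apply: (@le_trans _ _ (\int[gT N]_y (q ^+ N * (expR (gexp beta lambda s q J w (uv y)) * wgt bb cb one J y)))).
  rewrite bIZ; last by apply: bmM; [exact: bm_exp|exact: (bm_wgt D0 brho mc cD)].
  rewrite ler_pM2l ?exprn_gt0// mulrC.
  by move: hj; rewrite /av ler_pdivlMr.
have bh := bm_exp_hm lambda beta0 N0 J.
rewrite -lee_fin /Zr /Rintegral fineK; last by apply: integrable_fin_num => //; exact: bm_integrable.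
rewrite fineK; last by apply: integrable_fin_num => //; exact: bm_integrable.
rewrite [in leRHS](gaussT_aff (f := fun z => (expR (hm beta lambda J z))%:E) w q0); last 2 first.
- by apply/measurable_EFinP; exact: bh.1.
- by move=> z; rewrite lee_fin expR_ge0.
apply: ge0_le_integral => //.
- by move=> y _; rewrite lee_fin mulr_ge0 ?exprn_ge0 ?(ltW q0)// mulr_ge0 ?expR_ge0// wgt_ge0.
- by apply/measurable_EFinP; exact: be.1.
- apply/measurable_EFinP; apply: measurable_funM; last first.
    by apply: measurable_funM => //; apply: (measurableT_comp (@measurable_expR _)); exact: measurable_affw.
  by apply: (measurableT_comp bh.1); exact: measurable_afft.
move=> y _; rewrite -EFinM lee_fin.
have [b0|b0] := boolP (bb y == 0).
  rewrite /wgt (eqP b0) mul0r !mulr0 !mulr_ge0 ?expR_ge0// exprn_ge0// ltW//.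
have [bE uE _] := band_neq0 b0.
rewrite /wgt bE mul1r (ham_band J b0) uE -expRD [leRHS]mulrCA ler_wpM2l ?exprn_ge0 ?(ltW q0)//.
by rewrite -expRD ler_expR (shift_exponent beta lambda qs J w y) addrC.
Qed.

Let lnZr_shift J w : N%:R * ln q + ln (Zf (gT N) bb cb one J) +
  avb J (fun y => gexp beta lambda s q J w (uv y)) <= ln (Zr beta lambda J).
Proof.
have Z0 := @Zf_gt0 _ _ _ (gT N) _ _ _ D D0 brho rho0 rho_gt0 mc cD one J.
have qN : 0 < q ^+ N by rewrite exprn_gt0.
have := Zr_shift J w; rewrite -ler_ln ?posrE ?Zr_gt0//; last by rewrite !mulr_gt0 ?expR_gt0.
by rewrite lnM ?posrE ?mulr_gt0 ?expR_gt0// lnM ?posrE ?expR_gt0// expRK lnXn// mulr_natl addrA.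
Qed.

Let lnZr_even J w : N%:R * ln q + ln (Zf (gT N) bb cb one J) +
  avb J (fun y => geven beta lambda s J w (uv y)) <= ln (Zr beta lambda J).
Proof.
have h1 := lnZr_shift J w; have h2 := lnZr_shift J (fun i => - w i).
have : avb J (fun y => gexp beta lambda s q J w (uv y)) +
    avb J (fun y => gexp beta lambda s q J (fun i => - w i) (uv y)) =
    2 * avb J (fun y => geven beta lambda s J w (uv y)).
  rewrite -(avD (gT N) D0 brho mc cD)// -(avZ (gT N) D0 brho mc cD)//; congr (av _ _ _ _ _ _).
  by apply/funext => y; rewrite gexp_even.
move: h1 h2; move: (avb J _) (avb J _) (avb J _) => x y z h1 h2 h3.
by have := lerD h1 h2; lra.
Qed.

(** The coefficient of |y|^2 / 2 in the even exponent when |w|^2 = N rho. Its sign is not fixed, so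
    the band width enters [cst0] through its absolute value. *)
Let kk := 1 - (1 - lambda) * s - beta ^+ 2 * s * rho.
Let cst0 := - (beta ^+ 2 / 4 * (N%:R * rho ^+ 2)) - (1 - lambda) / 2 * (N%:R * rho) + (kk - `|kk| * eps) / 2 * N%:R.
Definition ovl J : R := \sum_k avb J (cb k) ^+ 2.

Let b1_gt0 : 0 < b1.
Proof. by rewrite mulr_gt0// /bN divr_gt0// sqrtr_gt0 mulr_gt0. Qed.

(** The average of (y.w)^2 pairs w w^T with the averaged matrix y y^T. Young's inequality with
    weight t separates the deterministic norm of w from the overlap, which will be small in mean. *)
Let sprod_av J w (t : R) : 0 < t -> sqn w = N%:R * rho ->
  avb J (fun y => sprod (uv y) w ^+ 2) <=
  ((N%:R * rho) ^+ 2 / t + t * (ovl J / b1 ^+ 2)) / 2.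
Proof.
move=> t0 wN.
have bu k : bm (fun y => uv y (rw k) * uv y (cl k)) by exact: bmM.
have -> : avb J (fun y => sprod (uv y) w ^+ 2) =
    \sum_k (w (rw k) * w (cl k)) * avb J (fun y => uv y (rw k) * uv y (cl k)).
  rewrite /avb; transitivity (av (gT N) bb cb one J (fun y => \sum_k (w (rw k) * w (cl k)) * (uv y (rw k) * uv y (cl k)))).
    by congr (av _ _ _ _ _ _); apply/funext => y; exact: sprod_sqr.
  rewrite (@av_sum _ _ _ (gT N) _ _ _ D D0 brho rho0 rho_gt0 mc cD); last by move=> k; exact: bmZ.
  by apply: eq_bigr => k _; rewrite (avZ (gT N) D0 brho mc cD).
have -> : ovl J / b1 ^+ 2 = \sum_k avb J (fun y => uv y (rw k) * uv y (cl k)) ^+ 2.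
  rewrite /ovl mulr_suml; apply: eq_bigr => k _; rewrite /avb /cb (avZ (gT N) D0 brho mc cD)//.
  by rewrite exprMn mulrAC mulfV ?mul1r// gt_eqF// exprn_gt0.
rewrite -wN -sum_prod_sqr mulr_suml mulr_sumr -big_split/= mulr_suml.
apply: ler_sum => k _; move: (w _ * w _) (avb J _) => a c.
have -> : (a ^+ 2 / t + t * c ^+ 2) / 2 = a * c + t / 2 * (a / t - c) ^+ 2 by field; rewrite gt_eqF.
by rewrite lerDl mulr_ge0 ?sqr_ge0// divr_ge0// ltW.
Qed.

Let geven_ge J w y : sqn w = N%:R * rho -> bb y != 0 ->
  (bN beta N * qform J w + cst0) - (beta ^+ 2 * s / N%:R) * sprod (uv y) w ^+ 2 <=
  geven beta lambda s J w (uv y).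
Proof.
move=> wN /band_neq0[_ _ h].
have hk : (kk - `|kk| * eps) * N%:R <= kk * sqn (uv y).
  have : `|kk * (sqn (uv y) - N%:R)| <= `|kk| * (eps * N%:R) by rewrite normrM ler_wpM2l.
  rewrite ler_norml => /andP[+ _]; move: (sqn _) (`|kk|) kk => T a k; lra.
rewrite -subr_ge0 /geven /cst0 wN.
have -> : bN beta N * qform J w -
     beta ^+ 2 / (4 * N%:R) * (2 * s * sqn (uv y) * (N%:R * rho) + (N%:R * rho) ^+ 2 + 4 * s * sprod (uv y) w ^+ 2) -
     (1 - lambda) / 2 * (s * sqn (uv y) + N%:R * rho) + sqn (uv y) / 2 -
     (bN beta N * qform J w + (- (beta ^+ 2 / 4 * (N%:R * rho ^+ 2)) - (1 - lambda) / 2 * (N%:R * rho) +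
         (kk - `|kk| * eps) / 2 * N%:R) - beta ^+ 2 * s / N%:R * sprod (uv y) w ^+ 2) =
     (kk * sqn (uv y) - (kk - `|kk| * eps) * N%:R) / 2.
  move: (`|kk|) (sqn (uv y)) (sprod _ _) (bN _ _ * _) => ak T p B; rewrite /kk; field; by rewrite gt_eqF.
by rewrite divr_ge0// subr_ge0.
Qed.

Let cst1 := cst0 - beta ^+ 2 * s * rho ^+ 2 / 2 * Num.sqrt N%:R.

Let lnZr_vec J w : sqn w = N%:R * rho ->
  N%:R * ln q + ln (Zf (gT N) bb cb one J) + bN beta N * qform J w + cst1 -
    Num.sqrt N%:R / s * ovl J <= ln (Zr beta lambda J).
Proof.
move=> wN; apply: le_trans (lnZr_even J w).
rewrite (_ : _ - _ = N%:R * ln q + ln (Zf (gT N) bb cb one J) + (bN beta N * qform J w + cst1 -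
    Num.sqrt N%:R / s * ovl J)); last by rewrite !addrA.
rewrite lerD2l.
have bs : bm (fun y => sprod (uv y) w ^+ 2) by exact: bmX.
have bc (c : R) : bm (fun _ : N.-tuple R => c) by exact: bm_cst.
have := @av_le _ _ _ (gT N) _ _ _ D D0 brho rho0 rho_gt0 mc cD one J _ _ (bmB (bc (bN beta N * qform J w + cst0)) (bmZ (beta ^+ 2 * s / N%:R) bs)) (bm_geven J w) (fun y => geven_ge J wN).
apply: le_trans.
rewrite (avB (gT N) D0 brho mc cD)//; last exact: bmZ.
rewrite (avZ (gT N) D0 brho mc cD)// (@av1 _ _ _ (gT N) _ _ _ D D0 brho rho0 rho_gt0 mc cD).
have S0 : 0 < Num.sqrt N%:R :> R by rewrite sqrtr_gt0.
have S2 : Num.sqrt N%:R ^+ 2 = N%:R :> R by rewrite sqr_sqrtr.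
(* After multiplication by beta^2 s / N the two Young terms are of order N / t and t times an
   overlap of bounded mean; t = sqrt(N) makes both of order sqrt(N). *)
have := @sprod_av J w (Num.sqrt N%:R) S0 wN; rewrite -/(avb J).
have bs0 : 0 <= beta ^+ 2 * s / N%:R by rewrite divr_ge0// mulr_ge0 ?sqr_ge0// ltW.
move=> /(ler_wpM2l bs0) h.
have h' : beta ^+ 2 * s / N%:R * avb J (fun y => sprod (uv y) w ^+ 2) <=
    beta ^+ 2 * s * rho ^+ 2 / 2 * Num.sqrt N%:R + Num.sqrt N%:R / s * ovl J; last first.
  exact: ler_exchange_terms.
apply: (le_trans h); apply: eq_lerR.
rewrite (exprMn 2 s) bN_sqr; clear h; move: S0 S2; move: (Num.sqrt N%:R) (ovl J) => S O S0 S2; rewrite -S2.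
by field; rewrite !gt_eqF.
Qed.

Definition ord00 : 'I_(N * N) := pr (Ordinal N0) (Ordinal N0).

(** Rescale a near-maximizer of the Rayleigh quotient to squared norm N rho. The term in |J_00|
    covers the case where the near-maximizer is the null vector. *)
Let near_top J : exists2 w, sqn w = N%:R * rho &
  N%:R * rho * (Lam J - 1 - `|tnth J ord00|) <= qform J w.
Proof.
have Nr : 0 <= N%:R * rho by rewrite mulr_ge0.
have [a ha] := Lam_adherent J (@ltr01 R).
(* For a null near-maximizer [Lam] J is below 1, so Lam J - 1 - |J_00| is below J_00, the Rayleigh
   quotient of the first coordinate vector. *)
have [v0|v0] := eqVneq (sqn (@intvec R N a)) 0.
  exists (fun i => Num.sqrt (N%:R * rho) * (i == Ordinal N0)%:R).
    rewrite sqnZ sqr_sqrtr// /sqn (bigD1 (Ordinal N0))//= ?eqxx expr1n big1 ?addr0 ?mulr1//.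
    by move=> i /negbTE ->; rewrite expr0n.
  rewrite qformZ sqr_sqrtr// ler_wpM2l//.
  rewrite qformE (bigD1 (Ordinal N0))//= [X in _ <= _ + X]big1; last first.
    by move=> i /negbTE ->; rewrite big1// => j _; rewrite mulr0 mul0r.
  rewrite (bigD1 (Ordinal N0))//= [X in _ <= _ + X + _]big1; last first.
    by move=> j /negbTE ->; rewrite mulr0.
  rewrite ?eqxx !mulr1 !addr0 -/ord00.
  move: ha; rewrite /rayleigh v0 invr0 mulr0 => ha.
  have h1 : - `|tnth J ord00| <= tnth J ord00 by rewrite lerNl -normrN ler_norm.
  by apply: le_trans h1; rewrite lerBlDr addNr; apply: ltW.
have v1 : 0 < sqn (@intvec R N a) by rewrite lt0r v0 sqn_ge0.
have h0 : 0 <= N%:R * rho / sqn (@intvec R N a) by rewrite divr_ge0// ltW.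
exists (fun i => Num.sqrt (N%:R * rho / sqn (@intvec R N a)) * (@intvec R N a) i).
  by rewrite sqnZ sqr_sqrtr// mulfVK.
rewrite qformZ sqr_sqrtr//.
rewrite [leRHS](_ : _ = N%:R * rho * rayleigh J (@intvec R N a)); last by rewrite /rayleigh; ring.
rewrite ler_wpM2l//.
by move: ha; have := normr_ge0 (tnth J ord00); move: (`|_|) (Lam J) (rayleigh _ _) => x y z; lra.
Qed.

(** The vector w is chosen for each J separately and no longer appears here, so its measurability in
    J never comes into question. *)
Let lnZr_ge J : N%:R * ln q + ln (Zf (gT N) bb cb one J) +
    bN beta N * (N%:R * rho * (Lam J - 1 - `|tnth J ord00|)) + cst1 - Num.sqrt N%:R / s * ovl J
  <= ln (Zr beta lambda J).
Proof.
have [w wN h] := near_top J; apply: le_trans (lnZr_vec J wN).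
by rewrite lerD2r lerD2r lerD2l ler_wpM2l// bN_ge0.
Qed.

Let tame_avc k : tame (fun J => avb J (cb k) ^+ 2).
Proof.
apply: tameX; apply: (@tame_av _ _ _ (gT N) _ _ _ D D0 brho rho0 rho_gt0 mc cD one).
by apply: bmZ; exact: bmM.
Qed.

(** The constant 2 subtracted from the mean of [Lam] is the slack 1 of the near-maximizer plus the
    bound 1 on the mean of |J_00|. *)
Lemma E_lnZr_ge :
  N%:R * ln q + free (gT N) bb cb (fun=> 1) +
    bN beta N * (N%:R * rho * (\int[gT (N * N)]_J Lam J - 2)) + cst1 -
    Num.sqrt N%:R / s * overlap2 (gT N) bb cb 1 <= \int[gT (N * N)]_J ln (Zr beta lambda J).
Proof.
have tz := @tame_lnZf _ _ _ (gT N) _ _ _ D D0 brho rho0 rho_gt0 mc cD one.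
have tl := @tame_Lam R N.
have ta : tame (fun J => `|tnth J ord00|) by apply: tame_norm; exact: tame_tnth.
have to : tame ovl by exact: tame_sum.
have c1 (c : R) : tame (fun _ : (N * N).-tuple R => c) by exact: tame_cst.
have t1 : tame (fun J => Lam J - 1 - `|tnth J ord00|) by apply: tameB => //; exact: tameB.
have Ea : \int[gT (N * N)]_J `|tnth J ord00| <= 1.
  apply: (@le_trans _ _ (\int[gT (N * N)]_J (2^-1 * (1 + tnth J ord00 ^+ 2)))).
    have t2 : tame (fun J : (N * N).-tuple R => tnth J ord00 ^+ 2) by apply: tameX; exact: tame_tnth.
    apply: E_le => //; first by apply: tameZ; exact: tameD.
    move=> J; rewrite -(real_normK (num_real (tnth J ord00))).
    have := sqr_ge0 (`|tnth J ord00| - 1); move: (`|_|) => x; nra.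
  have t2 : tame (fun J : (N * N).-tuple R => tnth J ord00 ^+ 2) by apply: tameX; exact: tame_tnth.
  by rewrite EZ ?ED ?EC ?E_tnth_sqr//; [apply: eq_lerR; field|exact: tameD].
have El : \int[gT (N * N)]_J Lam J - 2 <= \int[gT (N * N)]_J (Lam J - 1 - `|tnth J ord00|).
  rewrite EB// ?EB// ?EC//; last exact: tameB.
  by move: Ea; move: (\int[_]_J `|_|) (\int[_]_J Lam J) => x y; lra.
set bL := bN beta N * (N%:R * rho).
have bL0 : 0 <= bL by apply: mulr_ge0; [exact: bN_ge0|exact: mulr_ge0].
have tb : tame (fun J => bL * (Lam J - 1 - `|tnth J ord00|)) by exact: tameZ.
have t3 : tame (fun J => N%:R * ln q + ln (Zf (gT N) bb cb one J) + bL * (Lam J - 1 - `|tnth J ord00|) + cst1 - Num.sqrt N%:R / s * ovl J).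
  by apply: tameB; [apply: tameD => //; apply: tameD => //; exact: tameD|exact: tameZ].
apply: (@le_trans _ _ (\int[gT (N * N)]_J (N%:R * ln q + ln (Zf (gT N) bb cb one J) + bL * (Lam J - 1 - `|tnth J ord00|) + cst1 - Num.sqrt N%:R / s * ovl J))).
  rewrite EB; [|by apply: tameD => //; apply: tameD => //; exact: tameD|exact: tameZ].
  rewrite ED//; last by apply: tameD => //; exact: tameD.
  rewrite ED//; last exact: tameD.
  rewrite ED// !EC !EZ//.
  have -> : \int[gT (N * N)]_J ovl J = overlap2 (gT N) bb cb 1 by rewrite /ovl E_sum.
  by rewrite lerD2r lerD2r lerD2l mulrA ler_wpM2l.
apply: E_le => //; first exact: tame_lnZr.
by move=> J; apply: le_trans (lnZr_ge J); rewrite /bL -(mulrA (bN beta N)).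
Qed.

(** The interaction of the two replicas is K (beta s)^2 (y.z)^2 / (2 N). Dropping the band in z
    leaves a gaussian integral depending on |y|^2 only, which is at most (1 + eps) N; the resulting
    bound does not depend on N. *)
Lemma coupled_band_le K : 0 <= K -> K * (beta * s) ^+ 2 * (1 + eps) < 1 ->
  coupled (gT N) bb cb K <= (Num.sqrt (1 - K * (beta * s) ^+ 2 * (1 + eps)))^-1.
Proof.
move=> K0 hK; set C := (Num.sqrt _)^-1.
have C0 : 0 <= C by rewrite invr_ge0 sqrtr_ge0.
have bl (f : N.-tuple R -> R) : bm f -> bm (fun p : N.-tuple R * N.-tuple R => f p.1).
  move=> [mf [B B0 fB]]; split; last by exists B.
  by apply: measurableT_comp => //; exact: measurable_fst.
have br (f : N.-tuple R -> R) : bm f -> bm (fun p : N.-tuple R * N.-tuple R => f p.2).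
  move=> [mf [B B0 fB]]; split; last by exists B.
  by apply: measurableT_comp => //; exact: measurable_snd.
have bc k : bm (cb k) by apply: bmZ; exact: bmM.
have bi : bm (fun p : N.-tuple R * N.-tuple R => bb p.1 * bb p.2 * expR (K * cdot cb p.1 p.2)).
  apply: bmM; first by apply: bmM; [exact: bl|exact: br].
  apply: bm_exp; apply: bmZ; apply: bm_sum => k; apply: bmM; [exact: bl|exact: br].
have bi1 y : bm (fun z => bb y * bb z * expR (K * cdot cb y z)).
  have [m [B B0 hB]] := bi; split; last by exists B => // z; exact: (hB (y, z)).
  by apply: (measurableT_comp m (g := fun z => (y, z))); exact: measurable_pair1.
rewrite /coupled mu2_iter// -[leRHS](bIC (gT N)); apply: bI_le; [|exact: bm_cst|].
  exact: (bm_param (gT N) bi).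
move=> y /=; have [/eqP y0|y0] := boolP (bb y == 0).
  by under eq_Rintegral do rewrite y0 !mul0r; rewrite bIC.
have [y1 uy hy] := band_neq0 y0.
set th := K * (beta * s) ^+ 2 / N%:R.
have th0 : 0 <= th by rewrite divr_ge0// mulr_ge0// sqr_ge0.
have tT : th * sqt y <= K * (beta * s) ^+ 2 * (1 + eps).
  have : sqt y <= (1 + eps) * N%:R by rewrite /sqt -uy sqn_uv.
  move=> /(ler_wpM2l th0) /le_trans; apply; apply: eq_lerR.
  by rewrite /th; field; rewrite gt_eqF.
have hC : (Num.sqrt (1 - th * sqt y))^-1 <= C.
  rewrite /C lef_pV2 ?posrE ?sqrtr_gt0 ?subr_gt0//; last exact: le_lt_trans tT hK.
  by apply: ler_wsqrtr; rewrite lerD2l lerN2.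
apply: le_trans hC; rewrite -lee_fin -(gaussT_exp_dot_sqr th0 (le_lt_trans tT hK)).
rewrite /Rintegral fineK; last by apply: integrable_fin_num => //; exact: bm_integrable.
apply: ge0_le_integral => //.
- by move=> z _; rewrite lee_fin mulr_ge0 ?expR_ge0// mulr_ge0.
- by apply/measurable_EFinP; exact: (bi1 y).1.
- apply/measurable_EFinP; apply: (measurableT_comp (@measurable_expR _)).
  have md := measurable_dot y; by meas.
move=> z _; rewrite lee_fin y1 mul1r.
have [/eqP z0|z0] := boolP (bb z == 0); first by rewrite z0 mul0r expR_ge0.
have [z1 uz _] := band_neq0 z0; rewrite z1 mul1r; apply: eq_lerR; congr expR.
have -> : cdot cb y z = b1 ^+ 2 * dot y z ^+ 2.
  rewrite /cdot /dot expr2 [X in _ * X]mulr_suml mulr_sumr sum_pr; apply: eq_bigr => i _.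
  rewrite mulr_sumr mulr_sumr; apply: eq_bigr => j _; rewrite /cb rw_pr cl_pr uy uz; ring.
rewrite (exprMn 2 s) bN_sqr /th; move: (dot y z) => x; field.
by rewrite gt_eqF.
Qed.

(** Both bounds are independent of N: in the subcritical regime the annealed free energy is exact up
    to O(1), and the total overlap is O(1). *)
Lemma band_overlap_free K (C := (Num.sqrt (1 - K * (beta * s) ^+ 2 * (1 + eps)))^-1) :
  1 < K -> K * (beta * s) ^+ 2 * (1 + eps) < 1 ->
  - ((ln C / 2 + K * ln 2) / (K - 1)) <= free (gT N) bb cb (fun=> 1) /\
  overlap2 (gT N) bb cb 1 <= 2 * ((ln C / 2 + ln 2) * K) / (K - 1) / (K - 1).
Proof.
move=> K1 hK; have Kp : 0 < K - 1 by rewrite subr_gt0.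
have K0 : 0 < K by rewrite (lt_trans ltr01).
have cp := @coupled_gt0 _ _ _ (gT N) _ _ _ D D0 brho rho0 rho_gt0 mc cD K.
have C0 : 0 < C by rewrite invr_gt0 sqrtr_gt0 subr_gt0.
have hB : ln (coupled (gT N) bb cb K) <= ln C.
  by rewrite ler_ln ?posrE//; exact: coupled_band_le (ltW K0) hK.
have hr : - ln 2 <= ln (\int[gT N]_y bb y).
  rewrite -lnV ?posrE// ler_ln ?posrE ?invr_gt0//.
  by have := band_ge_half eps0 epsN; rewrite mul1r.
have := @free_lower _ _ _ (gT N) _ _ _ D D0 brho rho0 rho_gt0 mc cD K K1.
have := @overlap2_le _ _ _ (gT N) _ _ _ D D0 brho rho0 rho_gt0 mc cD K K1.
move: hB hr; move: (ln (coupled _ _ _ _)) (ln (\int[_]_y _)) (ln C) (free _ _ _ _) (overlap2 _ _ _ _) (ln 2) => B l c f o l2 hB hr ho hf.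
split.
  rewrite lerNl ler_pdivlMr//.
  have : (B / 2 - l) * K <= (B / 2 + l2) * K by rewrite ler_wpM2r ?(ltW K0)//; lra.
  move: hf; nra.
apply: (le_trans ho); rewrite ler_pM2r ?invr_gt0// ler_pM2r ?invr_gt0// ler_pM2l// ler_pM2r//.
lra.
Qed.

End band_gibbs.

(** Leaves room for a coupling K = 1 + e strictly above 1 and a band of width e while the annealed
    integral stays finite, where t stands for (beta s)^2 and e = (1 - t) / 4. *)
Lemma coupling_margin (R : realFieldType) (t : R) : t < 1 ->
  (1 + (1 - t) / 4) * t * (1 + (1 - t) / 4) < 1.
Proof.
move=> t1; have u0 : 0 < 1 - t by rewrite subr_gt0.
rewrite -subr_gt0; have -> : 1 - (1 + (1 - t) / 4) * t * (1 + (1 - t) / 4) =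
  (1 - t) / 2 + 7 / 16 * (1 - t) ^+ 2 + (1 - t) ^+ 3 / 16 by field.
by rewrite !addr_gt0 ?divr_gt0 ?mulr_gt0 ?divr_gt0 ?exprn_gt0.
Qed.

(** * Asymptotics of the lower bound and the limit of the free energy *)

Section lower_asymptotics.
Variable R : realType.
Local Notation gT := (@gaussT R).
Variables (beta lambda : R).
Hypothesis beta0 : 0 < beta.

(** Per site: the Jacobian gives ln s / 2, the form on the top direction beta rho, the terms in
    |w|^2 = N rho the next two, and |y|^2 close to N the last one. *)
Definition LB (s rho : R) : R := ln s / 2 + beta * rho - beta ^+ 2 / 4 * rho ^+ 2
  - (1 - lambda) / 2 * rho + (1 - (1 - lambda) * s - beta ^+ 2 * s * rho) / 2.

Lemma ln_sqrt (s : R) : 0 < s -> ln (Num.sqrt s) = ln s / 2.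
Proof.
move=> s0; have q0 : 0 < Num.sqrt s by rewrite sqrtr_gt0.
have : ln s = ln (Num.sqrt s ^+ 2) by rewrite sqr_sqrtr// ltW.
by rewrite lnXn// mulr2n => ->; field.
Qed.

Lemma sub_linear_error (A B e : R) : 0 < e ->
  exists N1, forall N, (N1 <= N)%N -> A + Num.sqrt N%:R * B <= N%:R * e.
Proof.
move=> e0; exists (Num.trunc (((`|A| + `|B|) / e) ^+ 2)).+1.+1 => N hN.
have N1 : 1 <= Num.sqrt N%:R :> R.
  by rewrite -[X in X <= _]sqrtr1 ler_wsqrtr// ler1n (leq_trans _ hN).
have h : (`|A| + `|B|) / e <= Num.sqrt N%:R.
  have h0 : 0 <= (`|A| + `|B|) / e by rewrite divr_ge0 ?addr_ge0// ltW.
  rewrite -(ger0_norm h0) -sqrtr_sqr ler_wsqrtr// (le_trans (ltW (truncnS_gt _)))// ler_nat//.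
  exact: leq_trans hN.
have -> : N%:R * e = Num.sqrt N%:R * (Num.sqrt N%:R * e) by rewrite mulrA -expr2 sqr_sqrtr.
move: h; rewrite ler_pdivrMr// => h.
apply: (@le_trans _ _ (Num.sqrt N%:R * (`|A| + `|B|))); last by rewrite ler_wpM2l// sqrtr_ge0.
rewrite mulrDr lerD//.
  by rewrite (le_trans (ler_norm _))// ler_peMl.
by rewrite ler_wpM2l ?sqrtr_ge0// ler_norm.
Qed.

Lemma bN_scale N : (0 < N)%N -> bN beta N * N%:R * Num.sqrt (2 * N%:R) = beta * N%:R.
Proof.
move=> N0; rewrite /bN; have S0 : 0 < Num.sqrt (2 * N%:R) :> R by rewrite sqrtr_gt0 mulr_gt0 ?ltr0n.
by field; rewrite gt_eqF.
Qed.

Lemma bN_scale_le N : (0 < N)%N -> bN beta N * N%:R <= beta * Num.sqrt N%:R.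
Proof.
move=> N0; have Np : 0 < N%:R :> R by rewrite ltr0n.
have S0 : 0 < Num.sqrt (2 * N%:R) :> R by rewrite sqrtr_gt0 mulr_gt0.
rewrite -(ler_pM2r S0) bN_scale// -mulrA ler_wpM2l ?(ltW beta0)//.
rewrite -sqrtrM ?(ltW Np)// mulrCA -expr2 sqrtrM// sqrtr_sqr (ger0_norm (ltW Np)).
rewrite ler_peMl//.
by rewrite -[X in X <= _]sqrtr1 ler_wsqrtr// ler1n.
Qed.

(** The loss eta is divided in four: the deficit of the mean eigenvalue, the band width, the terms
    of order 1 and sqrt(N), and one spare quarter. *)
Lemma E_lnZr_lower (s rho eta : R) : 0 < s -> beta * s < 1 -> 0 <= rho -> 0 < eta ->
  exists N1, forall N, (N1 <= N)%N -> (0 < N)%N ->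
    N%:R * (LB s rho - eta) <= \int[gT (N * N)]_J ln (Zr beta lambda J).
Proof.
move=> s0 bs1 rh0 eta0.
set kk := 1 - (1 - lambda) * s - beta ^+ 2 * s * rho.
have bs0 : 0 < beta * s by rewrite mulr_gt0.
set th := (beta * s) ^+ 2.
have th0 : 0 <= th by rewrite sqr_ge0.
have th1 : th < 1 by rewrite /th expr2; move: bs0 bs1; move: (beta * s) => b b0 b1; nra.
set e := (1 - th) / 4.
have e0 : 0 < e by rewrite divr_gt0 ?subr_gt0.
(* The first bound keeps the two-replica integral finite; the second limits the effect of the band
   on the coefficient of |y|^2. *)
set eps := Num.min e (eta / (2 * (`|kk| + 1))).
have k0 : 0 < `|kk| + 1 by rewrite ltr_wpDl.
have eps0 : 0 < eps by rewrite lt_min e0 divr_gt0// mulr_gt0.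
have epse : eps <= e by rewrite ge_min lexx.
have epsk : `|kk| * eps <= eta / 2.
  apply: (@le_trans _ _ ((`|kk| + 1) * (eta / (2 * (`|kk| + 1))))).
    by apply: ler_pM => //; [exact: ltW|rewrite lerDl|rewrite ge_min lexx orbT].
  by apply: eq_lerR; field; rewrite gt_eqF.
set K := 1 + e.
have K1 : 1 < K by rewrite ltrDl.
have hK : K * th * (1 + eps) < 1.
  apply: (@le_lt_trans _ _ (K * th * (1 + e))).
    by rewrite ler_wpM2l ?lerD2l// mulr_ge0// addr_ge0// ltW.
  exact: coupling_margin.
set C := (Num.sqrt (1 - K * th * (1 + eps)))^-1.
set A1 := (ln C / 2 + K * ln 2) / (K - 1).
set A2 := 2 * ((ln C / 2 + ln 2) * K) / (K - 1) / (K - 1).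
set d := eta / (4 * (beta * rho + 1)).
have br0 : 0 <= beta * rho by rewrite mulr_ge0// ltW.
have br1 : 0 < beta * rho + 1 by rewrite ltr_wpDl.
have d0 : 0 < d by rewrite divr_gt0// mulr_gt0.
have bd : beta * rho * d <= eta / 4.
  apply: (@le_trans _ _ ((beta * rho + 1) * d)); first by rewrite ler_wpM2r ?(ltW d0)// lerDl.
  by apply: eq_lerR; rewrite /d; field; rewrite gt_eqF.
have [Nl hl] := E_Lam_lower d0.
have [Ne he] := @sub_linear_error A1 (2 * (beta * rho) + beta ^+ 2 * s * rho ^+ 2 / 2 + A2 / s) (eta / 4) (divr_gt0 eta0 (ltr0n _ 4)).
exists (maxn (maxn Nl Ne) (Num.trunc (4 / eps ^+ 2)).+1) => N.
rewrite !geq_max => /andP[/andP[hNl hNe] hNeps] N0.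
have Np : 0 < N%:R :> R by rewrite ltr0n.
have epsN : 4 / eps ^+ 2 <= N%:R by rewrite (le_trans (ltW (truncnS_gt _)))// ler_nat.
have [hfree hover] := band_overlap_free beta0 N0 s0 eps0 epsN K1 hK.
have := @E_lnZr_ge R beta lambda N s rho eps beta0 N0 s0 rh0 eps0 epsN.
apply: le_trans.
rewrite -/kk -/th -/C -/A1 -/A2 in hfree hover *.
have := hl N hNl N0; set L := \int[_]_J Lam J => hL.
have := he N hNe; set S := Num.sqrt N%:R => hS.
have S0 : 0 <= S by exact: sqrtr_ge0.
rewrite ln_sqrt//.
have h1 : N%:R * (beta * rho - eta / 4) - 2 * (beta * rho) * S <= bN beta N * (N%:R * rho * (L - 2)).
  have hb := bN_scale N0; have hb2 := bN_scale_le N0.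
  have bN0 : 0 <= bN beta N * N%:R by rewrite mulr_ge0 ?bN_ge0// ltW.
  have -> : bN beta N * (N%:R * rho * (L - 2)) = rho * (bN beta N * N%:R * L) - 2 * (rho * (bN beta N * N%:R)) by ring.
  apply: lerD.
    apply: (@le_trans _ _ (rho * (beta * N%:R * (1 - d)))).
      have -> : rho * (beta * N%:R * (1 - d)) = N%:R * (beta * rho - beta * rho * d) by ring.
      by rewrite ler_wpM2l ?(ltW Np)// lerD2l lerN2.
    by rewrite ler_wpM2l// -hb -mulrA ler_wpM2l.
  rewrite lerN2 (_ : 2 * (beta * rho) * S = 2 * (rho * (beta * S))); last by ring.
  by rewrite ler_pM2l//; exact: ler_wpM2l.
have h2 : S / s * overlap2 (gT N) (@band R N eps) (cb beta s eps) 1 <= S * (A2 / s).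
  by rewrite mulrAC -mulrA ler_wpM2l// ler_wpM2r// invr_ge0 ltW.
have h3 : (kk - eta / 2) / 2 * N%:R <= (kk - `|kk| * eps) / 2 * N%:R.
  by rewrite ler_wpM2r ?(ltW Np)// ler_pM2r ?invr_gt0// lerD2l lerN2.
rewrite /LB -/kk; move: h1 h2 h3 hfree hS.
move: (bN _ _ * _) (S / s * _) (free _ _ _ _) ((kk - `|kk| * eps) / 2 * N%:R) => X O f R3 h1 h2 h3 hfree hS.
have h4 : 0 <= N%:R * (eta / 4) by rewrite mulr_ge0 ?divr_ge0// ltW.
have g1 (x y : R) : x <= y -> 0 <= y - x by rewrite subr_ge0.
rewrite -subr_ge0.
(* The difference to be shown nonnegative is exactly the sum of the slacks of these inequalities. *)
have := addr_ge0 (addr_ge0 (addr_ge0 (addr_ge0 (addr_ge0 (g1 _ _ h1) (g1 _ _ h2)) (g1 _ _ h3)) (g1 _ _ hfree)) (g1 _ _ hS)) h4.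
move=> /le_trans; apply; apply: eq_lerR; move: (ln s) => l; clearbody A1 A2 kk S.
by field; rewrite gt_eqF.
Qed.

(** At rho = Q the dependence on s is (ln s - s M) / 2, with M = max(beta, 1 - lambda), maximal at s
    = 1 / M, where [LB] equals [UB]. The factor t < 1 enforces beta s < 1 and changes the value by
    ln t / 2 + (1 - t) / 2. *)
Lemma LB_UB (Q t : R) : 0 < t -> t < 1 -> Q = qRS beta lambda ->
  UB beta lambda Q + ln t / 2 <= LB (t / Num.max beta (1 - lambda)) Q.
Proof.
move=> t0 t1 QE; set M := Num.max beta (1 - lambda).
have M0 : 0 < M by rewrite lt_max beta0.
have [vM hQ] : 1 - lambda + beta ^+ 2 * Q = M /\ (beta - (1 - lambda)) * Q = beta ^+ 2 * Q ^+ 2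
   /\ beta ^+ 2 * Q / (2 * M) = beta * Q / 2.
  rewrite QE /qRS /M; have [h|h] := leP beta (1 - lambda).
    by rewrite !mulr0 expr0n !mulr0 !mul0r addr0.
  by split; [field; rewrite gt_eqF|split; field; rewrite ?gt_eqF].
have -> : UB beta lambda Q = - (ln M / 2) + beta * Q / 2 + beta ^+ 2 / 4 * Q ^+ 2.
  rewrite /UB /sigma vM lnV ?posrE ?sqrtr_gt0// ln_sqrt//.
  by rewrite hQ.2.
have -> : LB (t / M) Q = ln t / 2 - ln M / 2 + (beta * Q - (1 - lambda) / 2 * Q - beta ^+ 2 / 4 * Q ^+ 2)
   + (1 - t / M * (1 - lambda + beta ^+ 2 * Q)) / 2.
  by rewrite /LB ln_div ?posrE//; move: (t / M) => x; field.
have -> : beta * Q - (1 - lambda) / 2 * Q = beta * Q / 2 + beta ^+ 2 * Q ^+ 2 / 2 by rewrite -hQ.1; field.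
rewrite vM divfK ?gt_eqF//; move: (ln M) (ln t) => a b.
rewrite -subr_ge0 [leRHS](_ : _ = (1 - t) / 2); last by field.
by rewrite divr_ge0// subr_ge0 ltW.
Qed.

Lemma qRS_ge0 : 0 <= qRS beta lambda.
Proof.
rewrite /qRS; have [h|h] := leP beta (1 - lambda); first exact: lexx.
by rewrite divr_ge0 ?sqr_ge0// subr_ge0 ltW.
Qed.

Lemma qRS_v : 1 - lambda + beta ^+ 2 * qRS beta lambda = Num.max beta (1 - lambda).
Proof.
rewrite /qRS; have [h|h] := leP beta (1 - lambda); first by rewrite mulr0 addr0.
by field; rewrite gt_eqF.
Qed.

Lemma AN_cvg : (fun N : nat => AN beta lambda N.+1) @ \oo --> (UB beta lambda (qRS beta lambda))%:E.
Proof.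
set Q := qRS beta lambda.
have M0 : 0 < Num.max beta (1 - lambda) by rewrite lt_max beta0.
have -> : (fun N : nat => AN beta lambda N.+1) =
    (fun N => (N.+1%:R^-1 * \int[gT (N.+1 * N.+1)]_J ln (Zr beta lambda J))%:E).
  by apply/funext => N; rewrite AN_Zr.
apply: cvg_EFin; first by near=> N.
apply/cvgrPdist_le => /= e e0.
(* The choice t = exp(- e) costs at most e / 2 in [LB_UB]; the other half of e is the error allowed
   in [E_lnZr_lower]. *)
have t0 : 0 < expR (- e) by exact: expR_gt0.
have t1 : expR (- e) < 1 by rewrite -expR0 ltr_expR oppr_lt0.
have s0 : 0 < expR (- e) / Num.max beta (1 - lambda) by rewrite divr_gt0.
have bs : beta * (expR (- e) / Num.max beta (1 - lambda)) < 1.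
  rewrite mulrA ltr_pdivrMr// mul1r (lt_le_trans (_ : _ < beta))//.
    by rewrite -[X in _ < X]mulr1 ltr_pM2l.
  by rewrite le_max lexx.
have [N1 hN1] := E_lnZr_lower s0 bs qRS_ge0 (divr_gt0 e0 (ltr0n R 2)).
near=> N.
have NN : (N1 <= N.+1)%N by near: N; exists N1 => // k /= h; exact: leqW.
have Np : 0 < N.+1%:R :> R by rewrite ltr0n.
have := hN1 N.+1 NN isT.
have := @E_lnZr_le R beta lambda N.+1 beta0 isT Q qRS_ge0 (ltac:(by rewrite qRS_v)).
rewrite -ler_pdivrMl// => hu; rewrite -ler_pdivlMl// => hl.
have := LB_UB t0 t1 (erefl Q); rewrite expRK => hLB.
move: hu hl hLB; move: (_^-1 * _) (LB _ _) (UB _ _ _) => I l u hu hl hLB.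
rewrite ler_norml; apply/andP; split.
  by rewrite lerNl opprB lerBlDr (le_trans hu)// lerDr ltW.
rewrite lerBlDr -lerBlDl (le_trans _ hl)// lerBrDr (le_trans _ hLB)//.
by apply: eq_lerR; field.
Unshelve. all: by end_near.
Qed.

End lower_asymptotics.

(** * The variational problem *)

Section order_parameter.
Variable R : realType.
Local Notation mu := (@lebesgue_measure R).
Local Notation TR := (measurableTypeR R).
Variables (beta lambda : R) (p : xpar R).
Hypothesis beta0 : 0 < beta.
Hypothesis pX : inX beta lambda p.
Local Notation Q := (xQ p).
Local Notation x := (xfun p).

Let Q0 : 0 <= Q. Proof. by case: pX. Qed.
Let v0 : 0 < 1 - lambda + beta ^+ 2 * Q. Proof. by case: pX => _ []. Qed.

Lemma xfun_ge0 t : 0 <= x t.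
Proof.
case: pX => _ [_ [_ [_ [_ [_ [hm _]]]]]].
rewrite /xfun big_nat_cond; apply: sumr_ge0 => a /andP[/andP[a1 aK] _].
by case: ifP => // _; have /andP[] : 0 <= xm p a <= 1 by apply: hm; rewrite a1.
Qed.

(** At most one piece is active at each t. The induction carries along that the partial sum vanishes
    to the right of its last breakpoint. *)
Lemma xfun_le1 t : x t <= 1.
Proof.
case: pX => _ [_ [_ [_ [_ [hq [hm _]]]]]].
suff H k : (k <= xK p)%N -> (xq p k <= t ->
    \sum_(1 <= a < k.+1) (if (xq p a.-1 <= t) && (t < xq p a) then xm p a else 0) = 0) /\
   \sum_(1 <= a < k.+1) (if (xq p a.-1 <= t) && (t < xq p a) then xm p a else 0) <= 1.
  exact: (H _ (leqnn _)).2.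
elim: k => [|k IH] kK; first by rewrite big_geq.
rewrite big_nat_recr//=; have [IH1 IH2] := IH (ltnW kK).
split => [h|].
  by rewrite IH1 ?(le_trans (hq _ kK))// [t < _]ltNge h andbF addr0.
have [h|h] := leP (xq p k) t; last by rewrite addr0.
rewrite IH1// add0r; case: ifP => // _.
by have /andP[] : 0 <= xm p k.+1 <= 1 by apply: hm.
Qed.

Lemma measurable_xfun : measurable_fun [set: TR] (x : TR -> R).
Proof.
apply: measurable_sum => a; apply: measurable_fun_ifT => //.
by apply: measurable_and; [exact: measurable_fun_ler|exact: measurable_fun_ltr].
Qed.

Definition xtail (t : R) : R := int_ab t Q x.

(** The function x extended to the triangle 0 <= t <= r <= Q and by zero elsewhere. Its two iterated
    integrals give the tail of x, with its measurability, and r x(r). *)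
Let tri (q : TR * TR) : \bar R :=
  (if (0 <= q.1) && (q.1 <= q.2) && (q.2 <= Q) then x q.2 else 0)%:E.

Let tri_ge0 q : (0 <= tri q)%E.
Proof. by rewrite lee_fin; case: ifP => // _; exact: xfun_ge0. Qed.

Let measurable_tri : measurable_fun setT tri.
Proof.
apply/measurable_EFinP; apply: measurable_fun_ifT => //.
  apply: measurable_and; last by apply: measurable_fun_ler => //; exact: measurable_snd.
  by apply: measurable_and; apply: measurable_fun_ler => //.
by apply: (measurableT_comp measurable_xfun); exact: measurable_snd.
Qed.

Let mitv (a b : R) : measurable (`[a, b]%classic : set TR).
Proof. exact: measurable_itv. Qed.

Lemma seg_integrable (a b B : R) (f : TR -> R) : measurable_fun `[a, b]%classic f ->
  (forall t, a <= t <= b -> `|f t| <= B) -> mu.-integrable `[a, b] (EFin \o f).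
Proof.
move=> mf fB; apply: measurable_bounded_integrable => //.
- by rewrite /= lebesgue_measure_itv/=; case: ifP => _; rewrite ?ltry// -EFinB ltry.
- exists B; split; first exact: num_real.
  by move=> M BM t /=; rewrite in_itv/= => h; rewrite (le_trans (fB t h))// ltW.
Qed.

Lemma int_seg_cst (a b c : R) : a <= b -> int_ab a b (fun=> c) = c * (b - a).
Proof.
move=> ab; rewrite /int_ab Rintegral_cst//; congr (_ * _).
rewrite /= lebesgue_measure_itv/= lte_fin; have [//|ba] := ltP a b.
by have -> : a = b; [apply/eqP; rewrite eq_le ab|rewrite subrr].
Qed.

Lemma int_seg_le (a b B B' : R) (f g : TR -> R) : measurable_fun `[a, b]%classic f -> measurable_fun `[a, b]%classic g ->
  (forall t, a <= t <= b -> `|f t| <= B) -> (forall t, a <= t <= b -> `|g t| <= B') ->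
  (forall t, a <= t <= b -> f t <= g t) -> int_ab a b f <= int_ab a b g.
Proof.
move=> mf mg fB gB fg; apply: le_Rintegral; [exact: mitv|exact: seg_integrable fB|exact: seg_integrable gB|].
by move=> t /=; rewrite in_itv/=; exact: fg.
Qed.

Let mx (a b : R) : measurable_fun (`[a, b]%classic : set TR) (x : TR -> R).
Proof. exact: measurable_funTS measurable_xfun. Qed.

Let xB t : `|x t| <= 1.
Proof. by rewrite ger0_norm ?xfun_ge0 ?xfun_le1. Qed.

Lemma xtail_ge0 t : 0 <= xtail t.
Proof. by apply: Rintegral_ge0 => r _; exact: xfun_ge0. Qed.

Lemma xtail_le t : t <= Q -> xtail t <= Q - t.
Proof.
move=> tQ; rewrite -[leRHS]mul1r -(int_seg_cst _ tQ).
apply: (@int_seg_le _ _ 1 1) => //.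
- exact: mx.
- by move=> r _; rewrite normr1.
- by move=> r _; exact: xfun_le1.
Qed.

Let tri_xtail t : 0 <= t -> (\int[mu]_r tri (t, r) = (xtail t)%:E)%E.
Proof.
move=> t0; rewrite /xtail /int_ab /Rintegral fineK; last first.
  apply: integrable_fin_num; first exact: mitv.
  by apply: (@seg_integrable _ _ 1); [exact: mx|move=> r _; exact: xB].
rewrite [RHS]integral_mkcond; apply: eq_integral => r _; rewrite /tri /= patchE t0 /=.
by rewrite mem_setE in_itv/=; case: ifP.
Qed.

Let tri_out t : ~~ (0 <= t <= Q) -> (\int[mu]_r tri (t, r) = 0)%E.
Proof.
move=> h; rewrite integral0_eq// => r _; rewrite /tri/=; case: ifP => // /andP[/andP[t0 tr] rQ].
by rewrite t0 (le_trans tr rQ) in h.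
Qed.

Let tri_sw r : (\int[mu]_t tri (t, r) = (if 0 <= r <= Q then r * x r else 0)%:E)%E.
Proof.
case: ifP => [/andP[r0 rQ]|h].
  transitivity (\int[mu]_(t in `[0%R, r]) (cst (x r)%:E t))%E.
    rewrite [RHS]integral_mkcond; apply: eq_integral => t _; rewrite /tri /= patchE rQ andbT.
    by rewrite mem_setE in_itv/=; case: ifP.
  rewrite integral_cst//= lebesgue_measure_itv/= lte_fin.
  have [_|h] := ltP 0 r; first by rewrite -EFinB subr0 -EFinM mulrC.
  by have -> : r = 0 by [apply/eqP; rewrite eq_le h]; rewrite mule0 mul0r.
rewrite integral0_eq// => t _; rewrite /tri/=; case: ifP => // /andP[/andP[t0 tr] rQ].
by rewrite rQ (le_trans t0 tr) in h.
Qed.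

Let measurable_inner : measurable_fun [set: TR] (fun t => \int[mu]_r tri (t, r))%E.
Proof. exact: (@measurable_fun_fubini_tonelli_F _ _ _ _ _ mu tri measurable_tri). Qed.

Lemma measurable_xtail : measurable_fun `[0, Q]%classic (xtail : TR -> R).
Proof.
apply/measurable_EFinP; apply: (eq_measurable_fun (fun t => \int[mu]_r tri (t, r))%E).
  by move=> t; rewrite inE/= in_itv/= => /andP[t0 _]; rewrite tri_xtail.
exact: measurable_funTS measurable_inner.
Qed.

(** Tonelli's theorem on the triangle does the integration by parts, so no regularity of the step
    function x is needed. *)
Lemma int_xtail : int_ab 0 Q (fun t => t * x t) = int_ab 0 Q xtail.
Proof.
rewrite /int_ab /Rintegral; congr fine.
have := @fubini_tonelli _ _ _ _ _ mu mu tri measurable_tri tri_ge0 => /= H.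
transitivity (\int[mu]_r \int[mu]_t tri (t, r))%E.
  rewrite [LHS]integral_mkcond; apply: eq_integral => r _; rewrite tri_sw patchE mem_setE in_itv/=.
  by case: ifP.
rewrite -H [RHS]integral_mkcond; apply: eq_integral => t _; rewrite patchE mem_setE in_itv/=.
case: ifPn => [/andP[t0 _]|h]; first by rewrite tri_xtail.
exact: tri_out.
Qed.

Lemma xtail_anti t t' : 0 <= t -> t <= t' -> xtail t' <= xtail t.
Proof.
move=> t0 tt; rewrite -lee_fin -(tri_xtail t0) -(tri_xtail (le_trans t0 tt)).
have ms s : measurable_fun [set: TR] (fun r => tri (s, r)).
  by apply: (measurableT_comp measurable_tri); exact: measurable_pair1.
apply: ge0_le_integral => // r _; rewrite /tri/= lee_fin t0 (le_trans t0 tt)/=.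
case: ifP => [/andP[h ->]|_]; first by rewrite (le_trans tt h).
by case: ifP => // _; exact: xfun_ge0.
Qed.

End order_parameter.

Section elementary_bounds.
Variable R : realType.

(** Both sides vanish at 1, and ln x - (2 x - x^2 / 2) has derivative (1 - x)^2 / x, which is
    nonnegative. The second-order term is essential when Q lies below the replica symmetric
    value. *)
Lemma ln_le_quadratic (w : R) : 0 < w -> w <= 1 -> ln w <= - ((1 - w) + (1 - w) ^+ 2 / 2).
Proof.
move=> w0; rewrite le_eqVlt => /predU1P[->|w1]; first by rewrite ln1 subrr expr0n mul0r addr0 oppr0.
pose f (x : R) := ln x - (2 * x - x ^+ 2 / 2).
pose df (x : R) := x^-1 - (2 - x).
have dfE (x : R) : 0 < x -> is_derive (x : R) (1 : R) f (df x).
  move=> x0; have dl := is_derive1_ln x0.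
  by rewrite /f; apply: is_derive_eq; rewrite /df /GRing.scale/=; move: (x^-1) => xi; field.
have cf : {within `[w, 1], continuous f}.
  apply: continuous_in_subspaceT => x; rewrite inE/= in_itv/= => /andP[wx _].
  apply/differentiable_continuous/derivable1_diffP.
  by have [] := dfE x (lt_le_trans w0 wx).
have [|c] := @MVT R f df w 1 w1 _ cf.
  by move=> x; rewrite in_itv/= => /andP[wx _]; apply: dfE; exact: lt_trans wx.
rewrite in_itv/= => /andP[wc c1] h.
have c0 : 0 < c by exact: lt_trans wc.
have : 0 <= f 1 - f w.
  rewrite h; apply: mulr_ge0; last by rewrite subr_ge0 ltW.
  have -> : df c = (1 - c) ^+ 2 / c by rewrite /df; field; rewrite gt_eqF.
  by rewrite divr_ge0 ?sqr_ge0// ltW.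
rewrite /f ln1 expr1n => h'; rewrite -subr_ge0 (le_trans h')//; apply: eq_lerR.
by move: (ln w) => l; field.
Qed.

Variables (y b a c : R).
Hypothesis ac : a < c.
Hypothesis ya : 0 < y + b ^+ 2 * a.

Lemma int_inverse_linear :
  int_ab a c (fun t => b ^+ 2 / (y + b ^+ 2 * t) + (y + b ^+ 2 * t)) =
  ln (y + b ^+ 2 * c) - ln (y + b ^+ 2 * a) + y * (c - a) + b ^+ 2 * (c ^+ 2 - a ^+ 2) / 2.
Proof.
pose G (t : R) := ln (y + b ^+ 2 * t) + (y * t + b ^+ 2 / 2 * t ^+ 2).
set g := fun t => _.
have pos (t : R) : a <= t -> 0 < y + b ^+ 2 * t.
  by move=> at_; rewrite (lt_le_trans ya)// lerD2l ler_wpM2l// sqr_ge0.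
have dG (t : R) : a <= t -> is_derive (t : R) (1 : R) G (g t).
  move=> at_; have dl := is_derive1_ln (pos t at_).
  have dl' : is_derive (t : R) (1 : R) (fun t : R => y + b ^+ 2 * t) (b ^+ 2).
    by apply: is_derive_eq; rewrite /GRing.scale/=; ring.
  have dc : is_derive (t : R) (1 : R) (fun t : R => ln (y + b ^+ 2 * t)) (b ^+ 2 * (y + b ^+ 2 * t)^-1).
    by rewrite mulrC; exact: is_derive1_comp.
  rewrite /G; apply: is_derive_eq; rewrite /g /GRing.scale/=; field.
  by rewrite gt_eqF// pos.
have cG (t : R) : a <= t -> {for t, continuous G}.
  by move=> at_; apply/differentiable_continuous/derivable1_diffP; have [] := dG t at_.
rewrite /int_ab /Rintegral (@continuous_FTC2 R g G)//.
- by rewrite /= /G; field.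
- apply: continuous_in_subspaceT => t; rewrite inE/= in_itv/= => /andP[at_ _].
  rewrite /g; apply: cvgD; last by apply: cvgD; [exact: cvg_cst|apply: cvgM; [exact: cvg_cst|exact: cvg_id]].
  apply: cvgM; first exact: cvg_cst.
  apply: cvgV; first by rewrite gt_eqF// pos.
  by apply: cvgD; [exact: cvg_cst|apply: cvgM; [exact: cvg_cst|exact: cvg_id]].
- split.
  + by move=> t; rewrite in_itv/= => /andP[/ltW at_ _]; have [] := dG t at_.
  + exact/cvg_at_right_filter/cG.
  + exact/cvg_at_left_filter/cG/ltW.
- move=> t; rewrite in_itv/= => /andP[/ltW at_ _]; rewrite derive1E.
  by have [_ ->] := dG t at_.
Qed.

End elementary_bounds.

Lemma measurable_fun_inv_pos d (T : measurableType d) (R : realType) (D : set T) (f : T -> R) :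
  (forall x, D x -> 0 < f x) -> measurable_fun D f -> measurable_fun D (fun x => (f x)^-1).
Proof.
move=> f0 mf; apply: (eq_measurable_fun (fun x => expR (- ln (f x)))).
  by move=> x; rewrite inE => Dx; rewrite expRN lnK// posrE f0.
apply: measurableT_comp => //; apply: measurableT_comp => //.
exact: measurableT_comp.
Qed.

Section variational_bound.
Variable R : realType.
Local Notation mu := (@lebesgue_measure R).
Local Notation TR := (measurableTypeR R).
Variables (beta lambda : R) (p : xpar R).
Hypothesis beta0 : 0 < beta.
Hypothesis pX : inX beta lambda p.
Local Notation Q := (xQ p).
Local Notation y := (1 - lambda).
Local Notation v := (1 - lambda + beta ^+ 2 * xQ p).
Local Notation s := (sigma beta lambda (xQ p)).
Local Notation q0 := (qRS beta lambda).
Local Notation M := (Num.max beta (1 - lambda)).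

Let Q0 : 0 <= Q. Proof. by case: pX. Qed.
Let v0 : 0 < v. Proof. by case: pX => _ []. Qed.

Lemma sigma_sqr : s ^+ 2 = v^-1.
Proof. by rewrite /sigma exprVn sqr_sqrtr// ltW. Qed.

Lemma ln_sigma : ln s = - (ln v / 2).
Proof. by rewrite /sigma lnV ?posrE ?sqrtr_gt0// ln_sqrt. Qed.

Let u (t : R) : R := v - beta ^+ 2 * xtail p t.

Let u_gt0 t : 0 <= t <= Q -> 0 < u t.
Proof.
move=> ht; case: pX => _ [_ [_ [_ [_ [_ [_ [_ h]]]]]]].
have := h t ht; rewrite sigma_sqr -/(xtail p t) mulrAC ltr_pdivrMr// mul1r.
by rewrite /u subr_gt0.
Qed.

Let u_ge t : t <= Q -> y + beta ^+ 2 * t <= u t.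
Proof.
move=> tQ; have := xtail_le pX tQ; rewrite /u => h.
have : beta ^+ 2 * xtail p t <= beta ^+ 2 * (Q - t) by rewrite ler_wpM2l ?sqr_ge0.
rewrite mulrBr; lra.
Qed.

Let u_le t : u t <= v.
Proof. by rewrite /u lerBlDr lerDl mulr_ge0 ?sqr_ge0// (xtail_ge0 pX). Qed.

Let u_min t : 0 <= t <= Q -> u 0 <= u t.
Proof.
move=> /andP[t0 tQ]; rewrite /u lerD2l lerN2 ler_wpM2l ?sqr_ge0//.
exact: (xtail_anti pX).
Qed.

Let h (t : R) : R := beta ^+ 2 / u t + u t.

Let u00 : 0 < u 0. Proof. by apply: u_gt0; rewrite lexx Q0. Qed.

Let mu_ : measurable_fun (`[0, Q]%classic : set TR) (u : TR -> R).
Proof.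
apply: measurable_funB => //; apply: measurable_funM => //.
exact: (measurable_xtail pX).
Qed.

Let mh : measurable_fun (`[0, Q]%classic : set TR) (h : TR -> R).
Proof.
apply: measurable_funD => //; apply: measurable_funM => //.
by apply: measurable_fun_inv_pos => // t /=; rewrite in_itv/=; exact: u_gt0.
Qed.

Let hB t : 0 <= t <= Q -> `|h t| <= beta ^+ 2 / u 0 + v.
Proof.
move=> ht; have ut := u_gt0 ht.
rewrite ger0_norm; last by rewrite addr_ge0 ?(ltW ut)// divr_ge0 ?sqr_ge0// ltW.
rewrite lerD//; rewrite ler_wpM2l ?sqr_ge0// lef_pV2 ?posrE//; exact: u_min.
Qed.

Let ih : mu.-integrable `[0, Q] (EFin \o h).
Proof. exact: seg_integrable mh hB. Qed.

Lemma Ahat_h : Ahat beta lambda p =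
  - (ln v / 2) + int_ab 0 Q h / 2 - v * Q / 2 + beta ^+ 2 / 4 * Q ^+ 2.
Proof.
rewrite /Ahat ln_sigma sigma_sqr (int_xtail pX).
have -> : int_ab 0 Q (fun t => (1 - beta ^+ 2 / v * int_ab t Q (xfun p))^-1) =
   int_ab 0 Q (fun t => v * (u t)^-1).
  apply: eq_Rintegral => t; rewrite inE/= in_itv/= => ht.
  have ut := u_gt0 ht; rewrite -/(xtail p t).
  have -> : 1 - beta ^+ 2 / v * xtail p t = u t / v by rewrite /u; field; rewrite gt_eqF.
  by rewrite invfM invrK mulrC.
have mV : measurable_fun (`[0, Q]%classic : set TR) (fun t : TR => (u t)^-1).
  by apply: measurable_fun_inv_pos => // t /=; rewrite in_itv/=; exact: u_gt0.
have iV : mu.-integrable `[0, Q] (EFin \o (fun t => (u t)^-1)).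
  apply: (@seg_integrable _ _ _ (u 0)^-1) => // t ht; have ut := u_gt0 ht.
  by rewrite ger0_norm ?invr_ge0 ?(ltW ut)// lef_pV2 ?posrE//; exact: u_min.
have iX : mu.-integrable `[0, Q] (EFin \o (xtail p)).
  apply: (@seg_integrable _ _ _ Q); first exact: (measurable_xtail pX).
  move=> t /andP[t0 tQ]; rewrite ger0_norm ?(xtail_ge0 pX)//.
  by rewrite (le_trans (xtail_le pX tQ))// lerBlDr lerDl.
have mi : measurable (`[0, Q]%classic : set TR) by exact: measurable_itv.
have ic : mu.-integrable `[0, Q] (EFin \o (fun=> v)).
  by apply: (@seg_integrable _ _ _ `|v|).
have iV' : mu.-integrable `[0, Q] (EFin \o (fun t => beta ^+ 2 * (u t)^-1)) by exact: (integrableZl mi (beta ^+ 2) iV).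
have iX' : mu.-integrable `[0, Q] (EFin \o (fun t => beta ^+ 2 * xtail p t)) by exact: (integrableZl mi (beta ^+ 2) iX).
have iu : mu.-integrable `[0, Q] (EFin \o u).
  apply: (@seg_integrable _ _ _ v) => // t ht.
  by rewrite ger0_norm ?u_le// ltW// u_gt0.
have -> : int_ab 0 Q h = beta ^+ 2 * int_ab 0 Q (fun t => (u t)^-1) + (v * Q - beta ^+ 2 * int_ab 0 Q (xtail p)).
  rewrite /int_ab /h RintegralD//; congr (_ + _).
    by rewrite RintegralZl.
  rewrite /u RintegralB// RintegralZl//; congr (_ - _).
  by have := @int_seg_cst R 0 Q v Q0; rewrite subr0.
rewrite /int_ab RintegralZl//.
move: (ln v) (\int[mu]_(_ in _) xtail p _) (\int[mu]_(_ in _) _) => l X V.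
by field; rewrite gt_eqF.
Qed.

Let h_ge2 t : 0 <= t <= Q -> 2 * beta <= h t.
Proof.
move=> ht; have ut := u_gt0 ht; rewrite /h -subr_ge0.
have -> : beta ^+ 2 / u t + u t - 2 * beta = (u t - beta) ^+ 2 / u t by field; rewrite gt_eqF.
by rewrite divr_ge0 ?sqr_ge0// ltW.
Qed.

Let g (t : R) : R := beta ^+ 2 / (y + beta ^+ 2 * t) + (y + beta ^+ 2 * t).

(** The map u -> beta^2 / u + u increases on [beta, oo), and to the right of [qRS] the linear lower
    bound of u is already at least beta. *)
Let h_geg t : q0 <= t -> t <= Q -> g t <= h t.
Proof.
move=> qt tQ; have t0 : 0 <= t by rewrite (le_trans _ qt)// qRS_ge0.
have ht : 0 <= t <= Q by rewrite t0.
have ut := u_gt0 ht; have := u_ge tQ; rewrite /g /h; set w := y + _.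
have wM : beta <= w.
  apply: (@le_trans _ _ (y + beta ^+ 2 * q0)); last by rewrite lerD2l ler_wpM2l ?sqr_ge0.
  by rewrite qRS_v// le_max lexx.
have w0 : 0 < w by exact: lt_le_trans wM.
move=> wu; rewrite -subr_ge0.
have -> : beta ^+ 2 / u t + u t - (beta ^+ 2 / w + w) = (u t - w) * (u t * w - beta ^+ 2) / (u t * w).
  by field; rewrite !gt_eqF.
apply: divr_ge0; last by apply: mulr_ge0; exact: ltW.
apply: mulr_ge0; rewrite subr_ge0//.
by rewrite expr2 ler_pM// ?(ltW beta0)// (le_trans wM).
Qed.

Let qRS_identities : (beta - y) * q0 = beta ^+ 2 * q0 ^+ 2 /\ beta ^+ 2 * q0 / (2 * M) = beta * q0 / 2.
Proof.
rewrite /qRS; have [hb|hb] := leP beta y.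
  by rewrite !mulr0 expr0n !mulr0 !mul0r.
by split; field; rewrite gt_eqF.
Qed.

Let UB_RS : UB beta lambda q0 = - (ln M / 2) + beta * q0 / 2 + beta ^+ 2 / 4 * q0 ^+ 2.
Proof.
have M0 : 0 < M by rewrite lt_max beta0.
by rewrite /UB /sigma qRS_v// lnV ?posrE ?sqrtr_gt0// ln_sqrt// qRS_identities.2.
Qed.

(** Here v <= beta, and the integrand bound 2 beta is used on all of [0, Q]. The remaining
    polynomial deficit is exactly the quadratic bound on ln(v / beta). *)
Lemma Ahat_ge_small : Q < q0 -> UB beta lambda q0 <= Ahat beta lambda p.
Proof.
move=> Qq; have yb : y < beta.
  by rewrite ltNge; apply/negP => hb; move: Qq; rewrite /qRS hb ltNge Q0.
have ME : M = beta by apply/max_idPl/ltW.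
have qE : q0 = (beta - y) / beta ^+ 2 by rewrite /qRS leNgt yb.
have hI : 2 * beta * Q <= int_ab 0 Q h.
  have := @int_seg_cst R 0 Q (2 * beta) Q0; rewrite subr0 => <-.
  apply: (@int_seg_le R 0 Q `|2 * beta| _ (fun=> 2 * beta) h _ mh _ hB).
  - exact: measurable_cst.
  - by move=> t _; exact: lexx.
  - by move=> t ht; exact: h_ge2.
have vb : v <= beta.
  have qv := qRS_v lambda beta0; rewrite ME in qv.
  by rewrite -[leRHS]qv lerD2l ler_wpM2l ?sqr_ge0// ltW.
have hl : ln v <= ln beta - ((1 - v / beta) + (1 - v / beta) ^+ 2 / 2).
  have := @ln_le_quadratic R (v / beta); rewrite divr_gt0// ler_pdivrMr// mul1r => /(_ erefl vb).
  by rewrite ln_div ?posrE// lerBlDl.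
rewrite Ahat_h UB_RS ME qE -subr_ge0.
have h0 : 0 <= (ln beta - ((1 - v / beta) + (1 - v / beta) ^+ 2 / 2) - ln v) / 2 + (int_ab 0 Q h - 2 * beta * Q) / 2.
  by rewrite addr_ge0// divr_ge0// subr_ge0.
apply: (le_trans h0); apply: eq_lerR; move: (ln v) (ln beta) (int_ab 0 Q h) => a b c.
by field; rewrite gt_eqF.
Qed.

Lemma int_h_split : q0 <= Q -> int_ab 0 Q h = int_ab 0 q0 h + int_ab q0 Q h.
Proof.
move=> qQ; have q00 := qRS_ge0 beta lambda.
have := @Rintegral_itvB R h (BLeft 0) (BRight Q) q0 ih.
rewrite !bnd_simp => /(_ q00 qQ) hs.
have io : mu.-integrable `]q0, Q] (EFin \o h).
  apply: integrableS ih => //.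
  by apply: subset_itvr; rewrite bnd_simp.
by have := Rintegral_itv_obnd_cbnd io; rewrite -hs /int_ab => <-; rewrite addrC subrK.
Qed.

(** Use 2 beta up to [qRS] and the linear lower bound of u beyond it. The second integral produces
    ln v - ln M, which cancels the ln v of the functional and leaves the ln M of the replica
    symmetric value. *)
Lemma Ahat_ge_large : q0 <= Q -> UB beta lambda q0 <= Ahat beta lambda p.
Proof.
move=> qQ; have q00 := qRS_ge0 beta lambda.
have M0 : 0 < M by rewrite lt_max beta0.
have qv := qRS_v lambda beta0.
have sub1 : measurable_fun (`[0, q0]%classic : set TR) (h : TR -> R).
  by apply: measurable_funS mh => //; apply: subset_itvl; rewrite bnd_simp.
have sub2 : measurable_fun (`[q0, Q]%classic : set TR) (h : TR -> R).
  by apply: measurable_funS mh => //; apply: subset_itvr; rewrite bnd_simp.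
have hI1 : 2 * beta * q0 <= int_ab 0 q0 h.
  have := @int_seg_cst R 0 q0 (2 * beta) q00; rewrite subr0 => <-.
  apply: (@int_seg_le R 0 q0 `|2 * beta| (beta ^+ 2 / u 0 + v) (fun=> 2 * beta) h).
  - exact: measurable_cst.
  - exact: sub1.
  - by move=> t _; exact: lexx.
  - by move=> t /andP[t0 tq]; apply: hB; rewrite t0 (le_trans tq qQ).
  - by move=> t /andP[t0 tq]; apply: h_ge2; rewrite t0 (le_trans tq qQ).
have hI2 : ln v - ln M + y * (Q - q0) + beta ^+ 2 * (Q ^+ 2 - q0 ^+ 2) / 2 <= int_ab q0 Q h.
  move: qQ; rewrite le_eqVlt => /predU1P[qE|qQ].
    rewrite -qv qE [leLHS](_ : _ = 0); last by ring.
    apply: Rintegral_ge0 => t; rewrite /= in_itv/= => /andP[qt tQ].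
    by rewrite (le_trans _ (h_ge2 _))// ?mulr_ge0 ?(ltW beta0)// tQ andbT (le_trans q00)// qE.
  have w0 : 0 < y + beta ^+ 2 * q0 by rewrite qv.
  rewrite -qv -(int_inverse_linear qQ w0).
  have gpos t : q0 <= t -> M <= y + beta ^+ 2 * t.
    by move=> qt; rewrite -qv lerD2l ler_wpM2l ?sqr_ge0.
  apply: (@int_seg_le R q0 Q (beta ^+ 2 / M + v) (beta ^+ 2 / u 0 + v)) => //.
  - have ml : measurable_fun (`[q0, Q]%classic : set TR) (fun t : TR => y + beta ^+ 2 * t : R).
      by apply: measurable_funD => //; exact: measurable_funM.
    apply: measurable_funD => //; apply: measurable_funM => //.
    apply: measurable_fun_inv_pos => // t /=; rewrite in_itv/= => /andP[qt _].
    exact: lt_le_trans M0 (gpos t qt).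
  - move=> t /andP[qt tQ]; have wM := gpos t qt; have wp := lt_le_trans M0 wM.
    rewrite ger0_norm; last by rewrite addr_ge0 ?divr_ge0 ?sqr_ge0 ?(ltW wp).
    rewrite lerD//; first by rewrite ler_wpM2l ?sqr_ge0// lef_pV2 ?posrE.
    by rewrite lerD2l ler_wpM2l ?sqr_ge0.
  - by move=> t /andP[qt tQ]; apply: hB; rewrite tQ (le_trans q00).
  - by move=> t /andP[qt tQ]; exact: h_geg.
rewrite Ahat_h UB_RS (int_h_split qQ) -subr_ge0.
have h0 : 0 <= (int_ab 0 q0 h - 2 * beta * q0) / 2 + (int_ab q0 Q h -
   (ln v - ln M + y * (Q - q0) + beta ^+ 2 * (Q ^+ 2 - q0 ^+ 2) / 2)) / 2.
  by rewrite addr_ge0// divr_ge0// subr_ge0.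
apply: (le_trans h0); apply: eq_lerR.
have e1 : beta * q0 = y * q0 + beta ^+ 2 * q0 ^+ 2 by rewrite -qRS_identities.1; ring.
move: e1; move: (ln v) (ln M) (int_ab 0 q0 h) (int_ab q0 Q h) q0 => a b c d q e1.
by rewrite -(mulrA 2 beta q) e1; field.
Qed.

Lemma Ahat_ge : UB beta lambda q0 <= Ahat beta lambda p.
Proof. by have [|] := ltP Q q0; [exact: Ahat_ge_small|exact: Ahat_ge_large]. Qed.

End variational_bound.

Section replica_symmetric_point.
Variable R : realType.
Variables (beta lambda : R).
Hypothesis beta0 : 0 < beta.

Lemma xfun_RS t : xfun (xRS beta lambda) t = 0.
Proof. by rewrite /xfun big1// => a _; case: ifP. Qed.

Lemma int_xfun_RS a b : int_ab a b (xfun (xRS beta lambda)) = 0.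
Proof.
have -> : xfun (xRS beta lambda) = fun=> 0 by apply/funext => t; exact: xfun_RS.
by rewrite /int_ab /Rintegral integral0.
Qed.

Lemma inX_RS : inX beta lambda (xRS beta lambda).
Proof.
have q0 := qRS_ge0 beta lambda.
split=> //; split; first by rewrite qRS_v// lt_max beta0.
do 3 split=> //.
split; first by case.
split; first by move=> a _; rewrite lexx ler01.
split=> [a _|t _]; first exact: lexx.
by rewrite int_xfun_RS mulr0.
Qed.

Lemma Ahat_RS : Ahat beta lambda (xRS beta lambda) = UB beta lambda (qRS beta lambda).
Proof.
have v0 : 0 < 1 - lambda + beta ^+ 2 * qRS beta lambda by rewrite qRS_v// lt_max beta0.
rewrite /Ahat /UB (@sigma_sqr _ _ _ (xRS beta lambda))//; last exact: inX_RS.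
have -> : int_ab 0 (xQ (xRS beta lambda)) (fun t => (1 - beta ^+ 2 * (1 - lambda + beta ^+ 2 * xQ (xRS beta lambda))^-1 *
    int_ab t (xQ (xRS beta lambda)) (xfun (xRS beta lambda)))^-1) = qRS beta lambda.
  transitivity (int_ab 0 (qRS beta lambda) (fun=> 1 : R)).
    by apply: eq_Rintegral => t _; rewrite int_xfun_RS mulr0 subr0 invr1.
  by rewrite int_seg_cst ?qRS_ge0// subr0 mul1r.
have -> : int_ab 0 (xQ (xRS beta lambda)) (fun t => t * xfun (xRS beta lambda) t) = 0.
  transitivity (int_ab 0 (qRS beta lambda) (fun=> 0 : R)); last by rewrite /int_ab /Rintegral integral0.
  by apply: eq_Rintegral => t _; rewrite xfun_RS mulr0.
rewrite /=; move: (ln _) => l; move: v0; move: (qRS beta lambda) => q v0.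
by field; rewrite gt_eqF.
Qed.

End replica_symmetric_point.

Theorem mainTheorem16 (R : realType) (beta lambda : R) (hbeta : 0 < beta) :
  let Ainf := ereal_inf [set (Ahat beta lambda p)%:E | p in inX beta lambda] in
  [/\ (fun N : nat => AN beta lambda N.+1) @ \oo --> Ainf,
      inX beta lambda (xRS beta lambda)
    & (Ahat beta lambda (xRS beta lambda))%:E = Ainf].
Proof.
move=> Ainf.
have AE : (Ahat beta lambda (xRS beta lambda))%:E = Ainf.
  apply/eqP; rewrite eq_le; apply/andP; split.
    by apply: le_ereal_inf_tmp => _ [p pX <-]; rewrite lee_fin Ahat_RS// Ahat_ge.
  by apply: ereal_inf_lbound; exists (xRS beta lambda) => //; exact: inX_RS.
split=> //; last exact: inX_RS.
by rewrite -AE Ahat_RS//; exact: AN_cvg.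
Qed.
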